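(* Let $p_1,p_2,q$ be distinct primes with $p_1\equiv p_2\equiv -q\equiv1\pmod 4$, $k=\mathbb{Q}(\sqrt{p_1p_2q},i)$, $\mathbb{K}_2=k(\sqrt{p_2})$, $\epsilon_{p_1q}=a+b\sqrt{p_1q}$ and $\epsilon_{p_1p_2q}=x+y\sqrt{p_1p_2q}$ with $a,b,x,y\in\mathbb{Z}$. 1. If $x\pm1$ is a square in $\mathbb{N}$ and neither $a+1$ nor $a-1$ is, then $\kappa_{\mathbb{K}_2}=\langle[\mathcal H_3],[\mathcal H_4],[\mathcal H_1\mathcal H_2]\rangle$. 2. If $a\pm1$ and ($p_2(x\pm1)$ or $2p_2(x\pm1)$) are squares in $\mathbb{N}$, then $\kappa_{\mathbb{K}_2}=\langle[\mathcal H_3]\rangle$. 3. If neither $a+1$ nor $a-1$ is a square in $\mathbb{N}$ and $p_2(x\pm1)$ or $2p_2(x\pm1)$ is, then $\kappa_{\mathbb{K}_2}=\langle[\mathcal H_3],[\mathcal H_1\mathcal H_2]\rangle$. 4. In all other cases, $\kappa_{\mathbb{K}_2}=\langle[\mathcal H_3],[\mathcal H_4]\rangle$.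
   Context: $i=\sqrt{-1}$; $\epsilon_m>1$ is the fundamental unit of $\mathbb{Q}(\sqrt m)$. For integers $c,u$, ''$c(u\pm1)$ is a square in $\mathbb{N}$'' means at least one of $c(u+1)$, $c(u-1)$ is the square of a natural number. Write $p_1=e^2+4f^2$, $p_2=g^2+4h^2$ ($e,f,g,h\in\mathbb{N}$), $\pi_1=e+2if$, $\pi_2=e-2if$, $\pi_3=g+2ih$, $\pi_4=g-2ih$; $\mathcal H_j$ is the prime ideal of $k$ above $\pi_j$ and $[\cdot]$ denotes ideal class in $k$. $\kappa_{\mathbb{K}_2}$ is the kernel of the map $\mathrm{Cl}(k)\to\mathrm{Cl}(\mathbb{K}_2)$ induced by extension of ideals. *)

(* Defs.v *)
From HB Require Import structures.
From mathcomp Require Import all_boot all_order all_algebra all_field.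
From mathcomp Require Import all_classical.

Set Implicit Arguments.
Unset Strict Implicit.
Unset Printing Implicit Defensive.

Import Order.TTheory GRing.Theory Num.Theory.

Local Open Scope classical_set_scope.
Local Open Scope ring_scope.

(* Number fields are realised as subfields of algC, the field of algebraic
   numbers; a subfield or an ideal is the set of its elements. *)

Definition field_gen (S : set algC) : set algC :=
  smallest (fun F : set algC => divring_closed (mem F)) S.

Definition adjoin (K : set algC) (z : algC) : set algC := field_gen (z |` K).

Definition Qsqrt (m : nat) : set algC := field_gen [set sqrtC m%:R].

Definition Qi : set algC := field_gen [set 'i].

Definition int_ring (K : set algC) : set algC := K `&` [set z | z \in Aint].

Definition is_unit (K : set algC) (u : algC) : Prop :=
  int_ring K u /\ exists2 v, int_ring K v & u * v = 1.

(* In the order of algC, 1 < eps entails that eps is real. *)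
Definition fundamental_unit (K : set algC) (eps : algC) : Prop :=
  [/\ is_unit K eps, 1 < eps &
      forall u, is_unit K u -> exists n : int, u = eps ^ n \/ u = - eps ^ n].

Section Ideals.
Variable K : set algC.

Definition is_ideal (I : set algC) : Prop :=
  [/\ I `<=` int_ring K,
      I 0,
      forall x y, I x -> I y -> I (x + y) &
      forall r x, int_ring K r -> I x -> I (r * x)].

Definition nz_ideal (I : set algC) : Prop := is_ideal I /\ I <> [set 0].

Definition principal (a : algC) : set algC := [set a * r | r in int_ring K].

Definition ideal_mul (I J : set algC) : set algC :=
  smallest is_ideal [set x * y | x in I & y in J].

Definition prime_ideal (P : set algC) : Prop :=
  [/\ nz_ideal P, P <> int_ring K &
      forall x y, int_ring K x -> int_ring K y -> P (x * y) -> P x \/ P y].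

(* Every class of fractional ideals contains a nonzero integral ideal, so Cl(K)
   is the set of nonzero integral ideals modulo I ~ J <-> a I = b J for some
   nonzero integers a, b of K. *)
Definition ideal_equiv (I J : set algC) : Prop :=
  exists a b, [/\ int_ring K a, int_ring K b, a != 0, b != 0 &
                  [set a * x | x in I] = [set b * x | x in J]].

Definition ideal_class (I : set algC) : set (set algC) :=
  [set J | nz_ideal J /\ ideal_equiv I J].

Definition Cl : set (set (set algC)) := [set ideal_class I | I in nz_ideal].

Definition class_one : set (set algC) := ideal_class (int_ring K).

Definition class_mul (A B : set (set algC)) : set (set algC) :=
  [set J | exists I1 I2, [/\ A I1, B I2 & ideal_class (ideal_mul I1 I2) J]].

Definition Cl_subgroup (G : set (set (set algC))) : Prop :=
  [/\ G `<=` Cl,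
      G class_one,
      forall A B, G A -> G B -> G (class_mul A B) &
      forall A, G A -> exists2 B, G B & class_mul A B = class_one].

Definition Cl_gen (S : set (set (set algC))) : set (set (set algC)) :=
  smallest Cl_subgroup S.

End Ideals.

Definition ideal_ext (L I : set algC) : set algC := smallest (is_ideal L) I.

(* The common value of the class of I O_L, for I in the class A; K is a
   subfield of L. *)
Definition class_ext (L : set algC) (A : set (set algC)) : set (set algC) :=
  [set J | exists2 I, A I & ideal_class L (ideal_ext L I) J].

Definition cap_kernel (K L : set algC) : set (set (set algC)) :=
  [set A | Cl K A /\ class_ext L A = class_one L].

(* P is a prime ideal of K lying above the prime pi of Z[i]. *)
Definition prime_lying_over (K : set algC) (pi : algC) (P : set algC) : Prop :=
  prime_ideal K P /\ P `&` int_ring Qi = principal Qi pi.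

Definition nat_square (u : int) : Prop := exists n : nat, u = n%:Z ^+ 2.

Definition square_pm (c u : int) : Prop :=
  nat_square (c * (u + 1)) \/ nat_square (c * (u - 1)).

(* Main.v *)
From HB Require Import structures.
Require Import Defs.
From mathcomp Require Import all_boot all_order all_algebra all_field.
From mathcomp Require Import all_classical.
From mathcomp Require Import zify ring lra.

Set Implicit Arguments.
Unset Strict Implicit.
Unset Printing Implicit Defensive.

Import Order.TTheory GRing.Theory Num.Theory.

(** Write [p = p2], [m = p1 q], [d = p m], and regard [L = K_2] as the biquadratic
    extension of [F = Q(i)] with intermediate fields [F1 = F(sqrt p)],
    [F2 = F(sqrt m)] and [k = F(sqrt d)].  If an ideal [I] of [k] becomes principal
    in [L], say generated by [al], then [I^2] is generated by [be = N_{L/k}(al)]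
    and [al^2 = be * eta] for a unit [eta] of [L].  The norm of [be] to [F] is a
    square: its squarefree part divides both [p] and [m], and [F1] has no unit of
    norm [i] or [-i].  By Hilbert 90 we get [be = t * nu^2] with [t] a squarefree
    Gaussian integer, which must divide [d]; so the class of [I] is that of the
    ideal [(t, sqrt d)], a product of ramified primes.  Thus the kernel is the set of
    classes of [(t, sqrt d)] for the divisors [t] of [d] that are a unit times a
    square in [L].  Those [t] are: [pi_3] and [pi_4] always, because of the unit of
    norm [-1] of [Q(sqrt p)]; never a [t] containing exactly one of [pi_1], [pi_2],
    because the conjugate of [eta] is a root of unity times [eta]; and [p1] according
    to whether [eps_m] is [p1] or [2] up to squares.  Finally [(t, sqrt d)] is
    principal in [k] when [t] is a unit times a square there, which is read off
    [eps_d ~ 2 (x + 1)]. *)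

(** * Squares and the Pell equation *)

(** The argument neither determines the unit group of [L] nor factors ideals into primes. Ideals are
    compared through their squares: an integer whose square is a multiple of [c^2] is a multiple of
    [c], so an ideal with square [(c^2)] is [(c)], and an ideal of [k] with square [(t)], for [t]
    dividing [d], is [(t, sqrt d)]. A unit [eta] of [L] is seen only through its norms [N1], [N2],
    [N3] to [F1], [F2], [k], by the identity [eta^2 * sp N1 = N2 * N3], where [sp] generates the
    group of [L/F2]. In [Q(i, sqrt n)], as soon as [sqrt 3] is absent, the square of a unit is up to
    sign its norm to [Q(i)] times the square of its absolute value, and the latter is a positive
    unit of [Q(sqrt n)], hence a power of the fundamental unit. The identity [2 = -i (1 + i)^2]
    recurs: modulo squares [2], [i] and [-i] coincide, and since [2] is not a square in [L], neither
    are [i] and [-i]. The congruence [p = 1 mod 4] makes [(1 + sqrt p) / 2] an integer of trace 1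
    over [k], which is how an ideal of [k] is recovered from its extension to [L]. *)

Definition nsq (n : nat) : Prop := exists c, n = (c ^ 2)%N.

Lemma nsq_even_logn n : (0 < n)%N ->
  (forall l, prime l -> ~~ odd (logn l n)) -> nsq n.
Proof.
elim/ltn_ind: n => n IH n0 ev.
have [n1|n1] := leqP n 1; first by exists 1%N; lia.
have pl := pdiv_prime n1; set l := pdiv n in pl.
have ll : (1 < logn l n)%N.
  have : (0 < logn l n)%N by rewrite logn_gt0 mem_primes pl n0 pdiv_dvd.
  by move: (ev l pl); case: (logn l n) => [|[|]].
have /dvdnP[r Er] : (l ^ 2 %| n)%N.
  by apply: dvdn_trans (pfactor_dvdnn l n); rewrite dvdn_exp2l.
have r0 : (0 < r)%N by move: n0; rewrite Er muln_gt0 => /andP[].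
have l1 := prime_gt1 pl.
have [|//|t pt|c Ec] := IH r.
- by rewrite Er -mulnn; nia.
- have := ev t pt; rewrite Er lognM ?expn_gt0 ?(ltnW l1) // lognX oddD.
  by rewrite oddM /= addbF.
by exists (c * l)%N; rewrite expnMn -Ec.
Qed.

Lemma nsq_prime_mul l n : prime l -> ~~ (l %| n)%N -> ~ nsq (l * n).
Proof.
move=> pl nd [c E].
have n0 : (0 < n)%N by case: n nd {E} => //; rewrite dvdn0.
have := congr1 (logn l) E.
rewrite (lognM _ (prime_gt0 pl) n0) logn_prime // eqxx lognX.
by rewrite (lognE l n) (negbTE nd) andbF andbF; lia.
Qed.

(** * Existence of Pell solutions by Conway's river *)

Section Pell.
Local Open Scope ring_scope.
Variable n : nat.
Hypothesis n_gt1 : (1 < n)%N.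
Hypothesis n_nsq : ~ nsq n.

(** A triple stands for the form [a X^2 + 2b XY + c Y^2], which is [X^2 - n Y^2] written in another
    basis. A step replaces one basis vector by the sum of the two, where the form takes the value
    [t], choosing the vector so that [a] and [c] keep opposite signs: this walks along Conway's
    river. *)
Definition river := (int * int * int)%type.

Definition river_step (v : river) : river :=
  let: (a, b, c) := v in
  let t := a + 2 * b + c in
  if t < 0 then (a, a + b, t) else (t, b + c, c).

Definition on_river (v : river) :=
  let: (a, b, c) := v in [/\ 0 < a, c < 0 & b ^+ 2 - a * c = n%:Z].

Lemma int_sqr_nsq (z : int) : z ^+ 2 = n%:Z -> False.
Proof.
by move=> E; apply: n_nsq; exists `|z|%N; move: E; rewrite !expr2 -mulnn; lia.
Qed.

(** The value [t = 0] is excluded because it would give [n = (a + b)^2]. *)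
Lemma on_river_step v : on_river v -> on_river (river_step v).
Proof.
case: v => [[a b] c] [a0 c0 E] /=.
have t0 : a + 2 * b + c <> 0.
  move=> t0; apply: (@int_sqr_nsq (a + b)); rewrite -E.
  have -> : c = - a - 2 * b by lia.
  ring.
case: ltP => H; split=> //; try lia; rewrite -E; ring.
Qed.

(** The new form takes at [(1, -1)] the value of the discarded coefficient, [c < 0] in one branch
    and [a > 0] in the other, so its sign tells which branch to undo. *)
Lemma river_step_inj u v : on_river u -> on_river v ->
  river_step u = river_step v -> u = v.
Proof.
case: u => [[a b] c] [a0 c0 _]; case: v => [[a' b'] c'] [a0' c0' _] /=.
case: ltP => H; case: ltP => H' [E1 E2 E3]; [|exfalso|exfalso|]; try lia;
  congr (_, _, _); lia.
Qed.

Definition river0 : river := (1, 0, - n%:Z).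

Lemma on_river_iter k : on_river (iter k river_step river0).
Proof.
elim: k => [|k IH]; last exact: on_river_step.
by split; lia.
Qed.

(** With [a > 0 > c], the equation [b^2 - a c = n] bounds all three coefficients by [n]. The river
    thus has finitely many states, and an injective step on them must come back to the start. *)
Lemma river_returns : exists2 k, (0 < k)%N & iter k river_step river0 = river0.
Proof.
(* The entry [b] ranges over [[-n, n]]; the shift by [n] makes it a natural number below
   [2 n + 1]. *)
pose code (v : river) : 'I_(n.*2.+1) * 'I_(n.*2.+1) * 'I_(n.*2.+1) :=
  let: (a, b, c) := v in
  (inord (absz a), inord (absz (b + n%:Z)), inord (absz c)).
have code_inj u v : on_river u -> on_river v -> code u = code v -> u = v.
  case: u => [[a b] c] [a0 c0 E]; case: v => [[a' b'] c'] [a0' c0' E'] /= [].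
  have bnd (x y z : int) : 0 < x -> z < 0 -> y ^+ 2 - x * z = n%:Z ->
     [/\ (`|x| <= n)%N, (`|z| <= n)%N, - n%:Z <= y & y <= n%:Z].
    move=> x0 z0 Exyz; have y2 : 0 <= y ^+ 2 by rewrite sqr_ge0.
    by split; nia.
  have [h1 h2 h3 h4] := bnd _ _ _ a0 c0 E.
  have [h1' h2' h3' h4'] := bnd _ _ _ a0' c0' E'.
  move=> /(congr1 val) /=; rewrite !inordK; [|lia..] => Ea.
  move=> /(congr1 val) /=; rewrite !inordK; [|lia..] => Eb.
  move=> /(congr1 val) /=; rewrite !inordK; [|lia..] => Ec.
  by congr (_, _, _); lia.
pose N := #|{: 'I_(n.*2.+1) * 'I_(n.*2.+1) * 'I_(n.*2.+1)}|.
pose f (i : 'I_N.+1) := code (iter i river_step river0).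
have /injectivePn[i [j ij Eij]] : ~~ injectiveb f.
  apply/injectiveP => /leq_card; rewrite card_ord -/N; lia.
wlog lt_ij : i j ij Eij / (i < j)%N.
  move=> W; case: (ltngtP i j) => [lt|lt|E]; first exact: (W i j).
    by apply: (W j i); rewrite 1?eq_sym.
  by case/eqP: ij; apply: val_inj.
exists (j - i)%N; first by rewrite subn_gt0.
have {Eij} : iter (0 + i) river_step river0 = iter (j - i + i) river_step river0.
  by rewrite subnK ?(ltnW lt_ij) //; apply: code_inj => //; apply: on_river_iter.
set r := (j - i)%N; elim: {lt_ij ij}(nat_of_ord i) => [|u IH]; first by rewrite !addn0 /=.
rewrite !addnS !iterS => /river_step_inj E; apply: IH; apply: E; exact: on_river_iter.
Qed.

(** [M] holds the two basis vectors [(x1, y1)] and [(x2, y2)] in the original coordinates. As long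
    as [y1 = 0] only the second vector has moved and [b] has grown by 1 at each of the [k] steps; a
    return to [b = 0] after [k > 0] steps therefore forces [y1 > 0], that is, a nontrivial
    solution. *)
Definition river_mx (k : nat) (v : river) (M : nat * nat * nat * nat) : Prop :=
  let: (a, b, c) := v in let: (x1, y1, x2, y2) := M in
  [/\ a = x1%:Z ^+ 2 - n%:Z * y1%:Z ^+ 2,
      b = x1%:Z * x2%:Z - n%:Z * (y1%:Z * y2%:Z),
      c = x2%:Z ^+ 2 - n%:Z * y2%:Z ^+ 2,
      (0 < y2)%N &
      (0 < y1)%N \/ a = 1 /\ b = k%:Z].

Lemma river_mx_iter k : exists M, river_mx k (iter k river_step river0) M.
Proof.
elim: k => [|k [[[[x1 y1] x2] y2]]].
  by exists (1, 0, 0, 1)%N => /=; split => //; try (right; split=> //); ring.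
rewrite iterS; case: (iter _ _ _) => [[a b] c] /= [Ea Eb Ec y20 H].
case: ltP => Ht.
  exists (x1, y1, x1 + x2, y1 + y2)%N; split; rewrite ?PoszD ?Ea ?Eb ?Ec; try ring.
    lia.
  case: H => [H|[H1 H2]]; [by left|right]; split=> //; lia.
exists (x1 + x2, y1 + y2, x2, y2)%N; split; rewrite ?PoszD ?Ea ?Eb ?Ec; try ring => //.
  by [].
by left; lia.
Qed.

Lemma pell_exists : exists x y : nat, (0 < y)%N /\ (x ^ 2 = n * y ^ 2 + 1)%N.
Proof.
have [k k0 E] := river_returns.
have [[[[x1 y1] x2] y2]] := river_mx_iter k; rewrite E => -[Ea Eb _ _ H].
exists x1, y1; split.
  by case: H => // -[_ H]; lia.
by move: Ea; rewrite !expr2 -!mulnn; lia.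
Qed.

End Pell.

Lemma coprime_mul_sqr (u v c : nat) : (0 < u)%N -> (0 < v)%N ->
  coprime u v -> (u * v = c ^ 2)%N -> nsq u.
Proof.
move=> u0 v0 cop E; apply: nsq_even_logn => // l pl.
have := congr1 (logn l) E; rewrite lognM // lognX mulnC muln2 => El.
have [lu|lu] := boolP (l %| u)%N; last by rewrite lognE pl u0 (negbTE lu).
suff lv : logn l v = 0%N by rewrite -[logn l u]addn0 -lv El odd_double.
rewrite lognE pl v0 /=; case: ifP => // lv.
by have := dvdn_gcd l u v; rewrite lu lv (eqP cop) Euclid_dvd1.
Qed.

(* Descent on the Pell equation: the least solution of [x^2 = p y^2 + 1] splits
   as [(x-1)/2 * (x+1)/2 = p (y/2)^2], and one of the two ways of distributing
   [p] gives a smaller solution. *)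
Lemma negative_pell p : prime p -> p %% 4 = 1%N ->
  exists s t : nat, (s ^ 2 + 1 = p * t ^ 2)%N.
Proof.
move=> pp p4; have p1 := prime_gt1 pp.
have pns : ~ nsq p.
  by rewrite -[p]muln1; apply: nsq_prime_mul => //; rewrite gtnNdvd.
have [x [y [y0 E]]] := pell_exists p1 pns.
elim/ltn_ind: y x y0 E => y IH x y0 E.
have m4 z : (z ^ 2 %% 4 = (if odd z then 1 else 0))%N.
  rewrite -[in LHS](odd_double_half z); case: (odd z) => /=.
    by rewrite -mulnn -muln2; nia.
  by rewrite -mulnn -muln2; nia.
(* Modulo 4 the equation reads [x^2 = y^2 + 1]. *)
have ox : odd x /\ ~~ odd y.
  by move: (m4 x) (m4 y); case: (odd x); case: (odd y) => // hx hy; nia.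
case: ox => ox oy.
set u := (x./2)%N; set w := (y./2)%N.
have Ex : x = (u.*2.+1)%N by rewrite -(odd_double_half x) ox.
have Ey : y = (w.*2)%N by rewrite -(odd_double_half y) (negbTE oy).
have Euw : (u * u.+1 = p * w ^ 2)%N.
  by move: E; rewrite Ex Ey -!mulnn -!muln2; nia.
have w0 : (0 < w)%N by lia.
have u0 : (0 < u)%N by case: u Euw {Ex} => //; rewrite -mulnn; nia.
have p0 : (0 < p)%N by lia.
have cop : coprime u u.+1 by exact: coprimenS.
have : (p %| u * u.+1)%N by rewrite Euw dvdn_mulr.
rewrite Euclid_dvdM // => /orP[/dvdnP[v Ev]|/dvdnP[v Ev]].
- have v0 : (0 < v)%N by move: u0; rewrite Ev muln_gt0 => /andP[].
  have Evu : (v * u.+1 = w ^ 2)%N.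
    move: Euw; rewrite {1}Ev => /eqP; rewrite [(v * p)%N]mulnC -mulnA.
    by rewrite eqn_pmul2l // => /eqP.
  have cv : coprime v u.+1.
    by move: cop; rewrite {1}Ev coprimeMl => /andP[].
  have [t Et] := coprime_mul_sqr v0 (ltn0Sn u) cv Evu.
  have [r Er] : nsq u.+1.
    apply: (@coprime_mul_sqr u.+1 v w) => //; first by rewrite coprime_sym.
    by rewrite mulnC.
  have t0 : (0 < t)%N by move: v0; rewrite Et -mulnn muln_gt0 => /andP[].
  apply: (IH t _ r) => //; last by rewrite -Er -Et mulnC -Ev addn1.
  have : (t ^ 2 <= w ^ 2)%N by rewrite -Evu Et leq_pmulr.
  by rewrite leq_exp2r //; lia.
(* Here [u = r^2] and [u + 1 = p t^2], which is the equation with [-1]. The previous case gave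
   [r^2 = p t^2 + 1] with [t <= w < y]. *)
- have v0 : (0 < v)%N by case: v Ev => //.
  have Evu : (u * v = w ^ 2)%N.
    move: Euw; rewrite Ev => /eqP; rewrite mulnA [(_ * p)%N]mulnC.
    by rewrite eqn_pmul2l // => /eqP.
  have cv : coprime u v.
    by move: cop; rewrite Ev coprimeMr => /andP[].
  have [r Er] := coprime_mul_sqr u0 v0 cv Evu.
  have [t Et] : nsq v.
    apply: (@coprime_mul_sqr v u w) => //; first by rewrite coprime_sym.
    by rewrite mulnC.
  by exists r, t; rewrite -Er -Et mulnC -Ev addn1.
Qed.

Local Open Scope classical_set_scope.
Local Open Scope ring_scope.

Local Notation Zi := (int_ring Qi).

(** * Subfields of algC and quadratic extensions *)

Definition subfield (K : set algC) : Prop :=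
  [/\ K 1, forall x y, K x -> K y -> K (x - y) &
      forall x y, K x -> K y -> K (x / y)].

Lemma subfieldP (K : set algC) : divring_closed (mem K) <-> subfield K.
Proof.
split=> -[K1 KB KD]; split.
- by move: K1; rewrite inE.
- by move=> x y Kx Ky; have := KB x y; rewrite !inE; apply.
- by move=> x y Kx Ky; have := KD x y; rewrite !inE; apply.
- by rewrite inE.
- by move=> x y; rewrite !inE; apply: KB.
- by move=> x y; rewrite !inE; apply: KD.
Qed.

Section Subfield.
Variables (K : set algC) (Kf : subfield K).

Lemma sf1 : K 1. Proof. by case: Kf. Qed.
Lemma sfB x y : K x -> K y -> K (x - y). Proof. by case: Kf => _ /(_ x y). Qed.
Lemma sf_div x y : K x -> K y -> K (x / y). Proof. by case: Kf => _ _ /(_ x y). Qed.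
Lemma sf0 : K 0. Proof. by rewrite -(subrr 1); apply: sfB; apply: sf1. Qed.
Lemma sfN x : K x -> K (- x).
Proof. by move=> Kx; rewrite -sub0r; apply: sfB => //; apply: sf0. Qed.
Lemma sfD x y : K x -> K y -> K (x + y).
Proof. by move=> Kx Ky; rewrite -[y]opprK; apply: sfB => //; apply: sfN. Qed.
Lemma sfV x : K x -> K x^-1.
Proof. by move=> Kx; rewrite -div1r; apply: sf_div => //; apply: sf1. Qed.
Lemma sfM x y : K x -> K y -> K (x * y).
Proof. by move=> Kx Ky; rewrite -[y]invrK; apply: sf_div => //; apply: sfV. Qed.
Lemma sf_nat n : K n%:R.
Proof. by elim: n => [|n IH]; rewrite ?mulrS; [apply: sf0|apply: sfD => //; apply: sf1]. Qed.
Lemma sf_int (z : int) : K z%:~R.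
Proof. by case: z => n; rewrite ?NegzE ?mulrNz -?pmulrn; try apply: sfN; apply: sf_nat. Qed.
Lemma sfX x n : K x -> K (x ^+ n).
Proof. by move=> Kx; elim: n => [|n IH]; rewrite ?exprS; [apply: sf1|apply: sfM]. Qed.
Lemma sfXz x (n : int) : K x -> K (x ^ n).
Proof. by move=> Kx; case: n => n; rewrite ?NegzE -?exprnP -?exprnN; [|apply: sfV]; apply: sfX. Qed.
Lemma sf_rat x : x \in Crat -> K x.
Proof.
case/CratP=> a ->; rewrite /ratr.
by apply: sf_div; apply: sf_int.
Qed.
Lemma sf_muln x n : K x -> K (x *+ n).
Proof. by move=> Kx; rewrite -mulr_natr; apply: sfM => //; apply: sf_nat. Qed.
End Subfield.

Ltac sf := try assumption; lazymatch goal with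
  | |- _ = _ => idtac
  | |- ?K (?x + - ?y) => apply: (@sfB K); sf
  | |- ?K (?x + ?y) => apply: (@sfD K); sf
  | |- ?K (- ?y) => apply: (@sfN K); sf
  | |- ?K (?x / ?y) => apply: (@sf_div K); sf
  | |- ?K (?x * ?y) => apply: (@sfM K); sf
  | |- ?K (?x^-1) => apply: (@sfV K); sf
  | |- ?K (?x ^+ ?y) => apply: (@sfX K); sf
  | |- ?K (?x ^ ?y) => apply: (@sfXz K); sf
  | |- ?K (?n%:~R) => apply: (@sf_int K); sf
  | |- ?K 1 => apply: (@sf1 K); sf
  | |- ?K 0 => apply: (@sf0 K); sf
  | |- ?K (?n%:R) => apply: (@sf_nat K); sf
  | |- ?K (?x *+ ?n) => apply: (@sf_muln K); sf
  | |- subfield _ => try by []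
  | |- _ => idtac end.

Definition quad (K : set algC) (w : algC) : set algC :=
  [set z | exists a b, [/\ K a, K b & z = a + b * w]].

Section Quad.
Variables (K : set algC) (w : algC) (Kf : subfield K) (Kw2 : K (w ^+ 2)).

Lemma quadI a b : K a -> K b -> quad K w (a + b * w).
Proof. by exists a, b. Qed.

Lemma quad_base a : K a -> quad K w a.
Proof. by move=> Ka; exists a, 0; split=> //; [exact: sf0|ring]. Qed.

Lemma quad_gen : quad K w w.
Proof. by exists 0, 1; split; [exact: sf0|exact: sf1|ring]. Qed.

(** [w] is allowed to lie in [K], so the norm of a nonzero element may vanish; in that case [w] is a
    quotient of elements of [K] and the quotient to be formed is already in [K]. *)
Lemma quad_subfield : subfield (quad K w).
Proof.
split; first by apply: quad_base; sf.
  move=> _ _ [a [b [Ka Kb ->]]] [c [e [Kc Ke ->]]].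
  by exists (a - c), (b - e); split; sf; ring.
move=> _ _ [a [b [Ka Kb ->]]] [c [e [Kc Ke ->]]].
have [E|N0] := eqVneq (c ^+ 2 - e ^+ 2 * w ^+ 2) 0.
  have {}E : (c - e * w) * (c + e * w) = 0 by rewrite -E; ring.
  have [->|N0] := eqVneq (c + e * w) 0.
    by rewrite invr0 mulr0; apply: quad_base; sf.
  move/eqP: E; rewrite mulf_eq0 (negbTE N0) orbF subr_eq0 => /eqP Ec.
  have [e0|e0] := eqVneq e 0.
    by move: N0; rewrite Ec e0 !mul0r addr0 eqxx.
  have Kw : K w by rewrite -[w](mulKf e0) mulrC -Ec; sf.
  by apply: quad_base; sf.
exists ((a * c - b * e * w ^+ 2) / (c ^+ 2 - e ^+ 2 * w ^+ 2)),
       ((b * c - a * e) / (c ^+ 2 - e ^+ 2 * w ^+ 2)); split; try by sf.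
have N1 : c + e * w != 0.
  by apply: contraNneq N0 => E; apply/eqP; transitivity ((c - e * w) * (c + e * w)); [ring|rewrite E mulr0].
by field; rewrite exprMn N1 N0.
Qed.

(** Kummer theory in degree 2: if [(a + b w)^2] is in [K], then so is [2 a b w], hence [a = 0],
    [b = 0], or [w] itself is in [K]. *)
Lemma quad_kummer r z : K r -> quad K w z -> z ^+ 2 = r ->
  exists2 c, K c & c ^+ 2 = r \/ c ^+ 2 = r * w ^+ 2.
Proof.
move=> Kr [a [b [Ka Kb Ez]]] Er.
have [b0|b0] := eqVneq b 0.
  by exists a => //; left; rewrite -Er Ez b0 mul0r addr0.
have [a0|a0] := eqVneq a 0.
  by exists (b * w ^+ 2); [sf|right]; rewrite -Er Ez a0; ring.
exists z; last by left.
have -> : z = a + b * w by [].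
suff Kw : K w by sf.
have -> : w = (r - a ^+ 2 - b ^+ 2 * w ^+ 2) / (2 * a * b).
  by rewrite -Er Ez; field; rewrite a0 b0.
by sf.
Qed.

Lemma quad_conj_sum (nu : {rmorphism algC -> algC}) :
  (forall x, K x -> nu x = x) -> nu w = - w ->
  forall z, quad K w z -> [/\ quad K w (nu z), K (z + nu z), K (z * nu z),
    nu (nu z) = z & nu z = z -> K z].
Proof.
move=> nuK nuw _ [a [b [Ka Kb ->]]].
rewrite rmorphD rmorphM /= (nuK a) // (nuK b) // nuw mulrN; split.
- by exists a, (- b); split; sf; ring.
- by have -> : a + b * w + (a - b * w) = 2 * a by [ring]; sf.
- have -> : (a + b * w) * (a - b * w) = a ^+ 2 - b ^+ 2 * w ^+ 2 by ring.
  by sf.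
- by rewrite rmorphB rmorphM /= (nuK a) // (nuK b) // nuw; ring.
- move=> E; have : 2 * (b * w) = 0 by rewrite -[RHS](subrr (a + b * w)) -{2}E; ring.
  by move/eqP; rewrite mulf_eq0 pnatr_eq0 /= => /eqP ->; rewrite addr0.
Qed.

End Quad.

Lemma field_gen_min S K : subfield K -> S `<=` K -> field_gen S `<=` K.
Proof. by move=> Kf SK; apply: smallest_sub => //; apply/subfieldP. Qed.

Lemma field_gen_subfield S : subfield (field_gen S).
Proof.
split=> [|x y Fx Fy|x y Fx Fy] F [/subfieldP Ff SF]; first exact: sf1.
  by apply: sfB => //; [apply: Fx|apply: Fy]; split=> //; apply/subfieldP.
by apply: sf_div => //; [apply: Fx|apply: Fy]; split=> //; apply/subfieldP.
Qed.

Lemma field_gen_sub S : S `<=` field_gen S.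
Proof. by move=> x Sx F [_]; apply. Qed.

Lemma quad_eq_field K w S : subfield K -> K (w ^+ 2) ->
  (forall x, K x -> field_gen S x) -> field_gen S w -> S `<=` quad K w ->
  field_gen S = quad K w.
Proof.
move=> Kf Kw2 KS Sw SK; apply/seteqP; split.
  by apply: field_gen_min => //; apply: quad_subfield.
have Sf := field_gen_subfield S.
by move=> _ [a [b [/KS Sa /KS Sb ->]]]; sf.
Qed.

Definition CratS : set algC := [set x | x \in Crat].

Lemma CratS_subfield : subfield CratS.
Proof.
split=> [|x y|x y]; rewrite /CratS /=; first exact: rpred1.
  exact: rpredB.
exact: rpred_div.
Qed.

Lemma Fadjoin_seq_image (Qs : fieldExtType rat) (QsC : {rmorphism Qs -> algC})
    (K : set algC) (s : seq Qs) : subfield K ->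
  (forall x, x \in s -> K (QsC x)) ->
  forall x, x \in <<1 & s>>%VS -> K (QsC x).
Proof.
move=> Kf; elim/last_ind: s => [|s y IH] sK x.
  rewrite Fadjoin_nil => /vlineP[a ->].
  by apply: sf_rat => //; rewrite alg_num_field fmorph_rat; apply: Crat_rat.
rewrite adjoin_rcons => /Fadjoin_polyP[p ps ->].
rewrite horner_coef rmorph_sum /=.
apply: (big_ind K); [exact: sf0|by move=> *; apply: sfD|move=> i _].
rewrite rmorphM rmorphXn /=; apply: sfM => //.
  apply: IH; last exact: (polyOverP ps).
  by move=> z zs; apply: sK; rewrite mem_rcons inE zs orbT.
by apply: sfX => //; apply: sK; rewrite mem_rcons mem_head.
Qed.

(** In the number field generated by [s] and [w], the minimal polynomial of [w] over [Q(s)] is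
    [X^2 - w^2], because [w] is not in [K]. Sending [w] to [-w] is then an automorphism of that
    number field, which extends to [algC]. *)
Lemma quadratic_automorphism (K : set algC) (s : seq algC) (w : algC) :
  subfield K -> (forall x, x \in s -> K x) -> ~ K w -> w ^+ 2 \in Crat ->
  exists nu : {rmorphism algC -> algC},
    (forall x, x \in s -> nu x = x) /\ nu w = - w.
Proof.
move=> Kf sK nKw w2.
have [Qs [QsC [ws Dws gen]]] := num_field_exists (rcons s w).
case/lastP: ws Dws gen => [/(congr1 size)|s1 w1]; first by rewrite size_rcons.
rewrite map_rcons => /rcons_inj[Ds Dw]; rewrite adjoin_rcons => gen.
pose K1 := <<1 & s1>>%AS.
have nw1 : w1 \notin K1.
  apply/negP => w1K; apply: nKw; rewrite -Dw.
  apply: (@Fadjoin_seq_image _ QsC K s1) => // x xs.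
  by apply: sK; rewrite -Ds map_f.
have [c Dc] : exists c : rat, w1 ^+ 2 = c%:A.
  have /CratP[c Ec] := w2; exists c; apply: (fmorph_inj QsC).
  by rewrite rmorphXn /= Dw Ec alg_num_field fmorph_rat.
have Pmin : minPoly K1 w1 = 'X^2 - (w1 ^+ 2)%:P.
  have dv : minPoly K1 w1 %| 'X^2 - (w1 ^+ 2)%:P.
    apply: minPoly_dvdp; last by rewrite rootE !hornerE subrr.
    rewrite rpredB ?rpredX ?polyOverX // polyOverC Dc.
    by apply: rpredZ; apply: mem1v.
  have szr : size ('X^2 - (w1 ^+ 2)%:P) = 3 by rewrite size_XnsubC.
  apply/eqP; rewrite -eqp_monic ?monic_minPoly ?monicXnsubC //.
  rewrite -dvdp_size_eqp // szr size_minPoly eqSS.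
  have := adjoin_deg_eq1 K1 w1; rewrite (negbTE nw1).
  have := dvdp_leq _ dv; rewrite -size_poly_gt0 szr => /(_ isT).
  rewrite size_minPoly ltnS.
  by case: (adjoin_degree _ _) (isT : (0 < adjoin_degree K1 w1)%N) => [|[|[|]]].
have hom1 : kHom K1 K1 (\1%VF : 'End(Qs)) by rewrite kHom1.
have rt : root (map_poly \1%VF (minPoly K1 w1)) (- w1).
  rewrite (@eq_map_poly _ _ _ idfun) => [|a]; last by rewrite /= id_lfunE.
  by rewrite map_poly_id // Pmin rootE !hornerE sqrrN subrr.
pose phi := kHomExtend K1 \1 w1 (- w1).
have phom : kHom K1 <<K1; w1>> phi.
  by apply: kHomExtendP.
have phim : monoid_morphism phi.
  apply/kHom_monoid_morphism; rewrite -gen; apply: kHomSl phom; exact: sub1v.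
pose phimM := GRing.isMonoidMorphism.Build _ _ phi phim.
pose phiRM : {rmorphism _ -> _} := HB.pack (fun_of_lfun phi) phimM.
have [nu Dnu] := extend_algC_subfield_aut QsC phiRM.
exists nu; split=> [x|].
  rewrite -Ds => /mapP[y ys ->]; rewrite -Dnu /= /phi kHomExtend_id ?id_lfunE //.
  exact: seqv_sub_adjoin.
by rewrite -Dw -Dnu /= /phi (kHomExtend_val hom1) // rmorphN.
Qed.

(** * Algebraic integers *)

(** If [p] is monic with integer coefficients and kills [z^2], then [p(X^2)] does the same for [z].
    This replaces integral closure wherever an element is recognised by its square. *)
Lemma Aint_sqr z : z ^+ 2 \in Aint -> z \in Aint.
Proof.
move=> Az; pose p := minCpoly (z ^+ 2).
have pm : p \is monic := minCpoly_monic _.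
have szX : size ('X^2 : {poly algC}) = 3%N by rewrite size_polyXn.
apply: (@root_monic_Aint (p \Po 'X^2)).
- by rewrite /root horner_comp hornerXn; apply: (root_minCpoly (z ^+ 2)).
- rewrite monicE lead_coef_comp ?szX // lead_coefXn expr1n mulr1.
  by rewrite -monicE.
- by apply: polyOver_comp => //; rewrite rpredX // polyOverX.
Qed.

Lemma Aint_quadratic (z : algC) (b c : int) :
  z ^+ 2 + b%:~R * z + c%:~R = 0 -> z \in Aint.
Proof.
move=> E; pose p : {poly algC} := 'X^2 + (b%:~R *: 'X + (c%:~R)%:P).
have szq : (size (b%:~R *: 'X + (c%:~R)%:P : {poly algC})%R < size ('X^2 : {poly algC})%R)%N.
  rewrite size_polyXn (leq_ltn_trans (size_polyD _ _)) // gtn_max.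
  rewrite (leq_ltn_trans (size_scale_leq _ _)) ?size_polyX //.
  by rewrite (leq_ltn_trans (size_polyC_leq1 _)).
apply: (@root_monic_Aint p).
- by apply/eqP; rewrite /p !hornerE /= E.
- by rewrite monicE /p lead_coefDl // lead_coefXn.
- apply/polyOverP => i; rewrite /p !coefD coefXn coefZ coefX coefC.
  rewrite rpredD // ?rpredD //; first by rewrite rpred_nat.
    by rewrite rpredM ?intr_int ?rpred_nat.
  by case: ifP; rewrite ?intr_int ?rpred0.
Qed.

Lemma Aint_i : 'i \in Aint.
Proof. by apply: Aint_sqr; rewrite sqrCi rpredN rpred1. Qed.

Ltac ai := try assumption; lazymatch goal with
  | |- is_true (_ + - _ \in _) => apply: rpredB; ai
  | |- is_true (_ + _ \in _) => apply: rpredD; ai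
  | |- is_true (- _ \in _) => rewrite rpredN; ai
  | |- is_true (_ * _ \in _) => apply: rpredM; ai
  | |- is_true (_ ^+ _ \in _) => apply: rpredX; ai
  | |- is_true (_%:~R \in _) => apply: Aint_int
  | |- is_true (1 \in _) => apply: Aint1
  | |- is_true (0 \in _) => apply: Aint0
  | |- is_true (_%:R \in _) => apply: rpred_nat
  | |- is_true ('i \in _) => apply: Aint_i
  | |- subfield _ => try by []
  | |- _ => idtac end.

Section IntRing.
Variables (K : set algC) (Kf : subfield K).
Local Notation O := (int_ring K).
Lemma int_ringD x y : O x -> O y -> O (x + y).
Proof. by move=> [Kx Ax] [Ky Ay]; split; rewrite /=; [sf|ai]. Qed.
Lemma int_ringM x y : O x -> O y -> O (x * y).
Proof. by move=> [Kx Ax] [Ky Ay]; split; rewrite /=; [sf|ai]. Qed.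
Lemma int_ringN x : O x -> O (- x).
Proof. by move=> [Kx Ax]; split; rewrite /=; [sf|ai]. Qed.
Lemma int_ringB x y : O x -> O y -> O (x - y).
Proof. by move=> Ox Oy; apply: int_ringD => //; apply: int_ringN. Qed.
Lemma int_ringX x n : O x -> O (x ^+ n).
Proof. by move=> [Kx Ax]; split; rewrite /=; [sf|ai]. Qed.
Lemma int_ring_nat n : O n%:R.
Proof. by split; rewrite /=; [sf|ai]. Qed.
Lemma int_ring_int (n : int) : O n%:~R.
Proof. by split; rewrite /=; [sf|ai]. Qed.
Lemma int_ring0 : O 0. Proof. exact: (int_ring_nat 0). Qed.
Lemma int_ring1 : O 1. Proof. exact: (int_ring_nat 1). Qed.
End IntRing.

Ltac oi := try assumption; lazymatch goal with
  | |- int_ring _ (_ + - _) => apply: int_ringB; oi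
  | |- int_ring _ (_ + _) => apply: int_ringD; oi
  | |- int_ring _ (- _) => apply: int_ringN; oi
  | |- int_ring _ (_ * _) => apply: int_ringM; oi
  | |- int_ring _ (_ ^+ _) => apply: int_ringX; oi
  | |- int_ring _ (_%:~R) => apply: int_ring_int; oi
  | |- int_ring _ 1 => apply: int_ring1; oi
  | |- int_ring _ 0 => apply: int_ring0; oi
  | |- int_ring _ (_%:R) => apply: int_ring_nat; oi
  | |- subfield _ => try by []
  | |- _ => idtac end.

Lemma Qi_quad : Qi = quad CratS 'i.
Proof.
apply: quad_eq_field.
- exact: CratS_subfield.
- by rewrite sqrCi; apply: sfN (sf1 CratS_subfield); apply: CratS_subfield.
- by move=> x; apply: sf_rat; apply: field_gen_subfield.
- exact: field_gen_sub.
- by move=> _ /= ->; apply: quad_gen; apply: CratS_subfield.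
Qed.

Lemma Qi_subfield : subfield Qi. Proof. exact: field_gen_subfield. Qed.
Hint Resolve Qi_subfield CratS_subfield : core.

Lemma Qi_i : Qi 'i. Proof. exact: field_gen_sub. Qed.
Hint Resolve Qi_i : core.

Lemma Aint_conj x : (x^* \in Aint) = (x \in Aint).
Proof. exact: Aint_aut. Qed.

Lemma Crat_int_ring z : z \in Crat -> z \in Aint -> exists a : int, z = a%:~R.
Proof. by move=> Qz Az; have /intrP[a ->] := Cint_rat_Aint Qz Az; exists a. Qed.

Lemma Zi_i : Zi 'i. Proof. by split=> //; exact: Aint_i. Qed.
Hint Resolve Zi_i : core.

Lemma int_mod2 (s : int) : exists r, s = 2 * r \/ s = 2 * r + 1.
Proof.
exists (s %/ 2)%Z; rewrite {1 3}(divz_eq s 2) mulrC.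
have : (0 <= (s %% 2)%Z)%R by rewrite modz_ge0.
have : ((s %% 2)%Z < 2)%R by rewrite ltz_pmod.
by case: (s %% 2)%Z => [[|[|]]|] // _ _; [left|right]; rewrite ?addr0.
Qed.

Lemma even_sum_sqr (s t n : int) : s ^+ 2 + t ^+ 2 = 4 * n ->
  exists s' t', s = 2 * s' /\ t = 2 * t'.
Proof.
have [u Eu] := int_mod2 s; have [v Ev] := int_mod2 t; rewrite !expr2 => E.
by exists u, v; case: Eu Ev E => -> [] -> E; split=> //; exfalso; lia.
Qed.

(** For [z = u + v i] integral, [2u], [2v] and [u^2 + v^2] are rational integers; the sum of the
    squares of [2u] and [2v] is then divisible by 4, so both are even. *)
Lemma ZiP z : Zi z <-> exists a b : int, z = a%:~R + b%:~R * 'i.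
Proof.
split=> [[]|[a [b ->]]]; last by oi.
rewrite {1}Qi_quad => -[u [v [Qu Qv ->]]] /= Az.
have Azc : u - v * 'i \in Aint.
  have := Az; rewrite -(Aint_conj (u + v * 'i)) rmorphD rmorphM /=.
  by rewrite (conj_Crat Qu) (conj_Crat Qv) conjCi mulrN.
have i2 := sqrCi algC.
have [s Es] : exists s : int, 2 * u = s%:~R.
  apply: Crat_int_ring; first by rewrite rpredM ?rpred_nat.
  by have -> : 2 * u = (u + v * 'i) + (u - v * 'i) by [ring]; ai.
have [t Et] : exists t : int, 2 * v = t%:~R.
  apply: Crat_int_ring; first by rewrite rpredM ?rpred_nat.
  have -> : 2 * v = - 'i * ((u + v * 'i) - (u - v * 'i)).
    by transitivity (- ('i ^+ 2) * (2 * v)); [rewrite i2; ring|ring].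
  by ai.
have [n En] : exists n : int, u ^+ 2 + v ^+ 2 = n%:~R.
  apply: Crat_int_ring; first by rewrite rpredD ?rpredX.
  have -> : u ^+ 2 + v ^+ 2 = (u + v * 'i) * (u - v * 'i).
    by transitivity (u ^+ 2 - v ^+ 2 * 'i ^+ 2); [rewrite i2; ring|ring].
  by ai.
have {En} En : s ^+ 2 + t ^+ 2 = 4 * n.
  apply: (@intr_inj algC); rewrite !expr2 rmorphD !rmorphM /= -Es -Et -En.
  by ring.
have [s' [t' [Es' Et']]] := even_sum_sqr En.
have n2 : (2 : algC) != 0 by rewrite pnatr_eq0.
exists s', t'; congr (_ + _ * _).
  by apply: (mulfI n2); rewrite Es Es' rmorphM.
by apply: (mulfI n2); rewrite Et Et' rmorphM.
Qed.

(** * Gaussian integers *)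

Lemma Ci_coord u v : u \in Crat -> v \in Crat -> u + v * 'i = 0 -> u = 0 /\ v = 0.
Proof.
move=> Qu Qv E.
have Ec : u - v * 'i = 0.
  rewrite -[0 in RHS](rmorph0 (Num.conj : {rmorphism algC -> algC})) -E.
  by rewrite rmorphD rmorphM /= (conj_Crat Qu) (conj_Crat Qv) conjCi mulrN.
have n2 : (2 : algC) != 0 by rewrite pnatr_eq0.
have u0 : u = 0.
  by apply: (mulfI n2); rewrite mulr0 -[RHS](addr0 0) -{1}E -Ec; ring.
split=> //; apply: (mulIf (neq0Ci algC)).
by rewrite mul0r -[RHS]E u0 add0r.
Qed.

Lemma Ci_int_inj (a b c e : int) :
  a%:~R + b%:~R * 'i = c%:~R + e%:~R * 'i :> algC -> a = c /\ b = e.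
Proof.
move=> E.
have [|||H1 H2] := @Ci_coord (a - c)%:~R (b - e)%:~R.
- by rewrite rpred_int.
- by rewrite rpred_int.
- by rewrite !rmorphB /= -[RHS](subrr (c%:~R + e%:~R * 'i)) -{1}E; ring.
move/eqP: H1; move/eqP: H2; rewrite !intr_eq0 !subr_eq0 => /eqP -> /eqP ->.
by [].
Qed.

Definition nrm (z : algC) := z * z^*.

Lemma nrmM x y : nrm (x * y) = nrm x * nrm y.
Proof. by rewrite /nrm rmorphM /=; ring. Qed.

Lemma nrm_ge0 x : 0 <= nrm x.
Proof. by rewrite /nrm -normCK exprn_ge0. Qed.

Lemma nrm_eq0 x : (nrm x == 0) = (x == 0).
Proof. by rewrite /nrm mulf_eq0 conjC_eq0 orbb. Qed.

Lemma Qi_conj z : Qi z -> Qi z^*.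
Proof.
rewrite Qi_quad => -[u [v [Qu Qv ->]]].
exists u, (- v); split=> //; first by apply: sfN.
by rewrite rmorphD rmorphM /= (conj_Crat Qu) (conj_Crat Qv) conjCi; ring.
Qed.

Lemma Zi_conj z : Zi z -> Zi z^*.
Proof. by move=> [Qz Az]; split; [apply: Qi_conj|rewrite /= Aint_conj]. Qed.

Lemma Qi_nrm_rat z : Qi z -> nrm z \in Crat.
Proof.
rewrite Qi_quad => -[u [v [Qu Qv ->]]].
rewrite /nrm rmorphD rmorphM /= (conj_Crat Qu) (conj_Crat Qv) conjCi.
have -> : (u + v * 'i) * (u + v * - 'i) = u ^+ 2 + v ^+ 2.
  by transitivity (u ^+ 2 - v ^+ 2 * 'i ^+ 2); [ring|rewrite sqrCi; ring].
by rewrite rpredD ?rpredX.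
Qed.

Lemma Zi_nrm_nat z : Zi z -> exists n : nat, nrm z = n%:R.
Proof.
move=> [Qz Az]; apply/natrP; rewrite natrEint nrm_ge0 andbT.
apply: Cint_rat_Aint; first exact: Qi_nrm_rat.
by rewrite /nrm rpredM ?Aint_conj.
Qed.

Lemma Qi_real_rat z : Qi z -> z^* = z -> z \in Crat.
Proof.
rewrite {1}Qi_quad => -[u [v [Qu Qv ->]]].
rewrite rmorphD rmorphM /= (conj_Crat Qu) (conj_Crat Qv) conjCi => E.
have [|||_ v0] := @Ci_coord 0 (2 * v); rewrite ?rpred0 ?rpredM ?rpred_nat //.
  by rewrite add0r -[RHS](subrr (u + v * 'i)) -{2}E; ring.
have -> : v = 0 by apply/eqP; have /eqP := v0; rewrite mulf_eq0 pnatr_eq0.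
by rewrite mul0r addr0.
Qed.

Definition dvdi (d x : algC) : Prop := exists2 t, Zi t & x = d * t.

Lemma dvdi_trans y x z : dvdi x y -> dvdi y z -> dvdi x z.
Proof. by move=> [t Zt ->] [s Zs ->]; exists (t * s); [oi|ring]. Qed.
Lemma dvdi_mull d x t : Zi t -> dvdi d x -> dvdi d (t * x).
Proof. by move=> Zt [s Zs ->]; exists (s * t); [oi|ring]. Qed.
Lemma dvdiD d x y : dvdi d x -> dvdi d y -> dvdi d (x + y).
Proof. by move=> [t Zt ->] [s Zs ->]; exists (t + s); [oi|ring]. Qed.
Lemma dvdi_refl d : dvdi d d.
Proof. by exists 1; [oi|ring]. Qed.

Lemma dvdi_Aint d x t : Qi d -> Qi x -> d != 0 -> t \in Aint -> x = d * t -> dvdi d x.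
Proof.
move=> Qd Qx d0 At Ex; exists t => //; split=> //.
by have -> : t = x / d by [rewrite Ex; field]; sf.
Qed.

Lemma rat_round (r : rat) : exists n : int, (r - n%:~R) ^+ 2 <= 4^-1.
Proof.
exists (Num.floor (r + 2^-1)).
have := floor_itv (r + 2^-1); rewrite rmorphD /=; set n := _%:~R => /andP[].
by nra.
Qed.

Lemma Crat_round u : u \in Crat -> exists n : int, (u - n%:~R) ^+ 2 <= 4^-1.
Proof.
case/CratP=> r ->; have [n Hn] := rat_round r; exists n.
have : ratr ((r - n%:~R) ^+ 2) <= ratr (4^-1) :> algC by rewrite ler_rat.
by rewrite rmorphXn rmorphB fmorphV /= ratr_int ratr_nat.
Qed.

(** Rounding both coordinates of [a / b] leaves an error of norm at most [1/4 + 1/4 < 1]. *)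
Lemma Zi_euclid a b : Zi a -> Zi b -> b != 0 ->
  exists2 c, Zi c & nrm (a - c * b) < nrm b.
Proof.
move=> [Qa _] [Qb _] b0.
have : Qi (a / b) by sf.
rewrite {1}Qi_quad => -[u [v [Qu Qv Eab]]].
have [n Hn] := Crat_round Qu; have [m Hm] := Crat_round Qv.
exists (n%:~R + m%:~R * 'i); first by oi.
have -> : a - (n%:~R + m%:~R * 'i) * b = ((u - n%:~R) + (v - m%:~R) * 'i) * b.
  by rewrite -{1}[a](divfK b0) Eab; ring.
rewrite nrmM gtr_pMl; last by rewrite lt_def nrm_eq0 b0 nrm_ge0.
rewrite /nrm rmorphD rmorphM !rmorphB /= (conj_Crat Qu) (conj_Crat Qv) !rmorph_int conjCi.
set s := u - _; set t := v - _.
have -> : (s + t * 'i) * (s + t * - 'i) = s ^+ 2 + t ^+ 2.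
  by transitivity (s ^+ 2 - t ^+ 2 * 'i ^+ 2); [ring|rewrite sqrCi; ring].
apply: le_lt_trans (lerD Hn Hm) _.
have -> : 4^-1 + 4^-1 = 2^-1 :> algC by field.
by rewrite invf_lt1 ?ltr1n.
Qed.

Lemma Zi_bezout x y : Zi x -> Zi y ->
  exists g u v, [/\ Zi g, Zi u, Zi v, g = u * x + v * y & dvdi g x /\ dvdi g y].
Proof.
move=> Zx Zy; have [n En] := Zi_nrm_nat Zy.
elim/ltn_ind: n x y Zx Zy En => n IH x y Zx Zy En.
have [y0|y0] := eqVneq y 0.
  exists x, 1, 0; split; oi; first by rewrite y0; ring.
  split; first exact: dvdi_refl.
  by exists 0; [oi|rewrite y0; ring].
have [c Zc Hc] := Zi_euclid Zx Zy y0.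
have Zr : Zi (x - c * y) by oi.
have [m Em] := Zi_nrm_nat Zr.
have mn : (m < n)%N by rewrite -(@ltr_nat algC) -Em -En.
have [g [u [v [Zg Zu Zv Eg [g1 g2]]]]] := IH m mn y _ Zy Zr Em.
exists g, v, (u - v * c); split; oi; first by rewrite Eg; ring.
split=> //; have -> : x = (x - c * y) + c * y by ring.
by apply: dvdiD => //; apply: dvdi_mull.
Qed.

Lemma Zi_gauss e g f u v : Zi e -> Zi g -> Zi u -> Zi v -> u * e + v * f = 1 ->
  dvdi e (g * f) -> dvdi e g.
Proof.
move=> Ze Zg Zu Zv E [t Zt Et].
exists (g * u + v * t); first by oi.
transitivity (g * (u * e + v * f)); first by rewrite E mulr1.
by transitivity (e * (g * u) + v * (g * f)); [ring|rewrite Et; ring].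
Qed.

Lemma Zi_unit_nrm u : Zi u -> Zi u^-1 -> u != 0 -> nrm u = 1.
Proof.
move=> Zu ZV u0; have [n En] := Zi_nrm_nat Zu; have [m Em] := Zi_nrm_nat ZV.
have : nrm u * nrm u^-1 = 1 by rewrite -nrmM divff // /nrm rmorph1 mulr1.
rewrite En Em -natrM => /eqP; rewrite -[1]/(1%:R) eqr_nat muln_eq1 => /andP[/eqP -> _].
by [].
Qed.

Lemma Zi_nrm1 u : Zi u -> nrm u = 1 -> u ^+ 4 = 1.
Proof.
move=> /ZiP[a [b ->]].
rewrite /nrm rmorphD rmorphM /= !rmorph_int conjCi => E.
have {}E : a ^+ 2 + b ^+ 2 = 1.
  apply: (@intr_inj algC); rewrite rmorphD !rmorphXn /= rmorph1 -[RHS]E.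
  by transitivity (a%:~R ^+ 2 - b%:~R ^+ 2 * 'i ^+ 2 : algC); [rewrite sqrCi; ring|ring].
have : (a = 0 /\ b ^+ 2 = 1) \/ (b = 0 /\ a ^+ 2 = 1).
  have [a0|a0] := eqVneq a 0; first by left; split; rewrite // -E a0 expr0n add0r.
  have [b0|b0] := eqVneq b 0; first by right; split; rewrite // -E b0 expr0n addr0.
  by move: E; rewrite !expr2; nia.
have i4 : 'i ^+ 4 = 1 :> algC by rewrite (exprM _ 2 2) sqrCi sqrrN expr1n.
case=> -[-> /(congr1 (fun z : int => z%:~R : algC))]; rewrite rmorphXn /= rmorph1 => E2.
  by rewrite add0r exprMn i4 (exprM _ 2 2) E2 expr1n mulr1.
by rewrite mul0r addr0 (exprM _ 2 2) E2 expr1n.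
Qed.

Lemma Zi_unit4 u : Zi u -> Zi u^-1 -> u != 0 -> u ^+ 4 = 1.
Proof. by move=> *; apply: Zi_nrm1 => //; apply: Zi_unit_nrm. Qed.

Lemma unit4_cases (u : algC) : u ^+ 4 = 1 -> u ^+ 2 = 1 \/ u ^+ 2 = -1.
Proof.
move=> E; have : (u ^+ 2 - 1) * (u ^+ 2 + 1) = 0 by rewrite -[RHS](subrr 1) -{3}E; ring.
move/eqP; rewrite mulf_eq0 subr_eq0 addr_eq0 => /orP[/eqP|/eqP]; by [left|right].
Qed.

Lemma unit4_Zi (u : algC) : u ^+ 4 = 1 -> Zi u.
Proof.
move/unit4_cases => -[/eqP|/eqP].
  by rewrite sqrf_eq1 => /orP[]/eqP ->; oi.
by rewrite -(sqrCi algC) eqf_sqr => /orP[]/eqP ->; oi.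
Qed.

(** Squarefree, stated as: the ideal [(d)] is radical. No prime factorisation is involved, and
    divisibility of a square can be turned directly into divisibility of its root. *)
Definition sqf (d : algC) : Prop :=
  [/\ Zi d, d != 0 & forall x, Zi x -> dvdi d (x ^+ 2) -> dvdi d x].

Lemma sqf_dvd d e : Zi e -> sqf d -> dvdi e d -> sqf e.
Proof.
move=> Ze [Zd d0 Hd] [t Zt Et]; split=> //.
  by apply: contraNneq d0 => e0; rewrite Et e0 mul0r.
have t0 : t != 0 by apply: contraNneq d0 => t0; rewrite Et t0 mulr0.
move=> x Zx [s Zs Es].
have [||r Zr Er] := Hd (t * x); first by oi.
  by exists (t * s); [oi|rewrite exprMn Es Et; ring].
exists r => //; apply: (mulfI t0); rewrite Er Et; ring.
Qed.

(** Write [d = g d'] and [e = g e'] with [g] the gcd. The square of [g d' e'] is a multiple of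
    [d e], so [d e = g (g d' e')] divides [g d' e'] and [g] is a unit. *)
Lemma sqf_coprime d e : Zi d -> Zi e -> sqf (d * e) ->
  exists u v, [/\ Zi u, Zi v & u * d + v * e = 1].
Proof.
move=> Zd Ze [Zde de0 H].
have [g [u [v [Zg Zu Zv Eg [[d' Zd' Ed] [e' Ze' Ee]]]]]] := Zi_bezout Zd Ze.
have [||t Zt Et] := H (g * d' * e'); first by oi.
  by exists (d' * e'); [oi|rewrite Ed Ee; ring].
have x0 : g * d' * e' != 0.
  apply: contraNneq de0 => E; apply/eqP.
  by transitivity (g * (g * d' * e')); [rewrite Ed Ee; ring|rewrite E mulr0].
have gt1 : g * t = 1.
  by apply: (mulfI x0); rewrite mulr1 [RHS]Et Ed Ee; ring.
exists (t * u), (t * v); split; oi.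
by rewrite -gt1 {1}Eg; ring.
Qed.

(** Descent on the norm. If [z] divides [x^2] but not [x], put [z = g e] and [x = g f] with [g] the
    gcd; then [e] divides [g f^2] and is prime to [f], so [e] divides [g], and [z = g' e^2] with [e]
    not a unit. *)
Lemma sqf_rep_Zi z : Zi z -> z != 0 ->
  exists d c, [/\ sqf d, Qi c, c != 0 & z = d * c ^+ 2].
Proof.
move=> Zz z0; have [n En] := Zi_nrm_nat Zz.
elim/ltn_ind: n z Zz z0 En => n IH z Zz z0 En.
have [Hz|] := pselect (forall x, Zi x -> dvdi z (x ^+ 2) -> dvdi z x).
  by exists z, 1; split; [split|sf|rewrite oner_eq0|ring].
move=> /existsNP[x] /not_implyP[Zx] /not_implyP[zx2 nzx].
have [g [u [v [Zg Zu Zv Eg [[e Ze Ee] [f Zf Ef]]]]]] := Zi_bezout Zz Zx.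
have g0 : g != 0 by apply: contraNneq z0 => g0; rewrite Ee g0 mul0r.
have e0 : e != 0 by apply: contraNneq z0 => e0; rewrite Ee e0 mulr0.
have uv : u * e + v * f = 1.
  apply: (mulfI g0); rewrite mulr1.
  by transitivity (u * (g * e) + v * (g * f)); [ring|rewrite -Ee -Ef -Eg].
have [g' Zg' Eg'] : dvdi e g.
  apply: (@Zi_gauss e g f u v) => //; apply: (@Zi_gauss e (g * f) f u v) => //; first by oi.
  case: zx2 => t Zt Et; exists t => //; apply: (mulfI g0).
  by transitivity (x ^+ 2); [rewrite Ef; ring|rewrite Et Ee; ring].
have g'0 : g' != 0 by apply: contraNneq g0 => E; rewrite Eg' E mulr0.
have Ez : z = g' * e ^+ 2 by rewrite Ee Eg'; ring.
have [m Em] := Zi_nrm_nat Zg'.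
have mn : (m < n)%N.
  have [j Ej] := Zi_nrm_nat Ze.
  have Enm : n = (m * j ^ 2)%N.
    by apply/eqP; rewrite -(eqr_nat algC) -En Ez nrmM Em expr2 nrmM Ej natrM -mulnn natrM.
  have m0 : (0 < m)%N by rewrite lt0n -(pnatr_eq0 algC) -Em nrm_eq0.
  have j0 : (0 < j)%N by rewrite lt0n -(pnatr_eq0 algC) -Ej nrm_eq0.
  have j1 : (j != 1)%N.
    (* If [e] had norm 1, then [g] would be a multiple of [z], and so would [x]. *)
    apply/eqP => j1; apply: nzx; apply: (@dvdi_trans g); last by exists f.
    exists e^*; first exact: Zi_conj.
    by rewrite {1}Ee -mulrA -/(nrm e) Ej j1 mulr1.
  by rewrite Enm -mulnn; nia.
have [d [c [Hd Qc c0 Ec]]] := IH m mn g' Zg' g'0 Em.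
exists d, (c * e); split=> //; first by case: Ze => Qe _; sf.
  by rewrite mulf_neq0.
by rewrite Ez Ec; ring.
Qed.

Lemma Qi_denom z : Qi z -> exists2 n : nat, (0 < n)%N & Zi (n%:R * z).
Proof.
rewrite {1}Qi_quad => -[_ [_ [/CratP[r ->] /CratP[s ->] ->]]].
pose n := `|denq r|%N; pose m := `|denq s|%N.
have n0 : (0 < n)%N by rewrite absz_gt0 denq_eq0.
have m0 : (0 < m)%N by rewrite absz_gt0 denq_eq0.
exists (n * m)%N; first by rewrite muln_gt0 n0.
have rE : n%:R * ratr r = (numq r)%:~R :> algC.
  rewrite /ratr /n pmulrn gez0_abs ?denq_ge0 // mulrCA mulfV ?mulr1 //.
  by rewrite intr_eq0 denq_eq0.
have sE : m%:R * ratr s = (numq s)%:~R :> algC.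
  rewrite /ratr /m pmulrn gez0_abs ?denq_ge0 // mulrCA mulfV ?mulr1 //.
  by rewrite intr_eq0 denq_eq0.
have -> : (n * m)%:R * (ratr r + ratr s * 'i) =
   m%:R * (n%:R * ratr r) + n%:R * (m%:R * ratr s) * 'i :> algC by rewrite natrM; ring.
by rewrite rE sE; oi.
Qed.

Lemma sqf_rep z : Qi z -> z != 0 ->
  exists d c, [/\ sqf d, Qi c, c != 0 & z = d * c ^+ 2].
Proof.
move=> Qz z0; have [n n0 Zn] := Qi_denom Qz.
have nn0 : n%:R != 0 :> algC by rewrite pnatr_eq0 -lt0n.
have [||d [c [Hd Qc c0 E]]] := @sqf_rep_Zi (n%:R * z * n%:R); first by oi.
  by rewrite !mulf_neq0.
exists d, (c / n%:R); split=> //; [by sf|by rewrite mulf_neq0 ?invr_eq0|].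
rewrite expr_div_n mulrA -E; field.
by [].
Qed.

(** With [g] the gcd of [x] and [z], coprimality gives [x = s g^2] and the Bezout relation for [g]
    gives [g^2 = x r]; hence [s r = 1]. *)
Lemma Zi_square_factor x y z u v : Zi x -> Zi y -> Zi z -> Zi u -> Zi v -> x != 0 ->
  x * y = z ^+ 2 -> u * x + v * y = 1 ->
  exists e g, [/\ e ^+ 4 = 1, Zi g & x = e * g ^+ 2].
Proof.
move=> Zx Zy Zz Zu Zv x0 Exy Euv.
have [g [u' [v' [Zg Zu' Zv' Eg [[x' Zx' Ex'] [z' Zz' Ez']]]]]] := Zi_bezout Zx Zz.
pose s := u * x' ^+ 2 + v * z' ^+ 2.
have Es : x = s * g ^+ 2.
  rewrite -{1}[x]mulr1 -Euv.
  by transitivity (u * x ^+ 2 + v * (x * y)); [ring|rewrite Exy {1}Ex' Ez' /s; ring].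
pose r := u' ^+ 2 * x + 2 * u' * v' * z + v' ^+ 2 * y.
have Er : g ^+ 2 = x * r.
  rewrite Eg /r; transitivity (u' ^+ 2 * x ^+ 2 + 2 * u' * v' * x * z + v' ^+ 2 * z ^+ 2); first ring.
  by rewrite -Exy; ring.
have sr : s * r = 1.
  by apply: (mulfI x0); rewrite mulr1 [RHS]Es Er; ring.
have Zs : Zi s by rewrite /s; oi.
have Zr : Zi r by rewrite /r; oi.
have s0 : s != 0 by apply: contraNneq x0 => s0; rewrite Es s0 mul0r.
exists s, g; split=> //; apply: Zi_unit4 => //.
by have -> : s^-1 = r by [rewrite -[r]mul1r -(mulVf s0) -mulrA sr mulr1].
Qed.

(** * Quadratic extensions of Q(i) *)

Definition uni (K : set algC) (u : algC) : Prop :=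
  [/\ K u, u \in Aint, u^-1 \in Aint & u != 0].

Section Uni.
Variables (K : set algC) (Kf : subfield K).

Lemma is_unitP u : is_unit K u <-> uni K u.
Proof.
split=> [[[Ku Au] [v [Kv Av] uv]]|[Ku Au Av u0]].
  have u0 : u != 0.
    by apply/eqP => u0; move/eqP: uv; rewrite u0 mul0r eq_sym oner_eq0.
  split=> //; suff -> : u^-1 = v by [].
  by rewrite -[v]mul1r -(mulVf u0) -mulrA uv mulr1.
split; first by split.
by exists u^-1; [split=> //; exact: sfV|rewrite divff].
Qed.

Lemma uniM u v : uni K u -> uni K v -> uni K (u * v).
Proof.
move=> [Ku Au Au' u0] [Kv Av Av' v0]; split; [by sf|by ai| |by rewrite mulf_neq0].
by rewrite invfM; ai.
Qed.

Lemma uniV u : uni K u -> uni K u^-1.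
Proof. by move=> [Ku Au Au' u0]; split; rewrite ?invrK ?invr_eq0 //; sf. Qed.

Lemma uni_sqrt u v : K v -> v ^+ 2 = u -> uni K u -> uni K v.
Proof.
move=> Kv E [Ku Au Au' u0]; split=> //.
- by apply: Aint_sqr; rewrite E.
- by apply: Aint_sqr; rewrite exprVn E.
- by apply: contraNneq u0 => v0; rewrite -E v0 expr0n.
Qed.

Lemma uni_unit4 u : K 'i -> u ^+ 4 = 1 -> uni K u.
Proof.
move=> Ki E.
have u0 : u != 0 by apply/eqP => u0; move/eqP: E; rewrite u0 expr0n eq_sym oner_eq0.
have Ku : K u.
  case/unit4_cases: E => /eqP.
    by rewrite sqrf_eq1 => /orP[]/eqP ->; sf.
  by rewrite -(sqrCi algC) eqf_sqr => /orP[]/eqP ->; sf.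
have Au : u \in Aint by case: (unit4_Zi E).
split=> //.
have -> : u^-1 = u ^+ 3 by rewrite -[RHS]mul1r -(mulVf u0) -mulrA -exprS E mulr1.
by ai.
Qed.

Lemma uni_aut (nu : {rmorphism algC -> algC}) u : K (nu u) -> uni K u -> uni K (nu u).
Proof.
move=> Ku' [Ku Au Au' u0]; split=> //; rewrite ?Aint_aut //.
  by rewrite -fmorphV Aint_aut.
by rewrite fmorph_eq0.
Qed.
End Uni.

Lemma Crat_sqr_int x (c : int) : x \in Crat -> x ^+ 2 = c%:~R -> nat_square c.
Proof.
move=> Qx E; have [|a Ea] := Crat_int_ring Qx.
  by apply: Aint_sqr; rewrite E; ai.
exists `|a|%N; apply: (@intr_inj algC); rewrite -E Ea -rmorphXn /=.
by congr _%:~R; lia.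
Qed.

Lemma Crat_sqr_nat x (c : nat) : x \in Crat -> x ^+ 2 = c%:R -> nsq c.
Proof.
move=> Qx; rewrite -[c%:R]/(c%:Z%:~R) => /(Crat_sqr_int Qx)[m Em].
by exists m; move: Em; rewrite expr2 -mulnn; lia.
Qed.

Lemma Qi_sqr_nat x (c : nat) : Qi x -> x ^+ 2 = c%:R -> nsq c.
Proof.
rewrite {1}Qi_quad => Qx E.
have i2 : CratS ('i ^+ 2) by rewrite sqrCi; sf.
have Qc : CratS c%:R by sf.
have [u Qu [|]] := quad_kummer CratS_subfield i2 Qc Qx E; first exact: Crat_sqr_nat.
rewrite sqrCi mulrN1 => Eu; have [->|c0] := eqVneq c 0%N; first by exists 0%N.
have : 0 <= u ^+ 2 by rewrite real_exprn_even_ge0 // Creal_Crat.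
by rewrite Eu oppr_ge0 lern0 (negbTE c0).
Qed.

Lemma aut_Qi (s : {rmorphism algC -> algC}) : s 'i = 'i -> forall x, Qi x -> s x = x.
Proof.
move=> si x; rewrite Qi_quad => -[u [v [Qu Qv ->]]].
by rewrite rmorphD rmorphM /= si !aut_Crat.
Qed.

(** * The fields Q(i, sqrt n) and their units *)

Section QuadraticField.
Variables (n : nat) (s : {rmorphism algC -> algC}).
Local Notation w := (sqrtC n%:R : algC).
Local Notation E := (quad Qi w).
Hypotheses (si : s 'i = 'i) (sw : s w = - w).

Let w2 : w ^+ 2 = n%:R. Proof. exact: sqrtCK. Qed.

Lemma Ew2 : Qi (w ^+ 2). Proof. by rewrite w2; sf. Qed.
Hint Resolve Ew2 : core.

Lemma E_subfield : subfield E. Proof. exact: quad_subfield. Qed.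
Hint Resolve E_subfield : core.

Lemma E_Qi x : Qi x -> E x. Proof. exact: quad_base. Qed.
Lemma E_i : E 'i. Proof. exact: E_Qi. Qed.
Lemma E_w : E w. Proof. exact: quad_gen. Qed.
Hint Resolve E_i E_w : core.

Lemma conj_w : w^* = w.
Proof. by rewrite conj_Creal // sqrtC_real // ler0n. Qed.

Lemma E_aut z : E z -> [/\ E (s z), Qi (z + s z), Qi (z * s z),
    s (s z) = z & s z = z -> Qi z].
Proof. by apply: quad_conj_sum => //; apply: aut_Qi. Qed.

Lemma E_conj z : E z -> E z^*.
Proof.
move=> [a [b [Qa Qb ->]]]; rewrite rmorphD rmorphM /= conj_w.
by exists a^*, b^*; split; rewrite ?Qi_conj //; apply: Qi_conj.
Qed.

Lemma E_conj_aut z : E z -> s z^* = (s z)^*.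
Proof.
move=> [a [b [Qa Qb ->]]]; rewrite !(rmorphD, rmorphM) /= conj_w sw.
rewrite (aut_Qi si Qa) (aut_Qi si Qb) (aut_Qi si (Qi_conj Qa)) (aut_Qi si (Qi_conj Qb)).
by rewrite rmorphN /= conj_w.
Qed.

Lemma E_sqr_nat x (c : nat) : E x -> x ^+ 2 = c%:R -> nsq c \/ nsq (c * n).
Proof.
move=> Ex Ec.
have Qc : Qi c%:R by sf.
have [u Qu [|]] := quad_kummer Qi_subfield Ew2 Qc Ex Ec.
  by move=> /(Qi_sqr_nat Qu); left.
by rewrite w2 -natrM => /(Qi_sqr_nat Qu); right.
Qed.

Lemma E_real z : E z -> z^* = z -> quad CratS w z.
Proof.
move=> [z1 [z2 [Q1 Q2 ->]]]; move: Q1 Q2; rewrite Qi_quad.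
move=> [a [b [Qa Qb ->]]] [c [e [Qc Qe ->]]].
rewrite !(rmorphD, rmorphM) /= conj_w conjCi !conj_Crat // => H.
have n2i : (2 * 'i : algC) != 0 by rewrite mulf_neq0 ?pnatr_eq0 ?neq0Ci.
have H0 : b + e * w = 0.
  apply: (mulfI n2i); rewrite mulr0 -[RHS](subrr (a + b * 'i + (c + e * 'i) * w)).
  by rewrite -{2}H; ring.
exists a, c; split=> //.
transitivity (a + c * w + 'i * (b + e * w)); first ring.
by rewrite H0 mulr0 addr0.
Qed.

Lemma E_norm_unit4 v : uni E v -> (v * s v) ^+ 4 = 1.
Proof.
move=> [Ev Av Av' v0]; have [_ _ Qn _ _] := E_aut Ev.
apply: Zi_unit4; first by split=> //; rewrite /= rpredM ?Aint_aut.
- split; first by sf.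
  by rewrite /= invfM rpredM // -fmorphV Aint_aut.
- by rewrite mulf_neq0 ?fmorph_eq0.
Qed.

Section Units.
Hypothesis E3 : forall z, E z -> z ^+ 2 <> 3.

Lemma E_imaginary_unit z : E z -> z \in Aint -> z * z^* = 1 -> s z^* = z ->
  z = 1 \/ z = -1.
Proof.
move=> Ez Az zz sz.
have sz' : s z = z^*.
  by rewrite -{1}sz; have [_ _ _ -> _] := E_aut (E_conj Ez).
have [_ Qt _ _ _] := E_aut Ez.
have Ezd : E (z - z^*) by move: (E_conj Ez) => Ezc; sf.
have [t Et] : exists t : int, z + z^* = t%:~R.
  apply: Crat_int_ring; last by rewrite rpredD ?Aint_conj.
  by apply: Qi_real_rat; rewrite -?sz' //= sz' rmorphD /= conjCK addrC.
have D : (z - z^*) ^+ 2 = (t ^+ 2 - 4)%:~R.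
  transitivity ((z + z^*) ^+ 2 - 4 * (z * z^*)); first ring.
  by rewrite zz Et mulr1 rmorphB rmorphXn.
have t4 : t ^+ 2 - 4 <= 0.
  rewrite -(@ler_int algC) -D.
  have -> : (z - z^*) ^+ 2 = - nrm (z - z^*) by rewrite /nrm rmorphB /= conjCK; ring.
  by rewrite oppr_le0 nrm_ge0.
have n0 : z != 0.
  by apply/eqP => z0; move/eqP: zz; rewrite z0 mul0r eq_sym oner_eq0.
have zeq : z - z^* = 0 -> z = 1 \/ z = -1.
  move/eqP; rewrite subr_eq0 => /eqP Ec; move: zz; rewrite -Ec -expr2 => /eqP.
  by rewrite sqrf_eq1 => /orP[]/eqP; [left|right].
have : t ^+ 2 = 0 \/ t ^+ 2 = 1 \/ t ^+ 2 = 4.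
  have : t = 0 \/ t = 1 \/ t = -1 \/ t = 2 \/ t = -2 by move: t4; rewrite expr2; nia.
  by move=> [->|[->|[->|[->|->]]]]; [left|right; left|right; left|right; right|right; right].
case=> [t0|[t1|t2]].
- exfalso; have {t0} t0 : t = 0 by apply/eqP; rewrite -sqrf_eq0 t0.
  have zc : z^* = - z by apply/eqP; rewrite -addr_eq0 addrC Et t0.
  have : z ^+ 2 = -1 by rewrite -zz zc; ring.
  move/eqP; rewrite -(sqrCi algC) eqf_sqr => /orP[]/eqP Ei.
    have : s z = z by rewrite Ei.
    by rewrite sz' zc => /eqP; rewrite eqNr (negbTE n0).
  have : s z = z by rewrite Ei rmorphN /= si.
  by rewrite sz' zc => /eqP; rewrite eqNr (negbTE n0).
- exfalso; apply: (@E3 ('i * (z - z^*))); first by sf.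
  by rewrite exprMn sqrCi D t1 mulN1r -rmorphN.
- by apply: zeq; apply/eqP; rewrite -sqrf_eq0 D t2.
Qed.

(** The unit [z = v * s v^*] has absolute value 1, because the norm of [v] to [Q(i)] is a root of
    unity, and [s] carries [z] to its complex conjugate; so it is 1 or -1. This writes [v^2] as a
    root of unity times a positive real unit, to which the fundamental unit applies. *)
Lemma E_unit_sqr v : uni E v ->
  v ^+ 2 = (v * s v) * (v * v^*) \/ v ^+ 2 = - ((v * s v) * (v * v^*)).
Proof.
move=> Uv; have N4 := E_norm_unit4 Uv; case: Uv => Ev Av Av' v0.
have [Esv _ Qn ss _] := E_aut Ev.
have Evc := E_conj Ev; have [Esvc _ _ ssc _] := E_aut Evc.
have N1 : (v * s v) * (v^* * s v^*) = 1.
  have -> : v^* * s v^* = (v * s v)^* by rewrite rmorphM /= E_conj_aut.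
  by apply: Zi_unit_nrm; [exact: unit4_Zi|apply: unit4_Zi; rewrite exprVn N4 invr1|rewrite mulf_neq0 ?fmorph_eq0].
have [||||H|H] := @E_imaginary_unit (v * s v^*).
- by sf.
- by rewrite rpredM // Aint_aut Aint_conj.
- by rewrite rmorphM /= E_conj_aut // conjCK -E_conj_aut // -N1; ring.
- by rewrite rmorphM rmorphM /= E_conj_aut // conjCK ss mulrC.
- left; rewrite -[LHS]mulr1 -N1.
  by transitivity (v * s v * (v * v^*) * (v * s v^*)); [ring|rewrite H mulr1].
- right; rewrite -[LHS]mulr1 -N1.
  by transitivity (v * s v * (v * v^*) * (v * s v^*)); [ring|rewrite H mulrN1].
Qed.

End Units.

(** * Integers of Q(i, R) for R^2 squarefree and 1 modulo 4 *)

Section Integers.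
Variables (R : algC) (c : int).
Hypotheses (ER : E R) (sR : s R = - R) (R2 : R ^+ 2 = (4 * c + 1)%:~R).
Hypothesis Nsqf : sqf (4 * c + 1)%:~R.
Local Notation N := ((4 * c + 1)%:~R : algC).

Let N0 : N != 0. Proof. by case: Nsqf. Qed.
Let R0 : R != 0. Proof. by rewrite -sqrf_eq0 R2. Qed.

Lemma omega_Aint : (1 + R) / 2 \in Aint.
Proof.
apply: (@Aint_quadratic _ (-1) (- c)).
rewrite expr_div_n sqrrD R2 rmorphD rmorphM !rmorphN /=; by field.
Qed.

(** For [y = z - s z], the product [R y] is a Gaussian integer and its square is [R^2] times the
    Gaussian integer [y^2]. As [R^2] is squarefree, it divides [R y], so [y] is a multiple of
    [R]. *)
Lemma E_int_diff z : int_ring E z -> exists2 v, Zi v & z - s z = v * R.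
Proof.
move=> [Ez Az]; have [Esz Qt Qn ss fx] := E_aut Ez.
pose y := z - s z; have Ay : y \in Aint by rewrite rpredB ?Aint_aut.
have Asz : s z \in Aint by rewrite Aint_aut.
have Qy2 : Zi (y ^+ 2).
  split; last by rewrite /=; ai.
  by have -> : y ^+ 2 = (z + s z) ^+ 2 - 4 * (z * s z) by [rewrite /y; ring]; sf.
have AR : R \in Aint by apply: Aint_sqr; rewrite R2; ai.
have ZRy : Zi (R * y).
  split; last by rewrite /=; ai.
  have ERy : E (R * y) by rewrite /y; sf.
  have [_ _ _ _] := E_aut ERy; apply.
  by rewrite rmorphM rmorphB /= sR ss /y; ring.
case: Nsqf => _ _ /(_ _ ZRy)[|t Zt Et].
  by exists (y ^+ 2) => //; rewrite exprMn R2.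
exists t => //; apply: (mulfI R0); rewrite Et -R2; ring.
Qed.

Lemma E_int_coord z : int_ring E z ->
  exists u v, [/\ Zi u, Zi v & z = u + v * ((1 + R) / 2)].
Proof.
move=> Oz; have [v Zv Ev] := E_int_diff Oz; case: Oz => Ez Az.
have [Esz _ _ ss _] := E_aut Ez.
exists (z - v * ((1 + R) / 2)), v; split=> //; last by ring.
have om := omega_Aint; have [Qv Av] := Zv.
split; last by rewrite /=; ai.
have EQv := E_Qi Qv.
have Euz : E (z - v * ((1 + R) / 2)) by sf.
have [_ _ _ _] := E_aut Euz; apply.
rewrite rmorphB rmorphM rmorphM rmorphD rmorph1 fmorphV rmorph_nat /= sR (aut_Qi si Qv).
by apply/eqP; rewrite -subr_eq0 -oppr_eq0; apply/eqP;
   transitivity ((z - s z) - v * R); [field|rewrite Ev subrr].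
Qed.

(** Let [z = u + v om] with [om = (1 + R) / 2]. Both [z^2] and [(s z)^2] are divisible by [d], and
    so is [z * s z], since the quotient has an integral square. Hence [d] divides
    [(N v)^2 = N (z - s z)^2], then [N v], and in turn [(N u)^2] and [N u]. *)
Lemma E_sqf_dvd z d t : int_ring E z -> sqf d -> t \in Aint -> z ^+ 2 = d * t ->
  exists2 t', t' \in Aint & N * z = d * t'.
Proof.
move=> Oz [Zd d0 Hd] At Ezt.
have [u [v [Zu Zv Euv]]] := E_int_coord Oz; case: (Oz) => Ez Az.
have [Esz Qt Qn ss _] := E_aut Ez.
have om := omega_Aint; set om_ := (1 + R) / 2 in Euv om.
have [Qd Ad] := Zd.
have Ezst : s z ^+ 2 = d * s t by rewrite -rmorphXn Ezt rmorphM /= (aut_Qi si Qd).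
have Ar : z * s z / d \in Aint.
  apply: Aint_sqr.
  have -> : (z * s z / d) ^+ 2 = t * s t by rewrite expr_div_n exprMn Ezt Ezst; field.
  by rewrite rpredM ?Aint_aut.
have [Qu Au] := Zu; have [Qv Av] := Zv.
have Est : s t \in Aint by rewrite Aint_aut.
have Evd : z - s z = v * R.
  rewrite {1}Euv {1}Euv /om_ !(rmorphD, rmorphM) fmorphV rmorph1 rmorph_nat /= sR.
  by rewrite (aut_Qi si Qu) (aut_Qi si Qv); field.
have dv : dvdi d (N * v).
  apply: Hd; first by oi.
  apply: (@dvdi_Aint _ _ (N * (t + s t - 2 * (z * s z / d)))) => //; [by sf|by ai|].
  transitivity (N * (v ^+ 2 * R ^+ 2)); first by rewrite R2; ring.
  rewrite -exprMn -Evd; transitivity (N * (z ^+ 2 + s z ^+ 2 - 2 * (z * s z))); first ring.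
  by rewrite Ezt Ezst; field.
have [a [Qa Aa] Ea] := dv.
have du : dvdi d (N * u).
  apply: Hd; first by oi.
  apply: (@dvdi_Aint _ _ (N ^+ 2 * t - 2 * N * z * a * om_ + d * a ^+ 2 * om_ ^+ 2)) => //.
  - by sf.
  - by ai.
  transitivity (N ^+ 2 * z ^+ 2 - 2 * N * z * (N * v) * om_ + (N * v) ^+ 2 * om_ ^+ 2).
    by rewrite Euv; ring.
  by rewrite Ezt Ea; ring.
have [b [Qb Ab] Eb] := du.
exists (b + a * om_); first by ai.
by transitivity (N * u + N * v * om_); [rewrite Euv; ring|rewrite Ea Eb; ring].
Qed.

(** Only ramified primes can enter: [N z = d t] squares to [N^2 u = d t^2], so [d] divides [N^2],
    and [N] because [d] is squarefree. *)
Lemma E_sqf_unit z d u : E z -> sqf d -> uni E u -> z ^+ 2 = d * u -> dvdi d N.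
Proof.
move=> Ez Sd [Eu Au Au' u0] Ezu; have [[Qd Ad] d0 Hd] := Sd.
have Oz : int_ring E z by split=> //; apply: Aint_sqr; rewrite Ezu; ai.
have [t At Et] := E_sqf_dvd Oz Sd Au Ezu.
apply: Hd; first by oi.
apply: (@dvdi_Aint _ _ (t ^+ 2 * u^-1)) => //; [by sf|by ai|].
have du0 : d * u != 0 by rewrite mulf_neq0.
apply: (mulIf du0); transitivity ((d * t) ^+ 2); last by field.
by rewrite -Et exprMn Ezu.
Qed.

End Integers.
End QuadraticField.

(** * Fundamental units *)

(** The mask is built by multiplying in each prime of the list at which the current number has odd
    valuation. *)
Lemma nsq_mask_primes (ls : seq nat) (N : nat) : (0 < N)%N -> all prime ls ->
  (forall l, prime l -> l \notin ls -> ~~ odd (logn l N)) ->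
  exists2 bs : bitseq, size bs = size ls & nsq (foldr muln N (mask bs ls)).
Proof.
elim: ls N => [|l ls IH] N N0 /= pls H.
  by exists [::] => //=; apply: nsq_even_logn => // l pl; apply: H.
case/andP: pls => pl pls; have l0 := prime_gt0 pl.
have [ev|od] := boolP (odd (logn l N)).
  have [|l' pl' nl'|bs sz sq] := IH (l * N)%N _ pls; first by rewrite muln_gt0 l0.
    rewrite lognM // logn_prime //; have [->|ne] := eqVneq l' l; first by rewrite addnC addn1 /= ev.
    by rewrite add0n H // inE (negbTE ne).
  exists (true :: bs); first by rewrite /= sz.
  suff -> : foldr muln N (mask (true :: bs) (l :: ls)) = foldr muln (l * N)%N (mask bs ls) by [].
  by rewrite /=; elim: (mask bs ls) => //= a u <-; rewrite mulnCA.
have [l' pl' nl'|bs sz sq] := IH N N0 pls; last by exists (false :: bs) => //=; rewrite sz.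
have [->|ne] := eqVneq l' l; first by [].
by apply: H => //; rewrite inE (negbTE ne).
Qed.

(** Meant for [N = a + 1], where [a^2 - n b^2 = 1]: an odd prime divides at most one of [a + 1] and
    [a - 1]. *)
Lemma pell_logn_even (n N B l : nat) : (2 < N)%N -> (0 < n)%N -> (0 < B)%N ->
  (N * (N - 2) = n * B ^ 2)%N -> prime l -> ~~ (l %| 2)%N -> ~~ (l %| n)%N ->
  ~~ odd (logn l N).
Proof.
move=> N2 n0 B0 E pl l2 ln.
have [lN|lN] := boolP (l %| N)%N; last by rewrite lognE pl (negbTE lN) !andbF.
have N2l : logn l (N - 2) = 0%N.
  rewrite lognE; case: ifP => // /and3P[_ _ H].
  by move: l2; rewrite -(dvdn_addr 2 H) subnK ?lN // ltnW.
have n2l : logn l n = 0%N by rewrite lognE (negbTE ln) !andbF.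
have := congr1 (logn l) E.
rewrite lognM ?subn_gt0 ?(ltnW (ltnW N2)) // N2l addn0 lognM ?expn_gt0 ?B0 // n2l add0n lognX => ->.
by rewrite mul2n odd_double.
Qed.

Lemma int_mul_eq1 (z m : int) : z * m = 1 -> z = 1 \/ z = -1.
Proof.
move/(congr1 absz); rewrite abszM => /eqP; rewrite muln_eq1 => /andP[/eqP z1 _].
by lia.
Qed.

Lemma Qsqrt_quad n : Qsqrt n = quad CratS (sqrtC n%:R).
Proof.
apply: quad_eq_field => //.
- by rewrite sqrtCK; sf.
- by move=> x; apply: sf_rat; apply: field_gen_subfield.
- exact: field_gen_sub.
- by move=> _ /= ->; apply: quad_gen; apply: CratS_subfield.
Qed.

(** * The fundamental unit of Q(sqrt n) for n = 3 modulo 4 *)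

Section FundamentalUnit.
Variables (n : nat) (s : {rmorphism algC -> algC}) (a b : int).
Local Notation w := (sqrtC n%:R : algC).
Local Notation E := (quad Qi w).
Local Notation eps := (a%:~R + b%:~R * w).
Hypotheses (si : s 'i = 'i) (sw : s w = - w).
Hypotheses (n4 : (n %% 4)%N = 3%N) (fu : fundamental_unit (Qsqrt n) eps).

Let w2 : w ^+ 2 = n%:R. Proof. exact: sqrtCK. Qed.
Let Ef : subfield E. Proof. exact: E_subfield. Qed.
Let Ew : E w. Proof. exact: E_w. Qed.
Hint Resolve Ef Ew : core.

Let Qf : subfield (Qsqrt n). Proof. exact: field_gen_subfield. Qed.
Hint Resolve Qf : core.

Let Qw : Qsqrt n w. Proof. exact: field_gen_sub. Qed.

Lemma Qsqrt_E x : Qsqrt n x -> E x.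
Proof.
rewrite Qsqrt_quad => -[u [v [Qu Qv ->]]].
by exists u, v; split=> //; apply: sf_rat.
Qed.

Lemma eps_uni : uni (Qsqrt n) eps.
Proof. by case: fu => /(is_unitP Qf). Qed.

Lemma eps_gt1 : 1 < eps. Proof. by case: fu. Qed.
Let eps_gt0 : 0 < eps. Proof. exact: lt_trans ltr01 eps_gt1. Qed.

Lemma s_eps : s eps = a%:~R - b%:~R * w.
Proof. by rewrite rmorphD rmorphM /= !rmorph_int sw mulrN. Qed.

(** The norm of a unit is 1 or -1, and -1 is impossible modulo 4: for [n = 3 mod 4] the norm is
    congruent to a sum of two squares. *)
Lemma eps_norm : a ^+ 2 - n%:Z * b ^+ 2 = 1.
Proof.
have [Qe Ae Ae' e0] := eps_uni.
have Een : eps * s eps = (a ^+ 2 - n%:Z * b ^+ 2)%:~R.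
  rewrite s_eps !expr2 rmorphB !rmorphM /= -[n%:~R]w2; ring.
have [m Em] : exists m : int, eps^-1 * s eps^-1 = m%:~R.
  apply: Crat_int_ring; last by rewrite rpredM ?Aint_aut.
  by rewrite fmorphV -invfM Een rpredV rpred_int.
have : (a ^+ 2 - n%:Z * b ^+ 2) * m = 1.
  apply: (@intr_inj algC); rewrite rmorphM /= -Een -Em fmorphV -invfM.
  by rewrite mulfV ?mulf_neq0 ?fmorph_eq0.
case/int_mul_eq1 => // z1; exfalso; move: z1 {Een Em}.
have [j ->] : exists j, n = (4 * j + 3)%N by exists (n %/ 4)%N; rewrite {1}(divn_eq n 4) n4 mulnC.
rewrite PoszD PoszM !expr2.
have [u Eu] := int_mod2 a; have [v Ev] := int_mod2 b.
by case: Eu => ->; case: Ev => -> H; lia.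
Qed.

Lemma eps_inv : eps^-1 = s eps.
Proof.
have [_ _ _ e0] := eps_uni; apply: (mulfI e0); rewrite mulfV //.
rewrite s_eps -[LHS]/(1%:~R) -eps_norm !expr2 rmorphB !rmorphM /= -[n%:~R]w2; ring.
Qed.

Let n0 : (0 < n)%N. Proof. by case: n n4. Qed.

Lemma eps_a_gt1 : 1 < a.
Proof.
have : 1 < (2 * a)%:~R :> algC.
  have -> : (2 * a)%:~R = eps + eps^-1 by rewrite eps_inv s_eps rmorphM /=; ring.
  by apply: lt_trans eps_gt1 _; rewrite ltrDl invr_gt0.
rewrite -[1]/(1%:~R) ltr_int => a0.
have [a1|] := eqVneq a 1; last by lia.
have b0 : b = 0 by move: eps_norm; rewrite a1 expr1n expr2; nia.
by move: eps_gt1; rewrite a1 b0 mul0r addr0 ltxx.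
Qed.

Lemma eps_b_neq0 : b != 0.
Proof.
apply/eqP => b0; move: eps_norm eps_a_gt1; rewrite b0 expr0n mulr0 subr0 expr2; nia.
Qed.

(** Expand and use [n b^2 = a^2 - 1]. This identifies [eps] with the rational integer [2 (a + 1)]
    modulo squares. *)
Lemma eps_double : 2 * (a + 1)%:~R * eps = ((a + 1)%:~R + b%:~R * w) ^+ 2.
Proof.
have -> : ((a + 1)%:~R + b%:~R * w) ^+ 2 =
  (a + 1)%:~R ^+ 2 + b%:~R ^+ 2 * w ^+ 2 + 2 * (a + 1)%:~R * (b%:~R * w) by ring.
rewrite w2 -[n%:R]/(n%:Z%:~R) -rmorphXn -rmorphXn -rmorphM /=.
have -> : b ^+ 2 * n%:Z = a ^+ 2 - 1 by rewrite -eps_norm; ring.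
by rewrite rmorphXn rmorphB rmorphXn rmorphD rmorph1 /=; ring.
Qed.

Lemma eps_half_neq0 : (a + 1)%:~R + b%:~R * w != 0.
Proof.
rewrite -sqrf_eq0 -eps_double !mulf_neq0 ?pnatr_eq0 ?(gt_eqF eps_gt0) //.
by rewrite intr_eq0; have := eps_a_gt1; lia.
Qed.

Lemma eps_pow_neq1 k : eps ^+ k.+1 <> 1.
Proof. by move=> H; have := exprn_egt1 k.+1 eps_gt1; rewrite H ltxx. Qed.

(** A square root would be plus or minus a power of [eps], giving [eps] equal to one of its even
    powers although [eps > 1]. *)
Lemma eps_nonsquare z : Qsqrt n z -> z ^+ 2 <> eps.
Proof.
move=> Qz Ez; have Uz := uni_sqrt Qz Ez eps_uni.
have [_ _ _ e0] := eps_uni.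
have [l El] : exists l : int, z ^+ 2 = eps ^ (l * 2).
  case: fu => _ _ /(_ z)[|l [->|->]]; first exact/is_unitP.
    by exists l; rewrite -exprz_exp.
  by exists l; rewrite sqrrN -exprz_exp.
move: El; rewrite Ez; case: l => l.
  rewrite -PoszM -exprnP; case: l => [|l]; first by move/(@eps_pow_neq1 0).
  rewrite mulnC mul2n doubleS exprS => /(congr1 (fun x => x / eps)).
  by rewrite mulfV // mulrAC mulfV // mul1r => /esym /eps_pow_neq1.
rewrite NegzE mulNr -PoszM -exprnN => /(congr1 (fun x => x * eps ^+ (l.+1 * 2))).
by rewrite mulVf ?expf_neq0 // -exprS => /eps_pow_neq1.
Qed.

Lemma a1_nat : (a + 1)%:~R = (absz (a + 1))%:R :> algC.
Proof.
rewrite -[(absz _)%:R]/((absz (a + 1))%:Z%:~R); congr _%:~R; have := eps_a_gt1; lia.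
Qed.

(** If the natural number [2 (a + 1)] is a square in [E], then it, or its product with [n], is a
    perfect square. In both cases it is a square in [Q(sqrt n)], and then so is [eps]. *)
Lemma eps_not_double z : E z -> z ^+ 2 <> 2 * (a + 1)%:~R.
Proof.
move=> Ez; rewrite a1_nat -natrM => H.
have hn0 := eps_half_neq0.
have a10 : (a + 1)%:~R != 0 :> algC by rewrite intr_eq0; have := eps_a_gt1; lia.
have Ee : eps = ((a + 1)%:~R + b%:~R * w) ^+ 2 / (2 * (a + 1)%:~R).
  by rewrite -eps_double mulrAC divff ?mul1r // mulf_neq0 ?pnatr_eq0.
have [[c Ec]|[c Ec]] := E_sqr_nat Ez H.
  apply: (@eps_nonsquare (((a + 1)%:~R + b%:~R * w) / c%:R)); first by sf.
  by rewrite [RHS]Ee expr_div_n a1_nat -natrM Ec natrX.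
apply: (@eps_nonsquare (((a + 1)%:~R + b%:~R * w) * w / c%:R)); first by sf.
rewrite [RHS]Ee expr_div_n exprMn w2 a1_nat -[2]/(2%:R) -natrM -natrX -Ec !natrM.
have n0' : n%:R != 0 :> algC by rewrite pnatr_eq0 -lt0n.
by field; rewrite n0' /= -a1_nat a10.
Qed.

(** Both signs are covered by one condition because [(a + 1) (a - 1) = n b^2]: the product
    [c (a - 1)] is a perfect square exactly when [c (a + 1) n] is, and the latter is how [c (a + 1)]
    can be a square in [E] without being one in the integers. *)
Lemma square_pmP (c : nat) : (0 < c)%N ->
  square_pm c a <-> exists2 z, E z & z ^+ 2 = c%:R * (a + 1)%:~R.
Proof.
move=> c0; have a1 := eps_a_gt1; have eN := eps_norm.
have cn0 : c%:R != 0 :> algC by rewrite pnatr_eq0 -lt0n.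
have a10 : (a + 1)%:~R != 0 :> algC by rewrite intr_eq0; lia.
have bw2 : (b%:~R * w) ^+ 2 = (a + 1)%:~R * (a - 1)%:~R.
  rewrite exprMn w2 -[n%:R]/(n%:Z%:~R) -rmorphXn -!rmorphM /=; congr _%:~R.
  by rewrite mulrC; transitivity (a ^+ 2 - 1); [rewrite -eN; ring|ring].
split=> [[[k Ek]|[k Ek]]|[z Ez Hz]].
- exists k%:R; first by sf.
  by rewrite -natrX -[c%:R]/(c%:Z%:~R) -rmorphM /= Ek -[(k ^ 2)%N%:R]/((k ^ 2)%N%:Z%:~R).
- exists (c%:R * (b%:~R * w) / k%:R); first by sf.
  have k0 : k%:R ^+ 2 = c%:R * (a - 1)%:~R :> algC.
    by rewrite -[k%:R]/(k%:Z%:~R) -rmorphXn -Ek rmorphM.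
  have a10' : (a - 1)%:~R != 0 :> algC by rewrite intr_eq0; lia.
  have aux (u v t : algC) : u != 0 -> t != 0 -> u ^+ 2 * (v * t) / (u * t) = u * v.
    by move=> u0 t0; field; rewrite u0 t0.
  by rewrite expr_div_n exprMn bw2 k0 aux.
move: (Hz); rewrite a1_nat -natrM => /(E_sqr_nat Ez)[[k Ek]|[k Ek]].
  left; exists k; move: Ek; rewrite expr2 -mulnn; lia.
right; apply: (@Crat_sqr_int (c%:R * n%:R * b%:~R / k%:R)).
  by rewrite !(rpredM, rpredV) ?rpred_nat ?rpred_int.
have kk : k%:R ^+ 2 = c%:R * (a + 1)%:~R * n%:R :> algC.
  by rewrite a1_nat -!natrM Ek natrX.
have n0' : n%:R != 0 :> algC by rewrite pnatr_eq0 -lt0n.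
rewrite expr_div_n kk rmorphM /=.
have -> : (c%:R * n%:R * b%:~R) ^+ 2 = c%:R ^+ 2 * n%:R * (b%:~R * w) ^+ 2 :> algC.
  by rewrite !exprMn w2; ring.
have aux (u v t y : algC) : u != 0 -> v != 0 -> y != 0 ->
    u ^+ 2 * y * (v * t) / (u * v * y) = u * t.
  by move=> u0 v0 y0; field; rewrite u0 v0 y0.
by rewrite bw2 aux.
Qed.

(** Leaves finitely many possibilities for [a + 1], hence for [eps], modulo squares: the subproducts
    of the primes dividing [2 n]. They are enumerated later. *)
Lemma eps_mask_primes ls : all prime ls ->
  (forall l, prime l -> (l %| 2 * n)%N -> l \in ls) ->
  exists2 bs : bitseq, size bs = size ls &
    exists2 z, E z & z ^+ 2 = (foldr muln 1 (mask bs ls))%:R * (a + 1)%:~R.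
Proof.
move=> pls lsP; have a1 := eps_a_gt1; have b0 := eps_b_neq0; have eN := eps_norm.
have [||l pl nl|bs sz [k Ek]] := @nsq_mask_primes ls (absz (a + 1)); first by lia.
- by [].
- have : ~~ (l %| 2 * n)%N by apply: contra nl; apply: lsP.
  rewrite Euclid_dvdM // negb_or => /andP[l2 ln].
  apply: (@pell_logn_even n _ `|b|%N) => //; [by lia|by rewrite absz_gt0|].
  by rewrite -mulnn; move: eN; rewrite !expr2; nia.
exists bs => //; exists k%:R; first by sf.
rewrite -natrX -Ek a1_nat -natrM; congr _%:R.
by elim: (mask bs ls) => [|l u /= ->]; rewrite /= ?mul1n ?mulnA.
Qed.

(** The positive factor [v v^*] of [v^2] is a unit of the real field [Q(sqrt n)], so it is a power
    of [eps]; positivity excludes the opposite sign. *)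
Lemma eps_unit_sqr v : (forall z, E z -> z ^+ 2 <> 3) -> uni E v ->
  (v * s v) ^+ 2 = 1 -> exists l : int, v ^+ 2 = eps ^ l \/ v ^+ 2 = - eps ^ l.
Proof.
move=> E3 Uv N2; have Hv := E_unit_sqr si sw E3 Uv; case: (Uv) => Ev Av Av' v0.
have rho0 : 0 < v * v^* by rewrite lt_def mulf_neq0 ?conjC_eq0 //= nrm_ge0.
have Qr : Qsqrt n (v * v^*).
  rewrite Qsqrt_quad; apply: E_real.
    by have Ec := E_conj Ev; sf.
  by rewrite rmorphM /= conjCK mulrC.
have [l El] : exists l : int, v * v^* = eps ^ l.
  have [_ _ /(_ (v * v^*))[|l [|El]]] := fu.
  - apply/is_unitP => //; split=> //; last by rewrite (gt_eqF rho0).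
      by rewrite rpredM ?Aint_conj.
    by rewrite invfM rpredM // -fmorphV Aint_conj.
  - by exists l.
  - by move: rho0; rewrite El oppr_gt0 => /(lt_trans (exprz_gt0 l eps_gt0)); rewrite ltxx.
exists l; rewrite -El.
move/eqP: N2; rewrite sqrf_eq1 => /orP[]/eqP E1; case: Hv; rewrite E1.
- by rewrite mul1r; left.
- by rewrite mul1r; right.
- by rewrite mulN1r; right.
- by rewrite mulN1r opprK; left.
Qed.

End FundamentalUnit.

Lemma int_sqr_double (k t : int) : k ^+ 2 = 2 * t -> exists2 j, k = 2 * j & t = 2 * j ^+ 2.
Proof.
have [j [->|->]] := int_mod2 k; rewrite !expr2 => H; first by exists j; rewrite ?expr2; lia.
by exfalso; lia.
Qed.

Lemma int_sqr_prime (p : nat) (k t : int) : prime p -> k ^+ 2 = p%:Z * t ->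
  exists2 j, k = p%:Z * j & t = p%:Z * j ^+ 2.
Proof.
move=> pp E.
have : (p%:Z %| k * k)%Z by apply/dvdzP; exists t; rewrite -expr2 E mulrC.
rewrite dvdzE abszM /= Euclid_dvdM // orbb => /dvdnP[j Ej].
have /dvdzP[r Er] : (p%:Z %| k)%Z by rewrite dvdzE /= Ej dvdn_mull.
have p0 : p%:Z != 0 by have := prime_gt0 pp; lia.
exists r; first by rewrite mulrC.
by apply: (mulfI p0); rewrite -E Er; ring.
Qed.

Lemma nsq_int (c : nat) : nsq c -> exists k : int, k ^+ 2 = c%:Z.
Proof. by move=> [k ->]; exists k%:Z; rewrite -mulnn expr2; lia. Qed.

Lemma nat_square_int (c : int) : nat_square c -> exists k : int, k ^+ 2 = c.
Proof. by move=> [k ->]; exists k%:Z. Qed.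

(** Modulo 4 the expression is a difference of two squares, which is never 2. *)
Lemma no_sqr_diff2 (p : nat) (A B : int) : (p %% 4)%N = 1%N ->
  A ^+ 2 - p%:Z * B ^+ 2 <> 2 /\ p%:Z * B ^+ 2 - A ^+ 2 <> 2.
Proof.
move=> p4; have [j ->] : exists j, p = (4 * j + 1)%N.
  by exists (p %/ 4)%N; rewrite {1}(divn_eq p 4) p4 mulnC.
rewrite PoszD PoszM !expr2.
have [u Eu] := int_mod2 A; have [v Ev] := int_mod2 B.
by case: Eu => ->; case: Ev => ->; split=> H; lia.
Qed.

Lemma int_sqr_double_prime (p : nat) (k t : int) : prime p -> (p %% 4)%N = 1%N ->
  k ^+ 2 = p%:Z * (2 * t) -> exists j, t = 2 * (p%:Z * j ^+ 2).
Proof.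
move=> pp p4 /(int_sqr_prime pp)[j1 _ Hj1].
have [jp Ep] : exists j, p = (4 * j + 1)%N.
  by exists (p %/ 4)%N; rewrite {1}(divn_eq p 4) p4 mulnC.
move: Hj1; have [j2 [->|->]] := int_mod2 j1; rewrite !expr2.
  by exists j2; rewrite expr2; lia.
by rewrite Ep PoszD PoszM => H; exfalso; lia.
Qed.

(** The hypotheses give [t = 2 k1^2] and [t - 4 = 2 p j1^2], whence [k1^2 - p j1^2 = 2]. The next
    lemma has [p] on the other side. *)
Lemma no_sqr_pair (p : nat) (k j t : int) : prime p -> (p %% 4)%N = 1%N ->
  k ^+ 2 = 2 * t -> j ^+ 2 = p%:Z * (2 * (t - 4)) -> False.
Proof.
move=> pp p4 /int_sqr_double[k1 _ Hk1] /(int_sqr_double_prime pp p4)[j1 Hj1].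
by have [H _] := no_sqr_diff2 k1 j1 p4; apply: H; lia.
Qed.

Lemma no_sqr_pair' (p : nat) (k j t : int) : prime p -> (p %% 4)%N = 1%N ->
  k ^+ 2 = p%:Z * (2 * t) -> j ^+ 2 = 2 * (t - 4) -> False.
Proof.
move=> pp p4 /(int_sqr_double_prime pp p4)[k1 Hk1] /int_sqr_double[j1 _ Hj1].
by have [_ H] := no_sqr_diff2 j1 k1 p4; apply: H; lia.
Qed.

(* A unit of norm [+-i] over [Q(i)] would give a totally positive unit [rho] of
   [Q(sqrt p)] with [2 rho] a square, hence [A^2 - p B^2 = +-2]. *)
Lemma no_unit_norm_i (p : nat) (s : {rmorphism algC -> algC}) :
  let w := sqrtC p%:R in let E := quad Qi w in
  prime p -> (p %% 4)%N = 1%N -> s 'i = 'i -> s w = - w ->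
  (forall z, E z -> z ^+ 2 <> 3) ->
  forall v, uni E v -> (v * s v) ^+ 2 = 1.
Proof.
move=> w E pp p4 si sw E3 v Uv.
have Ef : subfield E by exact: E_subfield.
have Ei : E 'i by exact: E_i.
have N4 := E_norm_unit4 si sw Uv.
case/unit4_cases: (N4) => // N2; exfalso.
have Hv := E_unit_sqr si sw E3 Uv; case: Uv => Ev Av Av' v0.
set nu := v * s v in N2 N4 Hv; pose rho := v * v^*; rewrite -/rho in Hv.
have [Esv _ Qnu ss _] := E_aut si sw Ev.
have Evc := E_conj Ev.
have rho0 : 0 < rho by rewrite lt_def mulf_neq0 ?conjC_eq0 //= nrm_ge0.
have srho : s rho = s v * (s v)^* by rewrite rmorphM /= (E_conj_aut si sw Ev).
have srho0 : 0 < s rho.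
  by rewrite srho lt_def mulf_neq0 ?conjC_eq0 ?fmorph_eq0 //= nrm_ge0.
have Erho : E rho by rewrite /rho; sf.
have nu0 : nu != 0 by rewrite mulf_neq0 ?fmorph_eq0.
have rs : rho * s rho = 1.
  rewrite srho; transitivity (nrm nu); first by rewrite /nrm /nu /rho rmorphM /=; ring.
  by apply: Zi_unit_nrm; [exact: unit4_Zi|apply: unit4_Zi; rewrite exprVn N4 invr1|].
have rhoc : rho^* = rho by rewrite rmorphM /= conjCK mulrC.
have [_ Qt _ _ _] := E_aut si sw Erho.
have [t Et] : exists t : int, rho + s rho = t%:~R.
  apply: Crat_int_ring; last by rewrite rpredD // ?Aint_aut rpredM ?Aint_conj.
  apply: Qi_real_rat => //; rewrite rmorphD /= rhoc.
  by rewrite srho rmorphM /= conjCK [X in _ + X]mulrC.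
have t0 : 0 < t by rewrite -(ltr_int algC) -Et addr_gt0.
have [al [be [Qal Qbe Erw]]] : quad CratS w rho by apply: E_real.
(* So [(t + 2) (t - 2)] is [p] times a rational square; below [t - 2] is written [t + 2 - 4]. *)
have Dr : (t ^+ 2 - 4)%:~R = p%:R * (2 * be) ^+ 2.
  have -> : (t ^+ 2 - 4)%:~R = (rho - s rho) ^+ 2.
    transitivity ((rho + s rho) ^+ 2 - 4 * (rho * s rho)); last ring.
    by rewrite rs Et mulr1 rmorphB rmorphXn.
  rewrite Erw rmorphD rmorphM /= sw !aut_Crat // -[p%:R]sqrtCK -/w; ring.
have [ka [k2 Ek]] : exists ka, ka ^+ 2 = -1 /\ v ^+ 2 = ka * rho.
  by case: Hv => ->; [exists nu|exists (- nu)]; rewrite ?sqrrN ?mulNr.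
have Eka : E ka.
  by have : (ka ^+ 2 == 'i ^+ 2) by [rewrite k2 sqrCi]; rewrite eqf_sqr => /orP[]/eqP ->; sf.
have rn0 : rho != 0 by rewrite gt_eqF.
(* A square root of [2 (t + 2)]: as [(1 + ka)^2 = 2 ka] and [v^2 = ka rho] with [ka^2 = -1], the
   square is [2 (rho + 1)^2 / rho = 2 (rho + rho^-1 + 2)]. *)
have ET : E ('i * v * (1 + ka) * (rho + 1) / rho) by sf.
have HT : ('i * v * (1 + ka) * (rho + 1) / rho) ^+ 2 = (absz (2 * (t + 2)))%:R.
  rewrite -[(absz _)%:R]/((absz (2 * (t + 2)))%:Z%:~R) gez0_abs; last by rewrite ltW // mulr_gt0 // addr_gt0.
  have -> : (2 * (t + 2))%:~R = 2 * (rho + s rho + 2) by rewrite Et intrM intrD.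
  have rV : s rho = rho^-1 by apply: (mulfI rn0); rewrite rs mulfV.
  have aux (i0 v1 r k : algC) : r != 0 -> i0 ^+ 2 = -1 -> k ^+ 2 = -1 ->
      v1 ^+ 2 = k * r -> (i0 * v1 * (1 + k) * (r + 1) / r) ^+ 2 = 2 * (r + r^-1 + 2).
    move=> r0 ii kk vv.
    transitivity (i0 ^+ 2 * v1 ^+ 2 * (1 + 2 * k + k ^+ 2) * (r + 1) ^+ 2 / r ^+ 2).
      by field.
    rewrite ii vv kk; transitivity (- k ^+ 2 * 2 * (r + 1) ^+ 2 / r); first by field.
    by rewrite kk; field.
  by rewrite rV; apply: aux => //; exact: sqrCi.
have Q2 : 2 * be \in Crat by rewrite rpredM ?rpred_nat.
have p0 := prime_gt0 pp.
have pn0 : p%:R != 0 :> algC by rewrite pnatr_eq0 -lt0n.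
have tt : (t ^+ 2 - 4)%:~R = (t + 2)%:~R * (t + 2 - 4)%:~R :> algC.
  by rewrite -rmorphM /=; congr _%:~R; ring.
have t2 : 0 < t + 2 by rewrite addr_gt0.
have t20 : (t + 2)%:~R != 0 :> algC by rewrite intr_eq0 gt_eqF.
have Qx (k : int) : 2 * p%:R * (2 * be) / k%:~R \in Crat.
  by rewrite !(rpredM, rpredV) ?rpred_nat ?rpred_int.
have abs2 : (absz (2 * (t + 2)))%:Z = 2 * (t + 2) by rewrite gez0_abs // ltW // mulr_gt0.
have Ex (y : algC) : (2 * p%:R * (2 * be) / y) ^+ 2 =
    4 * p%:R * ((t + 2)%:~R * (t + 2 - 4)%:~R) / y ^+ 2.
  by rewrite -tt Dr expr_div_n; congr (_ / _); ring.
have [y Ey] : exists y : algC, (t + 2 - 4)%:~R = y by eexists.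
have [u Eu] : exists u : algC, (t + 2)%:~R = u by eexists.
rewrite Eu in t20 Ex; rewrite Ey in Ex; rename t20 into u0.
(* Either [2 (t + 2)] or [2 p (t + 2)] is a perfect square. Dividing into
   [(t + 2) (t - 2) = p (2 be)^2] shows that [2 p (t - 2)], respectively [2 (t - 2)], is one too. *)
have [/nsq_int[k]|/nsq_int[k]] := E_sqr_nat ET HT; rewrite ?PoszM abs2 => H1.
- have k2' : k%:~R ^+ 2 = 2 * u by rewrite -rmorphXn /= H1 rmorphM /= Eu.
  have [j Ej] : exists j : int, j ^+ 2 = p%:Z * (2 * (t + 2 - 4)).
    apply: nat_square_int; apply: Crat_sqr_int (Qx k) _.
    by rewrite Ex k2' !rmorphM /= Ey -[p%:~R]/(p%:R); field.
  exact: (no_sqr_pair pp p4 H1 Ej).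
- have k2' : k%:~R ^+ 2 = 2 * u * p%:R by rewrite -rmorphXn /= H1 !rmorphM /= Eu.
  have [j Ej] : exists j : int, j ^+ 2 = 2 * (t + 2 - 4).
    apply: nat_square_int; apply: Crat_sqr_int (Qx k) _.
    by rewrite Ex k2' !rmorphM /= Ey; field; rewrite u0 pn0.
  by rewrite mulrC in H1; apply: (no_sqr_pair' pp p4 H1 Ej).
Qed.

(** * Ideals and capitulation *)

Section Ideals.
Variables (K : set algC) (Kf : subfield K).
Local Notation O := (int_ring K).

Lemma ideal_sub I x : is_ideal K I -> I x -> O x. Proof. by case=> /(_ x). Qed.
Lemma ideal0 I : is_ideal K I -> I 0. Proof. by case. Qed.
Lemma idealD I x y : is_ideal K I -> I x -> I y -> I (x + y).
Proof. by case=> _ _ /(_ x y). Qed.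
Lemma idealMl I r x : is_ideal K I -> O r -> I x -> I (r * x).
Proof. by case=> _ _ _ /(_ r x). Qed.
Lemma idealMr I r x : is_ideal K I -> O r -> I x -> I (x * r).
Proof. by rewrite mulrC; exact: idealMl. Qed.

Lemma int_ring_ideal : is_ideal K O.
Proof. by split=> [x //|||]; [exact: int_ring0|exact: int_ringD|exact: int_ringM]. Qed.

Lemma smallest_ideal S : S `<=` O -> is_ideal K (smallest (is_ideal K) S).
Proof.
move=> SO; split=> [x|J [Ji SJ]|x y Hx Hy J HJ|r x Or Hx J HJ].
- by apply; split=> //; exact: int_ring_ideal.
- exact: ideal0.
- by apply: idealD; [case: HJ|exact: Hx|exact: Hy].
- by apply: idealMl; [case: HJ| |exact: Hx].
Qed.

Lemma smallest_ideal_gen S : S `<=` smallest (is_ideal K) S.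
Proof. by move=> x Sx J [_]; apply. Qed.

(** The induction principle for generated ideals: inclusions below are proved by gathering the
    elements with the desired property into an ideal [M]. *)
Lemma smallest_ideal_min S M : is_ideal K M -> S `<=` M ->
  smallest (is_ideal K) S `<=` M.
Proof. by move=> Mi SM x; apply. Qed.

Lemma ideal_mul_ideal I J : is_ideal K I -> is_ideal K J -> is_ideal K (ideal_mul K I J).
Proof.
move=> Ii Ji; apply: smallest_ideal => _ [x Ix [y Jy <-]].
by apply: int_ringM => //; [apply: ideal_sub Ix|apply: ideal_sub Jy].
Qed.

Lemma ideal_mulI I J x y : I x -> J y -> ideal_mul K I J (x * y).
Proof. by move=> Ix Jy; apply: smallest_ideal_gen; exists x => //; exists y. Qed.

Lemma ideal_mul_sub I J M : is_ideal K M -> (forall x y, I x -> J y -> M (x * y)) ->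
  ideal_mul K I J `<=` M.
Proof.
by move=> Mi H; apply: smallest_ideal_min => // _ [x Ix [y Jy <-]]; apply: H.
Qed.

Lemma principal_ideal a : O a -> is_ideal K (principal K a).
Proof.
move=> Oa; split.
- by move=> _ [r Or <-]; oi.
- by exists 0; [oi|rewrite mulr0].
- by move=> _ _ [r Or <-] [t Ot <-]; exists (r + t); [oi|ring].
- by move=> r _ Or [t Ot <-]; exists (r * t); [oi|ring].
Qed.

Lemma principal_self a : principal K a a.
Proof. by exists 1; [oi|rewrite mulr1]. Qed.

Lemma principal_sub a I : is_ideal K I -> I a -> principal K a `<=` I.
Proof. by move=> Ii Ia _ [r Or <-]; apply: idealMr. Qed.

Lemma nz_idealP I : nz_ideal K I <-> is_ideal K I /\ exists2 x, I x & x != 0.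
Proof.
split=> [[Ii I0]|[Ii [x Ix x0]]]; split=> //.
  apply: contrapT => H; apply: I0; apply/seteqP; split=> [x Ix /=|_ -> ]; last exact: ideal0.
  by apply: contrapT => /eqP x0; apply: H; exists x.
by move=> E; move: Ix; rewrite E /= => x00; rewrite x00 eqxx in x0.
Qed.

Lemma int_ring_nz : nz_ideal K O.
Proof.
apply/nz_idealP; split; first exact: int_ring_ideal.
by exists 1; [oi|exact: oner_neq0].
Qed.

Lemma ideal_mul_nz I J : nz_ideal K I -> nz_ideal K J -> nz_ideal K (ideal_mul K I J).
Proof.
move=> /nz_idealP[Ii [x Ix x0]] /nz_idealP[Ji [y Jy y0]]; apply/nz_idealP.
split; first exact: ideal_mul_ideal.
by exists (x * y); [exact: ideal_mulI|rewrite mulf_neq0].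
Qed.

Lemma ideal_equiv_refl I : ideal_equiv K I I.
Proof. by exists 1, 1; split=> //; oi; exact: oner_neq0. Qed.

Lemma ideal_equiv_sym I J : ideal_equiv K I J -> ideal_equiv K J I.
Proof. by move=> [a [b [Oa Ob a0 b0 E]]]; exists b, a. Qed.

Lemma scale_comp (a b : algC) (I : set algC) :
  [set a * b * x | x in I] = [set a * x | x in [set b * x | x in I]].
Proof. by rewrite image_comp; apply: eq_imagel => x _ /=; rewrite mulrA. Qed.

Lemma ideal_equiv_trans J I M : ideal_equiv K I J -> ideal_equiv K J M -> ideal_equiv K I M.
Proof.
move=> [a [b [Oa Ob a0 b0 E]]] [c [e [Oc Oe c0 e0 E']]].
exists (c * a), (b * e); split; oi; rewrite ?mulf_neq0 //.
by rewrite scale_comp E -scale_comp [c * b]mulrC (scale_comp b c) E' -scale_comp.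
Qed.

Lemma ideal_class_eq I J : ideal_equiv K I J -> ideal_class K I = ideal_class K J.
Proof.
move=> IJ; apply/seteqP; split=> M [Mn H]; split=> //.
  by apply: ideal_equiv_trans H; apply: ideal_equiv_sym.
by apply: ideal_equiv_trans H.
Qed.

Lemma ideal_class_eqP I J : nz_ideal K J ->
  ideal_class K I = ideal_class K J -> ideal_equiv K I J.
Proof.
move=> Jn E; have : ideal_class K J J by split=> //; exact: ideal_equiv_refl.
by rewrite -E => -[].
Qed.

(** The relation [a' b' t = a b z] is carried through the generated ideal in place of a division, so
    that no fractional ideals appear. *)
Lemma ideal_mul_scale_sub I J I' J' a b a' b' :
  is_ideal K I -> is_ideal K J -> is_ideal K I' -> is_ideal K J' ->
  [set a * x | x in I] = [set a' * x | x in I'] ->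
  [set b * x | x in J] = [set b' * x | x in J'] ->
  [set a * b * x | x in ideal_mul K I J] `<=` [set a' * b' * x | x in ideal_mul K I' J'].
Proof.
move=> Ii Ji Ii' Ji' EI EJ.
have IJi' := ideal_mul_ideal Ii' Ji'.
suff H : ideal_mul K I J `<=`
    [set z | O z /\ exists2 t, ideal_mul K I' J' t & a' * b' * t = a * b * z].
  by move=> _ [z /H[_ [t Ht Et]] <-]; exists t.
apply: ideal_mul_sub.
  split.
  - by move=> z [].
  - by split; [oi|exists 0; [exact: (ideal0 IJi')|rewrite !mulr0]].
  - move=> x y [Ox [t Ht Et]] [Oy [t' Ht' Et']]; split; first by oi.
    by exists (t + t'); [exact: (idealD IJi')|rewrite !mulrDr Et Et'].
  - move=> r x Or [Ox [t Ht Et]]; split; first by oi.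
    exists (r * t); first exact: (idealMl IJi').
    by transitivity (r * (a' * b' * t)); [ring|rewrite Et; ring].
move=> x y Ix Jy; split; first by have := ideal_sub Ii Ix; have := ideal_sub Ji Jy; move=> *; oi.
have [x' Ix' Ex] : [set a' * x | x in I'] (a * x) by rewrite -EI; exists x.
have [y' Jy' Ey] : [set b' * x | x in J'] (b * y) by rewrite -EJ; exists y.
exists (x' * y'); first exact: ideal_mulI.
by transitivity ((a' * x') * (b' * y')); [ring|rewrite Ex Ey; ring].
Qed.

Lemma ideal_equiv_mul I J I' J' :
  is_ideal K I -> is_ideal K J -> is_ideal K I' -> is_ideal K J' ->
  ideal_equiv K I I' -> ideal_equiv K J J' ->
  ideal_equiv K (ideal_mul K I J) (ideal_mul K I' J').
Proof.
move=> Ii Ji Ii' Ji' [a [a' [Oa Oa' a0 a0' EI]]] [b [b' [Ob Ob' b0 b0' EJ]]].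
exists (a * b), (a' * b'); split; oi; rewrite ?mulf_neq0 //.
by apply/seteqP; split; apply: ideal_mul_scale_sub.
Qed.

Lemma class_mulE I J : nz_ideal K I -> nz_ideal K J ->
  class_mul K (ideal_class K I) (ideal_class K J) = ideal_class K (ideal_mul K I J).
Proof.
move=> In Jn; have [Ii _] := In; have [Ji _] := Jn.
apply/seteqP; split=> M.
  move=> [I1 [J1 [[[Ii1 _] H1] [[Ji1 _] H2] [Mn H]]]]; split=> //.
  by apply: ideal_equiv_trans H; apply: ideal_equiv_mul.
by move=> HM; exists I, J; split=> //; split=> //; exact: ideal_equiv_refl.
Qed.

Lemma principal_equiv a : O a -> a != 0 ->
  ideal_class K (principal K a) = class_one K.
Proof.
move=> Oa a0; apply: ideal_class_eq; exists 1, a; split; oi.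
- exact: oner_neq0.
- apply/seteqP; split=> [_ [_ [r Or <-] <-]|_ [r Or <-]].
    by exists r => //; rewrite mul1r.
  by exists (a * r); [exists r|rewrite mul1r].
Qed.

(** For [y] in [H], the square of [y / c] is integral, so [H] is contained in [(c)]. Then the
    product of [H] with itself lies in [c H]; it contains [c^2], so [c] is in [H]. *)
Lemma ideal_sqrt_principal H c : is_ideal K H -> K c -> c != 0 ->
  ideal_mul K H H = principal K (c ^+ 2) -> H = principal K c.
Proof.
move=> Hi Kc c0 E.
have Hc : H `<=` principal K c.
  move=> y Hy; have [r [Kr Ar] Er] : principal K (c ^+ 2) (y * y) by rewrite -E; apply: ideal_mulI.
  have [Ky Ay] := ideal_sub Hi Hy.
  exists (y / c); last by rewrite mulrC divfK.
  split; first by sf.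
  apply: Aint_sqr; rewrite expr_div_n [y ^+ 2]expr2 -Er mulrAC divff ?mul1r //.
  by rewrite expf_neq0.
apply/seteqP; split=> //; apply: principal_sub => //.
suff S : ideal_mul K H H `<=` [set z | O z /\ exists2 h, H h & z = c * h].
  have [_ [h Hh]] : [set z | O z /\ exists2 h, H h & z = c * h] (c ^+ 2).
    by apply: S; rewrite E; apply: principal_self.
  by rewrite expr2 => /(mulfI c0) ->.
apply: ideal_mul_sub.
  split.
  - by move=> z [].
  - by split; [oi|exists 0; [exact: (ideal0 Hi)|rewrite mulr0]].
  - move=> x y [Ox [h Hh Ex]] [Oy [h' Hh' Ey]]; split; first by oi.
    by exists (h + h'); [exact: (idealD Hi)|rewrite Ex Ey; ring].
  - move=> r x Or [Ox [h Hh Ex]]; split; first by oi.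
    by exists (r * h); [exact: (idealMl Hi)|rewrite Ex; ring].
move=> x y Hx Hy; split.
  by have Ox := ideal_sub Hi Hx; have Oy := ideal_sub Hi Hy; oi.
have [r Or <-] := Hc x Hx; exists (r * y); first exact: (idealMl Hi).
by ring.
Qed.

End Ideals.

(** * Capitulation in a quadratic extension with an integer of trace 1 *)

Section Capitulation.
Variables (K L : set algC) (sg : {rmorphism algC -> algC}) (th : algC).
Hypotheses (Kf : subfield K) (Lf : subfield L) (KL : forall x, K x -> L x).
Hypothesis sgK : forall x, K x -> sg x = x.
Hypothesis sgL : forall z, L z ->
  [/\ L (sg z), K (z + sg z), K (z * sg z), sg (sg z) = z & sg z = z -> K z].
Hypotheses (Oth : int_ring L th) (th1 : th + sg th = 1).

Local Notation ext := (ideal_ext L).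

Lemma int_ring_KL x : int_ring K x -> int_ring L x.
Proof. by move=> [Kx Ax]; split=> //; exact: KL. Qed.

Lemma ext_ideal I : is_ideal K I -> is_ideal L (ext I).
Proof. by move=> Ii; apply: smallest_ideal => // x /(ideal_sub Ii)/int_ring_KL. Qed.

Lemma ext_gen I x : I x -> ext I x.
Proof. exact: smallest_ideal_gen. Qed.

Lemma ext_sub I M : is_ideal L M -> I `<=` M -> ext I `<=` M.
Proof. exact: smallest_ideal_min. Qed.

Lemma sg_int z : int_ring L z -> int_ring L (sg z).
Proof. by move=> [Lz Az]; have [Lsz _ _ _ _] := sgL Lz; split=> //; rewrite /= Aint_aut. Qed.

Lemma trace_int z : int_ring L z -> int_ring K (z + sg z).
Proof.
move=> Oz; have [_ As] := sg_int Oz; case: Oz => Lz Az.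
by have [_ Kt _ _ _] := sgL Lz; split=> //; rewrite /=; ai.
Qed.

(* Since [th] has trace 1, an element [z] of [K] is the trace of [z th]. *)
Lemma ext_contract I z : is_ideal K I -> K z -> ext I z -> I z.
Proof.
move=> Ii Kz Iz.
(* The integers of [L] all of whose multiples have their trace in [I] form an ideal containing [I],
   hence its extension. *)
have S : ext I `<=` [set x | int_ring L x /\ forall t, int_ring L t -> I (x * t + sg (x * t))].
  apply: ext_sub.
    split.
    - by move=> x [].
    - by split=> [|t Ot]; [oi|rewrite mul0r rmorph0 addr0; exact: (ideal0 Ii)].
    - move=> x y [Ox Hx] [Oy Hy]; split=> [|t Ot]; first by oi.
      have -> : (x + y) * t + sg ((x + y) * t) = (x * t + sg (x * t)) + (y * t + sg (y * t)).
        by rewrite mulrDl rmorphD; ring.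
      by apply: (idealD Ii); [exact: Hx|exact: Hy].
    - move=> r x Or [Ox Hx]; split=> [|t Ot]; first by oi.
      by have -> : r * x * t = x * (r * t) by [ring]; apply: Hx; oi.
  move=> x Ix; split=> [|t Ot]; first exact/int_ring_KL/(ideal_sub Ii).
  have Kx : K x by case: (ideal_sub Ii Ix).
  rewrite rmorphM /= (sgK Kx) -mulrDr; apply: (idealMr Ii) => //; exact: trace_int.
have [_ /(_ th Oth)] := S z Iz.
by rewrite rmorphM /= (sgK Kz) -mulrDr th1 mulr1.
Qed.

Lemma ext_equiv_sub I J a b : is_ideal K I -> is_ideal K J ->
  [set a * x | x in I] `<=` [set b * x | x in J] ->
  [set a * x | x in ext I] `<=` [set b * x | x in ext J].
Proof.
move=> Ii Ji E; have Je := ext_ideal Ji.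
suff H : ext I `<=` [set z | int_ring L z /\ exists2 t, ext J t & b * t = a * z].
  by move=> _ [z /H[_ [t Ht Et]] <-]; exists t.
apply: ext_sub.
  split.
  - by move=> z [].
  - by split; [oi|exists 0; [exact: (ideal0 Je)|rewrite !mulr0]].
  - move=> x y [Ox [t Ht Et]] [Oy [t' Ht' Et']]; split; first by oi.
    by exists (t + t'); [exact: (idealD Je)|rewrite !mulrDr Et Et'].
  - move=> r x Or [Ox [t Ht Et]]; split; first by oi.
    exists (r * t); first exact: (idealMl Je).
    by transitivity (r * (b * t)); [ring|rewrite Et; ring].
move=> x Ix; split; first exact/int_ring_KL/(ideal_sub Ii).
have [x' Ix' Ex] : [set b * x | x in J] (a * x) by apply: E; exists x.
by exists x' => //; apply: ext_gen.
Qed.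

Lemma ext_equiv I J : is_ideal K I -> is_ideal K J ->
  ideal_equiv K I J -> ideal_equiv L (ext I) (ext J).
Proof.
move=> Ii Ji [a [b [Oa Ob a0 b0 E]]]; exists a, b.
split; try exact: int_ring_KL; rewrite //.
by apply/seteqP; split; apply: ext_equiv_sub; rewrite // E.
Qed.

Lemma class_extE I : nz_ideal K I ->
  class_ext L (ideal_class K I) = ideal_class L (ext I).
Proof.
move=> In; have [Ii _] := In; apply/seteqP; split=> M.
  move=> [J [[Ji _] IJ] [Mn H]]; split=> //.
  by apply: ideal_equiv_trans H => //; apply: ext_equiv.
by move=> HM; exists I => //; split=> //; exact: ideal_equiv_refl.
Qed.

Definition capitulates I al := [/\ int_ring L al, al != 0 & ext I = principal L al].

Lemma cap_kernelP I : nz_ideal K I ->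
  cap_kernel K L (ideal_class K I) <-> exists al, capitulates I al.
Proof.
move=> In; have [Ii _] := In; split=> [[_]|[al [Oal al0 E]]].
  rewrite class_extE // => /ideal_class_eqP -/(_ Lf (int_ring_nz Lf)).
  move=> [a [b [Oa Ob a0 b0 E]]].
  have Ep : ext I = principal L (b / a).
    apply/seteqP; split=> z.
      move=> Iz; have [r Or Er] : [set b * x | x in int_ring L] (a * z) by rewrite -E; exists z.
      by exists r => //; rewrite mulrAC Er mulrAC divff ?mul1r.
    move=> [r Or <-].
    have [y Iy Ey] : [set a * x | x in ext I] (b * r) by rewrite E; exists r.
    by rewrite mulrAC -Ey mulrAC divff ?mul1r.
  exists (b / a); split=> //; last by rewrite mulf_neq0 ?invr_eq0.
  by apply: (ideal_sub (ext_ideal Ii)); rewrite Ep; apply: principal_self.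
split; first by exists I.
by rewrite class_extE // E; apply: principal_equiv.
Qed.

Lemma ext_mulI I J x y : is_ideal K I -> is_ideal K J ->
  ext I x -> ext J y -> ext (ideal_mul K I J) (x * y).
Proof.
move=> Ii Ji Ix Jy.
have IIe := ext_ideal (ideal_mul_ideal Kf Ii Ji).
have S : ext I `<=` [set z | int_ring L z /\ forall y, ext J y -> ext (ideal_mul K I J) (z * y)].
  apply: ext_sub.
    split.
    - by move=> z [].
    - by split=> [|t _]; [oi|rewrite mul0r; exact: (ideal0 IIe)].
    - move=> u v [Ou Hu] [Ov Hv]; split=> [|t It]; first by oi.
      by rewrite mulrDl; apply: (idealD IIe); [exact: Hu|exact: Hv].
    - move=> r u Or [Ou Hu]; split=> [|t It]; first by oi.
      by rewrite -mulrA; apply: (idealMl IIe) => //; exact: Hu.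
  move=> u Iu; have Ou : int_ring L u by exact/int_ring_KL/(ideal_sub Ii).
  split=> //.
  suff S' : ext J `<=` [set t | int_ring L t /\ ext (ideal_mul K I J) (u * t)].
    by move=> t /S'[].
  apply: ext_sub.
    split.
    - by move=> z [].
    - by split; [oi|rewrite mulr0; exact: (ideal0 IIe)].
    - move=> t z [Ot Ht] [Oz Hz]; split; first by oi.
      by rewrite mulrDr; apply: (idealD IIe).
    - move=> r t Or [Ot Ht]; split; first by oi.
      by rewrite mulrCA; apply: (idealMl IIe).
  move=> t It; split; first exact/int_ring_KL/(ideal_sub Ji).
  by apply: ext_gen; apply: ideal_mulI.
by have [_] := S x Ix; apply.
Qed.

(** If [x = al r] and [y = al t] are in [I], then [y] is fixed by [sg], so
    [x y = al (sg al) r (sg t)]. Conversely [ext I] is stable under [sg], so [al * sg al] lies in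
    the extension of [I^2] and, being in [K], in [I^2] itself. *)
Lemma capitulates_norm I al : is_ideal K I -> capitulates I al ->
  [/\ ideal_mul K I I = principal K (al * sg al), int_ring K (al * sg al) &
      uni L (al / sg al)].
Proof.
move=> Ii [Oal al0 E]; have Ie := ext_ideal Ii.
have [Lal Aal] := Oal; have [Lsal _ Kn ss _] := sgL Lal.
have Osal := sg_int Oal; have [_ Asal] := Osal.
have sal0 : sg al != 0 by rewrite fmorph_eq0.
have On : int_ring K (al * sg al) by split=> //; rewrite /=; ai.
have Ial : ext I al by rewrite E; apply: principal_self.
have stab : ext I `<=` [set z | int_ring L z /\ ext I (sg z)].
  apply: ext_sub.
    split.
    - by move=> z [].
    - by split; [oi|rewrite rmorph0; exact: (ideal0 Ie)].
    - move=> x y [Ox Hx] [Oy Hy]; split; first by oi.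
      by rewrite rmorphD; exact: (idealD Ie).
    - move=> r x Or [Ox Hx]; split; first by oi.
      by rewrite rmorphM; apply: (idealMl Ie) => //; exact: sg_int.
  move=> x Ix; split; first exact/int_ring_KL/(ideal_sub Ii).
  by rewrite sgK; [apply: ext_gen|case: (ideal_sub Ii Ix)].
have [_ Isal] := stab al Ial.
split=> //; last first.
  have [r [Lr Ar] Er] : principal L al (sg al) by rewrite -E.
  have r0 : r != 0 by apply: contraNneq sal0 => r0; rewrite -Er r0 mulr0.
  have -> : al / sg al = r^-1 by rewrite -Er invfM mulrA divff ?mul1r.
  split; rewrite ?invrK ?invr_eq0 //; first by sf.
  (* Applying [sg] to [al * r = sg al] and substituting gives [r * sg r = 1]. *)
  suff -> : r^-1 = sg r by rewrite Aint_aut.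
  apply: (mulfI r0); rewrite divff //; apply: (mulfI al0).
  by rewrite mulr1 mulrA Er -rmorphM /= Er ss.
apply/seteqP; split.
  apply: ideal_mul_sub; first exact: principal_ideal.
  move=> x y Ix Iy.
  have [Kx Ax] := ideal_sub Ii Ix; have [Ky Ay] := ideal_sub Ii Iy.
  have [r [Lr Ar] Er] : principal L al x by rewrite -E; apply: ext_gen.
  have [t [Lt At] Et] : principal L al y by rewrite -E; apply: ext_gen.
  have Exy : al * sg al * (r * sg t) = x * y.
    by rewrite -Er -[in RHS](sgK Ky) -Et rmorphM; ring.
  exists (r * sg t) => //; split; last by rewrite /= rpredM ?Aint_aut.
  have -> : r * sg t = x * y / (al * sg al).
    by rewrite -Exy mulrAC divff ?mul1r // mulf_neq0.
  by sf.
have IIi := ideal_mul_ideal Kf Ii Ii.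
apply: principal_sub => //; apply: ext_contract => //.
have IIe := ext_ideal IIi.
exact: ext_mulI.
Qed.

Lemma cap_kernel_subgroup : Cl_subgroup K (cap_kernel K L).
Proof.
split.
- by move=> A [].
- apply/cap_kernelP; first exact: int_ring_nz.
  exists 1; split; [by oi|exact: oner_neq0|].
  have Oi := int_ring_ideal Kf.
  apply/seteqP; split=> [z /(ideal_sub (ext_ideal Oi)) Oz|]; first by exists z; rewrite ?mul1r.
  by apply: principal_sub; [exact: ext_ideal|apply: ext_gen; oi].
- move=> _ _ [[I In <-] HI] [[J Jn <-] HJ].
  have [Ii _] := In; have [Ji _] := Jn.
  have [al [Oal al0 Eal]] : exists al, capitulates I al by apply/cap_kernelP => //; split=> //; exists I.
  have [be [Obe be0 Ebe]] : exists al, capitulates J al by apply/cap_kernelP => //; split=> //; exists J.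
  rewrite class_mulE //; apply/cap_kernelP; first exact: ideal_mul_nz.
  have Oab : int_ring L (al * be) by oi.
  have Pab := principal_ideal Lf Oab.
  exists (al * be); split; [by []|by rewrite mulf_neq0|].
  apply/seteqP; split; last first.
    apply: principal_sub; first by apply/ext_ideal/ideal_mul_ideal.
    by apply: ext_mulI => //; rewrite ?Eal ?Ebe; apply: principal_self.
  apply: ext_sub => //.
  suff S : ideal_mul K I J `<=` [set z | int_ring K z /\ principal L (al * be) z] by move=> z /S[].
  apply: ideal_mul_sub.
    split.
    - by move=> z [].
    - by split; [oi|exact: (ideal0 Pab)].
    - by move=> x y [Ox Hx] [Oy Hy]; split; [oi|exact: (idealD Pab)].
    - by move=> r x Or [Ox Hx]; split; [oi|apply: (idealMl Pab) => //; exact: int_ring_KL].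
  move=> x y Ix Jy; split.
    by have Ox := ideal_sub Ii Ix; have Oy := ideal_sub Ji Jy; oi.
  have [r Or Er] : principal L al x by rewrite -Eal; apply: ext_gen.
  have [t Ot Et] : principal L be y by rewrite -Ebe; apply: ext_gen.
  by exists (r * t); [oi|rewrite -Er -Et; ring].
(* The square of a capitulating ideal is generated by a norm, so every class of the kernel is its
   own inverse. *)
- move=> A HA; exists A => //; case: (HA) => -[I In EA] _; rewrite -EA in HA *.
  have [Ii _] := In; have [al Hal] := (cap_kernelP In).1 HA.
  have [E On _] := capitulates_norm Ii Hal; case: Hal => _ al0 _.
  by rewrite class_mulE // E principal_equiv // mulf_neq0 ?fmorph_eq0.
Qed.

(** The square of [ext I] is generated by [de], hence by [al^2]; extracting the root gives
    [ext I = (al)]. *)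
Lemma sqrt_capitulates I de u al : is_ideal K I -> int_ring K de ->
  ideal_mul K I I = principal K de -> uni L u -> L al -> al != 0 ->
  de * u = al ^+ 2 -> capitulates I al.
Proof.
move=> Ii Od E [Lu Au Au' u0] Lal al0 Edu.
have Ie := ext_ideal Ii; have OdL := int_ring_KL Od; have [Ld Ad] := OdL.
have IIi := ideal_mul_ideal Kf Ii Ii.
have Oal : int_ring L al by split=> //; apply: Aint_sqr; rewrite -Edu; ai.
split=> //; apply: ideal_sqrt_principal => //.
have XXi := ideal_mul_ideal Lf Ie Ie.
have Oal2 : int_ring L (al ^+ 2) by oi.
apply/seteqP; split.
  apply: ideal_mul_sub; first exact: principal_ideal.
  move=> x y Ix Iy.
  have : ext (ideal_mul K I I) `<=` principal L de.
    apply: ext_sub; first exact: principal_ideal.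
    by rewrite E => _ [r Or <-]; exists r => //; apply: int_ring_KL.
  move/(_ _ (ext_mulI Ii Ii Ix Iy)) => [r [Lr Ar] <-].
  exists (u^-1 * r); first by split; rewrite /=; [sf|ai].
  by rewrite -Edu; field.
apply: principal_sub => //; rewrite -Edu mulrC; apply: (idealMl XXi) => //.
suff S : ideal_mul K I I `<=` [set z | int_ring K z /\ ideal_mul L (ext I) (ext I) z].
  by have [] := S de; rewrite // E; apply: principal_self.
apply: ideal_mul_sub.
  split.
  - by move=> z [].
  - by split; [oi|exact: (ideal0 XXi)].
  - by move=> x y [Ox Hx] [Oy Hy]; split; [oi|exact: (idealD XXi)].
  - by move=> r x Or [Ox Hx]; split; [oi|apply: (idealMl XXi) => //; exact: int_ring_KL].
move=> x y Ix Iy; split.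
  by have Ox := ideal_sub Ii Ix; have Oy := ideal_sub Ii Iy; oi.
by apply: ideal_mulI; apply: ext_gen.
Qed.

End Capitulation.

(** For [t] dividing [d] the ideal [(t, sqrt d)] has square [(t)], so this is the condition under
    which it becomes principal in [K]. *)
Definition usq (K : set algC) (x : algC) : Prop :=
  exists u z, [/\ uni K u, K z, z != 0 & x * u = z ^+ 2].

Section Usq.
Variables (K : set algC) (Kf : subfield K).

Lemma usqM x y : usq K x -> usq K y -> usq K (x * y).
Proof.
move=> [u [z [Uu Kz z0 E]]] [v [t [Uv Kt t0 E']]].
exists (u * v), (z * t); split; [exact: uniM|by sf|by rewrite mulf_neq0|].
by rewrite exprMn -E -E'; ring.
Qed.

Lemma usq_sqr z : K z -> z != 0 -> usq K (z ^+ 2).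
Proof.
move=> Kz z0; exists 1, z; split=> //; last by rewrite mulr1.
by split; rewrite ?invr1 ?oner_neq0 ?Aint1 //; sf.
Qed.

Lemma usq_neq0 x : usq K x -> x != 0.
Proof.
move=> [u [z [_ _ z0 E]]]; apply: contraNneq z0 => x0.
by rewrite -sqrf_eq0 -E x0 mul0r.
Qed.

Lemma usqV x : usq K x -> usq K x^-1.
Proof.
move=> [u [z [Uu Kz z0 E]]].
exists u^-1, z^-1; split; [exact: uniV|by sf|by rewrite invr_eq0|].
by rewrite exprVn -E invfM.
Qed.

Lemma usq_divl x y : usq K (x * y) -> usq K x -> usq K y.
Proof.
move=> Hxy Hx; have x0 := usq_neq0 Hx.
by have -> : y = x^-1 * (x * y) by [rewrite mulKf]; apply: usqM => //; apply: usqV.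
Qed.

Lemma usq_uni u : uni K u -> usq K u.
Proof.
move=> Uu; exists u^-1, 1; split; [exact: uniV|by sf|exact: oner_neq0|].
by case: Uu => _ _ _ u0; rewrite mulfV // expr1n.
Qed.

(** Since [(1 + ka)^2 = 2 ka], a factor [i] or [-i] can be traded for a factor 2 modulo squares. *)
Lemma sqr_i_double (y c ka : algC) : K 'i -> K y -> ka ^+ 2 = -1 -> y ^+ 2 = c * ka ->
  exists2 z, K z & z ^+ 2 = 2 * c.
Proof.
move=> Ki Ky k2 E.
have Kk : K ka.
  by have : ka ^+ 2 == 'i ^+ 2 by [rewrite k2 sqrCi]; rewrite eqf_sqr => /orP[]/eqP ->; sf.
exists ('i * y * (1 + ka)); first by sf.
rewrite !exprMn sqrCi E sqrrD k2.
by transitivity (- 2 * c * ka ^+ 2); [ring|rewrite k2; ring].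
Qed.

Lemma unit4_sqr_cases (y c ka : algC) : K 'i -> K y -> ka ^+ 4 = 1 -> y ^+ 2 = c * ka ->
  exists2 z, K z & z ^+ 2 = c \/ z ^+ 2 = 2 * c.
Proof.
move=> Ki Ky /unit4_cases[|k2 E].
  move/eqP; rewrite sqrf_eq1 => /orP[]/eqP -> E.
    by exists y => //; left; rewrite E mulr1.
  by exists ('i * y); [sf|left; rewrite exprMn sqrCi E; ring].
by have [z Kz Ez] := sqr_i_double Ki Ky k2 E; exists z => //; right.
Qed.

End Usq.

(** * The fundamental unit and the units of Q(i, sqrt n) modulo squares *)

Section FundamentalUnitSquares.
Variables (n : nat) (s : {rmorphism algC -> algC}) (a b : int).
Local Notation w := (sqrtC n%:R : algC).
Local Notation E := (quad Qi w).
Local Notation eps := (a%:~R + b%:~R * w).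
Hypotheses (si : s 'i = 'i) (sw : s w = - w).
Hypotheses (n4 : (n %% 4)%N = 3%N) (fu : fundamental_unit (Qsqrt n) eps).

Let Ef : subfield E. Proof. exact: E_subfield. Qed.
Let Ei : E 'i. Proof. exact: E_i. Qed.
Let Ew : E w. Proof. exact: E_w. Qed.
Hint Resolve Ef Ei : core.

Lemma eps_uniE : uni E eps.
Proof. by have [Q1 Q2 Q3 Q4] := eps_uni fu; split=> //; apply: Qsqrt_E. Qed.

Let a10 : (a + 1)%:~R != 0 :> algC.
Proof. by rewrite intr_eq0; have := eps_a_gt1 sw n4 fu; lia. Qed.

(** Modulo squares [eps] is [2 (a + 1)], so the hypothesis makes [c] equal to [eps] or to [2 eps];
    the factor 2 is absorbed by [2 = -i (1 + i)^2]. *)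
Lemma eps_usq (c : nat) z : (0 < c)%N -> E z ->
  z ^+ 2 = c%:R * (a + 1)%:~R \/ z ^+ 2 = 2 * c%:R * (a + 1)%:~R -> usq E c%:R.
Proof.
move=> c0 Ez Hz.
have h2 := eps_double sw n4 fu; have h0 := eps_half_neq0 sw n4 fu.
have [Ee _ _ e0] := eps_uniE.
have n2 : (2 : algC) != 0 by rewrite pnatr_eq0.
have z0 : z != 0.
  by rewrite -sqrf_eq0; case: Hz => ->; rewrite !mulf_neq0 // pnatr_eq0 -lt0n.
set hh := (a + 1)%:~R + _ in h2 h0.
have Eh : E hh by rewrite /hh; sf.
have Ue := eps_uniE.
case: Hz => Hz.
  have i10 : 1 + 'i != 0 :> algC.
    apply/eqP => H; have := @Ci_coord 1 1 (rpred1 _) (rpred1 _); rewrite mul1r => /(_ H)[/eqP].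
    by rewrite oner_eq0.
  exists (- 'i * eps), (z * hh / ((a + 1)%:~R * (1 + 'i))); split.
  - apply: uniM => //; apply: uni_unit4 => //.
    by rewrite (exprM _ 2 2) sqrrN sqrCi sqrrN expr1n.
  - by sf.
  - by rewrite !mulf_neq0 ?invr_eq0 ?mulf_neq0.
  rewrite expr_div_n exprMn Hz -h2 exprMn.
  have -> : (1 + 'i) ^+ 2 = 2 * 'i :> algC by rewrite sqrrD sqrCi; ring.
  move: a10; move: ((a + 1)%:~R : algC) => y y0; apply/eqP.
  rewrite eq_sym -subr_eq0; apply/eqP; move: eps {e0 Ee Ue} => ee.
  have i0 := neq0Ci algC.
  transitivity (c%:R * ee * ('i ^+ 2 + 1) / 'i :> algC); first by field; rewrite i0 y0.
  by rewrite sqrCi addNr mulr0 mul0r.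
exists eps, (z * hh / (2 * (a + 1)%:~R)); split => //.
- by sf.
- by rewrite !mulf_neq0 ?invr_eq0 ?mulf_neq0.
rewrite expr_div_n exprMn Hz -h2.
move: a10; move: ((a + 1)%:~R : algC) => y y0; move: eps {e0 Ee Ue} => ee.
by field.
Qed.

(** In [v^2 = eps^l] up to sign, [l] is even: otherwise [eps] or [-eps], and hence [eps] since
    [-1 = i^2], would be a square in [E], and so would [2 (a + 1)]. Then [v / eps^(l/2)] is a fourth
    root of unity. *)
Lemma eps_unit_form v : (forall z, E z -> z ^+ 2 <> 3) -> uni E v ->
  (v * s v) ^+ 2 = 1 -> exists ka (l : int), ka ^+ 4 = 1 /\ v = ka * eps ^ l.
Proof.
move=> E3 Uv N2; have [l Hl] := eps_unit_sqr si sw fu E3 Uv N2.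
have [Ev _ _ v0] := Uv; have [Ee _ _ e0] := eps_uniE.
have h2 := eps_double sw n4 fu; have h0 := eps_half_neq0 sw n4 fu.
have sq (z : algC) : E z -> z ^+ 2 = eps -> False.
  move=> Ez Hz; apply: (@eps_not_double _ s a b sw n4 fu (((a + 1)%:~R + b%:~R * w) / z)).
    by sf.
  by rewrite expr_div_n -h2 Hz mulfK.
have [r Hr] := int_mod2 l; exists (v / eps ^ r), r.
have er0 : eps ^ r != 0 by rewrite expfz_neq0.
split; last by rewrite divfK.
have e2r : eps ^ (2 * r) = (eps ^ r) ^+ 2 by rewrite [2 * r]mulrC -exprz_exp.
case: Hr => Er; rewrite Er in Hl.
  rewrite (exprM _ 2 2) expr_div_n -e2r.
  have e2r0 : eps ^ (2 * r) != 0 by rewrite expfz_neq0.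
  by case: Hl => ->; rewrite ?mulNr divff // ?sqrrN expr1n.
exfalso; move: Hl; rewrite expfzDr // expr1z e2r => -[Hl|Hl].
  apply: (sq (v / eps ^ r)); first by sf.
  by rewrite expr_div_n Hl mulrAC divff ?mul1r // expf_neq0.
apply: (sq ('i * v / eps ^ r)); first by sf.
rewrite expr_div_n exprMn sqrCi Hl mulrN mulN1r opprK.
by rewrite mulrAC divff ?mul1r // expf_neq0.
Qed.

Lemma eps_sim (c : nat) z : (0 < c)%N -> E z -> z ^+ 2 = c%:R * (a + 1)%:~R ->
  exists2 y, E y & y != 0 /\ eps = 2 * c%:R * y ^+ 2.
Proof.
move=> c0 Ez Hz.
have h2 := eps_double sw n4 fu; have h0 := eps_half_neq0 sw n4 fu.
have n2 : (2 : algC) != 0 by rewrite pnatr_eq0.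
have cn0 : c%:R != 0 :> algC by rewrite pnatr_eq0 -lt0n.
have z0 : z != 0 by rewrite -sqrf_eq0 Hz !mulf_neq0.
exists (((a + 1)%:~R + b%:~R * w) / (2 * z)); first by sf.
split; first by rewrite mulf_neq0 ?invr_eq0 ?mulf_neq0.
rewrite expr_div_n -h2 exprMn Hz; move: a10; move: ((a + 1)%:~R : algC) => y y0.
by move: eps => ee; field; rewrite cn0 y0.
Qed.

End FundamentalUnitSquares.

(** A certificate that [X] is not a square: a prime [l] occurring exactly once in a given
    factorisation. *)
Lemma nsq_primes (l : nat) (s : seq nat) X : prime l -> all prime s -> l \notin s ->
  X = (l * foldr muln 1 s)%N -> ~ nsq X.
Proof.
move=> pl ps ls ->; apply: nsq_prime_mul => //.
elim: s ps ls => [|a s IH] /=; first by rewrite Euclid_dvd1.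
move=> /andP[pa ps]; rewrite inE negb_or => /andP[la ls].
by rewrite Euclid_dvdM // negb_or dvdn_prime2 // la IH.
Qed.

Lemma mod4_odd n : (n %% 4)%N = 3%N -> exists j, n = (2 * j + 1)%N.
Proof. by move=> n4; exists (n %/ 4 * 2 + 1)%N; rewrite {1}(divn_eq n 4) n4; lia. Qed.

(** If [l] divides [(a + b i)^2], it divides [2 a b] and [a^2 - b^2], hence both coordinates. The
    prime 2 is a unit times [(1 + i)^2] and has to be excluded. *)
Lemma sqf_prime l : prime l -> l != 2%N -> sqf l%:R.
Proof.
move=> pl l2; split; [by oi|by rewrite pnatr_eq0 -lt0n prime_gt0|].
move=> x /ZiP[a [b ->]] [t /ZiP[c [e ->]] E].
have [] := @Ci_int_inj (a ^+ 2 - b ^+ 2) (2 * a * b) (l%:Z * c) (l%:Z * e).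
  rewrite !(intrM, intrB, rmorphXn) /= -[l%:~R]/(l%:R : algC).
  transitivity ((a%:~R + b%:~R * 'i) ^+ 2 - (1 + 'i ^+ 2) * b%:~R ^+ 2 : algC); first ring.
  by rewrite E sqrCi subrr mul0r subr0; ring.
move=> E1 E2.
have dv (z : int) : (l%:Z %| z)%Z = (l %| `|z|)%N by rewrite dvdzE.
have la2 : (l %| `|a|)%N \/ (l %| `|b|)%N.
  have : (l%:Z %| (2 * a * b)%R)%Z by rewrite E2 dvdz_mulr.
  rewrite dv !abszM !Euclid_dvdM // dvdn_prime2 // (negbTE l2) /=.
  by case/orP; [left|right].
have sqd (z : int) : (l %| `|z|)%N = (l%:Z %| z ^+ 2)%Z.
  by rewrite dv expr2 abszM Euclid_dvdM // orbb.
have dd : (l%:Z %| (a ^+ 2 - b ^+ 2)%R)%Z by rewrite E1 dvdz_mulr.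
have [la lb] : (l%:Z %| a)%Z /\ (l%:Z %| b)%Z.
  rewrite !dv; case: la2 => H; split=> //; move: H; rewrite !sqd => H.
    by have -> : b ^+ 2 = a ^+ 2 - (a ^+ 2 - b ^+ 2) by [ring]; apply: rpredB.
  by have -> : a ^+ 2 = b ^+ 2 + (a ^+ 2 - b ^+ 2) by [ring]; apply: rpredD.
move: la lb => /dvdzP[a' ->] /dvdzP[b' ->].
exists (a'%:~R + b'%:~R * 'i); first by oi.
by rewrite !rmorphM /= -[l%:~R]/(l%:R : algC); ring.
Qed.

Lemma sqf_mul m n : coprime m n -> sqf m%:R -> sqf n%:R -> sqf (m * n)%:R.
Proof.
move=> cop [Zm m0 Hm] [Zn n0 Hn]; rewrite natrM; split; [by oi|by rewrite mulf_neq0|].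
move=> x Zx [t Zt Et].
have [s Zs Es] : dvdi m%:R x by apply: Hm => //; exists (n%:R * t); [oi|rewrite Et; ring].
have nx : dvdi n%:R x by apply: Hn => //; exists (m%:R * t); [oi|rewrite Et; ring].
have [u [v Euv]] := Bezoutz m%:Z n%:Z.
have E1 : v%:~R * n%:R + u%:~R * m%:R = 1 :> algC.
  rewrite -[m%:R]/(m%:Z%:~R) -[n%:R]/(n%:Z%:~R) -!rmorphM -rmorphD /= addrC Euv.
  by rewrite /gcdz /= (eqP cop).
have [r Zr Er] : dvdi n%:R s.
  apply: (@Zi_gauss n%:R s m%:R v%:~R u%:~R) => //; try by oi.
  by rewrite mulrC -Es.
by exists r => //; rewrite Es Er mulrA.
Qed.

Lemma sqfN t : sqf t -> sqf (- t).
Proof.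
move=> [Zt t0 Ht]; split; [by oi|by rewrite oppr_eq0|].
move=> x Zx [s Zs Es]; have [|r Zr Er] := Ht x Zx.
  by exists (- s); [oi|rewrite Es; ring].
by exists (- r); [oi|rewrite Er; ring].
Qed.

(** * The biquadratic extension of Q(i) *)

Section Fields.
Variables (p1 p q : nat) (sp sm : {rmorphism algC -> algC}).
Hypotheses (pp1 : prime p1) (pp : prime p) (pq : prime q).
Hypotheses (ne1 : p1 != p) (ne2 : p1 != q) (ne3 : p != q).
Hypotheses (m1 : (p1 %% 4)%N = 1%N) (mp : (p %% 4)%N = 1%N) (mq : (q %% 4)%N = 3%N).

Local Notation m := (p1 * q)%N.
Local Notation d := (p1 * p * q)%N.
Local Notation P := (sqrtC p%:R : algC).
Local Notation M := (sqrtC m%:R : algC).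
Local Notation D := (sqrtC d%:R : algC).
Local Notation F1 := (quad Qi P).
Local Notation F2 := (quad Qi M).
Local Notation k := (quad Qi D).
Local Notation L := (quad k P).

Hypotheses (spi : sp 'i = 'i) (spP : sp P = - P) (spM : sp M = M).
Hypotheses (smi : sm 'i = 'i) (smP : sm P = P) (smM : sm M = - M).

Ltac nsqt l s := apply: (@nsq_primes l s);
  [by [] | by rewrite /= ?pp1 ?pp ?pq | first [by [] | by rewrite ?inE; lia] | rewrite /=; ring].

Lemma DPM : D = P * M.
Proof.
by rewrite -sqrtCM ?qualifE /= ?ler0n // -natrM; congr (sqrtC _%:R); ring.
Qed.

Let P2 : P ^+ 2 = p%:R. Proof. exact: sqrtCK. Qed.
Let M2 : M ^+ 2 = m%:R. Proof. exact: sqrtCK. Qed.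
Let D2 : D ^+ 2 = d%:R. Proof. exact: sqrtCK. Qed.

Lemma p_neq0 : p%:R != 0 :> algC. Proof. by rewrite pnatr_eq0 -lt0n prime_gt0. Qed.
Lemma p1_neq0 : p1%:R != 0 :> algC. Proof. by rewrite pnatr_eq0 -lt0n prime_gt0. Qed.
Lemma P_neq0 : P != 0. Proof. by rewrite -sqrf_eq0 P2 p_neq0. Qed.

Lemma F1_subfield : subfield F1. Proof. exact: E_subfield. Qed.
Lemma F2_subfield : subfield F2. Proof. exact: E_subfield. Qed.
Lemma k_subfield : subfield k. Proof. exact: E_subfield. Qed.
Hint Resolve F1_subfield F2_subfield k_subfield : core.
Let kP2 : k (P ^+ 2). Proof. by rewrite P2; sf. Qed.
Let F1M2 : F1 (M ^+ 2). Proof. by rewrite M2; sf. Qed.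
Let F2P2 : F2 (P ^+ 2). Proof. by rewrite P2; sf. Qed.
Lemma L_subfield : subfield L. Proof. exact: quad_subfield. Qed.
Hint Resolve L_subfield : core.

Lemma k_L x : k x -> L x. Proof. exact: quad_base. Qed.
Lemma Qi_L x : Qi x -> L x. Proof. by move=> Qx; apply/k_L/E_Qi. Qed.
Lemma L_i : L 'i. Proof. exact: Qi_L. Qed.
Lemma L_P : L P. Proof. exact: quad_gen. Qed.
Lemma L_D : L D. Proof. by apply: k_L; apply: E_w. Qed.
Hint Resolve L_i L_P L_D : core.
Lemma L_M : L M.
Proof. by have -> : M = D / P by [rewrite DPM mulrAC divff ?mul1r ?P_neq0]; sf. Qed.
Hint Resolve L_M : core.
Lemma F1_L x : F1 x -> L x.
Proof. by move=> [a [b [/Qi_L La /Qi_L Lb ->]]]; sf. Qed.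
Lemma F2_L x : F2 x -> L x.
Proof. by move=> [a [b [/Qi_L La /Qi_L Lb ->]]]; sf. Qed.

Lemma L_quadF1 z : L z -> quad F1 M z.
Proof.
move=> [x [y [[a [b [Qa Qb ->]]] [c [e [Qc Qe ->]]] ->]]].
exists (a + c * P), (e * p%:R + b * P); split.
- exact: quadI.
- by apply: quadI => //; sf.
- by have := P2; rewrite DPM; move: P M => u v <-; ring.
Qed.

Lemma L_quadF2 z : L z -> quad F2 P z.
Proof.
move=> [x [y [[a [b [Qa Qb ->]]] [c [e [Qc Qe ->]]] ->]]].
exists (a + e * p%:R * M), (c + b * M); split.
- by apply: quadI => //; sf.
- exact: quadI.
- by have := P2; rewrite DPM; move: P M => u v <-; ring.
Qed.

Lemma spD : sp D = - D. Proof. by rewrite DPM rmorphM /= spP spM mulNr. Qed.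
Lemma smD : sm D = - D. Proof. by rewrite DPM rmorphM /= smP smM mulrN. Qed.

(** It changes the sign of both [P] and [M], so it fixes [D = P M] and is the conjugation of [L]
    over [k]. *)
Definition sg : {rmorphism algC -> algC} := (sp \o sm : algC -> algC).
Lemma sgE z : sg z = sp (sm z). Proof. by []. Qed.

Lemma sp_F2 x : F2 x -> sp x = x.
Proof.
move=> [a [b [Qa Qb ->]]].
by rewrite rmorphD rmorphM /= spM (aut_Qi spi Qa) (aut_Qi spi Qb).
Qed.
Lemma sm_F1 x : F1 x -> sm x = x.
Proof.
move=> [a [b [Qa Qb ->]]].
by rewrite rmorphD rmorphM /= smP (aut_Qi smi Qa) (aut_Qi smi Qb).
Qed.
Lemma sg_k x : k x -> sg x = x.
Proof.
move=> [a [b [Qa Qb ->]]].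
have E1 : sm (a + b * D) = a + b * - D.
  by rewrite rmorphD rmorphM /= smD (aut_Qi smi Qa) (aut_Qi smi Qb).
rewrite sgE E1 rmorphD rmorphM rmorphN /= spD opprK.
by rewrite (aut_Qi spi Qa) (aut_Qi spi Qb).
Qed.

Lemma L_F1 z : L z -> [/\ quad F1 M (sm z), F1 (z + sm z), F1 (z * sm z),
    sm (sm z) = z & sm z = z -> F1 z].
Proof. by move/L_quadF1; apply: quad_conj_sum => //; exact: sm_F1. Qed.

Lemma L_F2 z : L z -> [/\ quad F2 P (sp z), F2 (z + sp z), F2 (z * sp z),
    sp (sp z) = z & sp z = z -> F2 z].
Proof. by move/L_quadF2; apply: quad_conj_sum => //; exact: sp_F2. Qed.

Lemma L_k z : L z -> [/\ L (sg z), k (z + sg z), k (z * sg z),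
    sg (sg z) = z & sg z = z -> k z].
Proof.
by apply: quad_conj_sum => //; [exact: sg_k|rewrite sgE smP spP].
Qed.

Lemma L_sm z : L z -> L (sm z).
Proof.
by move=> /L_F1[[a [b [/F1_L La /F1_L Lb ->]]] _ _ _ _]; sf.
Qed.

Lemma L_conj z : L z -> L z^*.
Proof.
move=> [x [y [kx ky ->]]].
have -> : (x + y * P)^* = x^* + y^* * P by rewrite rmorphD rmorphM /= conj_w.
by exists x^*, y^*; split=> //; apply: E_conj.
Qed.

Lemma L_conj_sp z : L z -> sp z^* = (sp z)^*.
Proof.
move=> /L_quadF2[x [y [Fx Fy ->]]]; rewrite !(rmorphD, rmorphM) /= conj_w spP.
have Fx' := E_conj Fx; have Fy' := E_conj Fy.
by rewrite (sp_F2 Fx) (sp_F2 Fy) (sp_F2 Fx') (sp_F2 Fy') rmorphN /= conj_w.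
Qed.

Lemma L_conj_sm z : L z -> sm z^* = (sm z)^*.
Proof.
move=> /L_quadF1[x [y [Fx Fy ->]]].
have cE u : (x + y * u)^* = x^* + y^* * u^* by rewrite rmorphD rmorphM.
have smE u v w : sm (u + v * w) = sm u + sm v * sm w by rewrite rmorphD rmorphM.
have Fx' := E_conj Fx; have Fy' := E_conj Fy.
rewrite cE !smE (sm_F1 Fx) (sm_F1 Fy) (sm_F1 Fx') (sm_F1 Fy') conj_w smM.
by rewrite cE rmorphN /= conj_w.
Qed.

Lemma L_sqr_nat z (c : nat) : L z -> z ^+ 2 = c%:R ->
  [\/ nsq c, nsq (c * d), nsq (c * p) | nsq (c * p * d)].
Proof.
move=> Lz Ec; have kc : k c%:R by sf.
have [u ku [|]] := quad_kummer k_subfield kP2 kc Lz Ec.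
  by move/(E_sqr_nat ku) => []; [constructor 1|constructor 2].
by rewrite P2 -natrM => /(E_sqr_nat ku)[]; [constructor 3|constructor 4].
Qed.

Lemma L_sqr_Qi z r : L z -> Qi r -> z ^+ 2 = r ->
  exists c (j : nat), [/\ Qi c, (0 < j)%N & c ^+ 2 = r * j%:R].
Proof.
move=> Lz Qr Ec; have kr := @E_Qi d _ Qr.
have p0 := prime_gt0 pp; have d0 : (0 < d)%N by rewrite !muln_gt0 !prime_gt0.
have [u ku [Eu|]] := quad_kummer k_subfield kP2 kr Lz Ec.
  have [v Qv [Ev|]] := quad_kummer Qi_subfield (Ew2 d) Qr ku Eu.
    by exists v, 1%N; rewrite mulr1.
  by rewrite D2 => Ev; exists v, d.
have Qrp : Qi (r * p%:R) by sf.
rewrite P2 => Eu; have [v Qv [Ev|]] := quad_kummer Qi_subfield (Ew2 d) Qrp ku Eu.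
  by exists v, p.
by rewrite D2 => Ev; exists v, (p * d)%N; rewrite muln_gt0 p0 natrM mulrA.
Qed.

(** * Non-squares and units in L *)

Lemma L_not2 z : L z -> z ^+ 2 <> 2.
Proof.
move=> Lz /(@L_sqr_nat _ 2 Lz)[].
- by nsqt 2%N ([::] : seq nat).
- by nsqt 2%N [:: p1; p; q].
- by nsqt 2%N [:: p].
- by nsqt 2%N [:: p; p1; p; q].
Qed.

Lemma L_noti z ka : L z -> ka ^+ 2 = -1 -> z ^+ 2 <> ka.
Proof.
move=> Lz k2 E.
have [|y Ly] := @sqr_i_double L L_subfield z 1 ka L_i Lz k2; first by rewrite mul1r.
by rewrite mulr1; apply: L_not2.
Qed.

Lemma L_notp1 z ka : L z -> ka ^+ 4 = 1 -> z ^+ 2 <> p1%:R * ka.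
Proof.
move=> Lz k4 E.
have [y Ly [Ey|Ey]] := unit4_sqr_cases L_subfield L_i Lz k4 E.
  move: (L_sqr_nat Ly Ey) => [].
  - by nsqt p1 ([::] : seq nat).
  - by nsqt q [:: p1; p1; p].
  - by nsqt p1 [:: p].
  - by nsqt q [:: p1; p1; p; p].
rewrite -natrM in Ey; move: (L_sqr_nat Ly Ey) => [].
- by nsqt 2%N [:: p1].
- by nsqt 2%N [:: p1; p1; p; q].
- by nsqt 2%N [:: p1; p].
- by nsqt 2%N [:: p1; p; p1; p; q].
Qed.

Lemma F1_not3 z : F1 z -> z ^+ 2 <> 3.
Proof.
move=> Fz H; have [] := @E_sqr_nat p z 3 Fz H.
- by nsqt 3%N ([::] : seq nat).
- by nsqt p [:: 3]%N.
Qed.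
Lemma F2_not3 z : F2 z -> z ^+ 2 <> 3.
Proof.
move=> Fz H; have [] := @E_sqr_nat m z 3 Fz H.
- by nsqt 3%N ([::] : seq nat).
(* The certificate is [p1] and not 3, because [q] may be 3. *)
- by nsqt p1 [:: 3; q]%N.
Qed.
Lemma k_not3 z : k z -> z ^+ 2 <> 3.
Proof.
move=> Fz H; have [] := @E_sqr_nat d z 3 Fz H.
- by nsqt 3%N ([::] : seq nat).
- by nsqt p1 [:: 3; p; q]%N.
Qed.

Lemma F1_norm v : uni F1 v -> (v * sp v) ^+ 2 = 1.
Proof. by apply: no_unit_norm_i => //; exact: F1_not3. Qed.

(** Neither [i] nor [-i] is a square in [L], so [L] has no primitive eighth root of unity. *)
Lemma L_root16 z : L z -> z ^+ 16 = 1 -> z ^+ 4 = 1.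
Proof.
move=> Lz E.
have /unit4_cases[/eqP|H] : (z ^+ 4) ^+ 4 = 1 by rewrite -exprM.
  rewrite sqrf_eq1 => /orP[/eqP //|/eqP E4].
  case: (@L_noti z (z ^+ 2) Lz) => //.
  by rewrite -exprM E4.
case: (@L_noti (z ^+ 2) (z ^+ 4)) => //; first by sf.
by rewrite -exprM.
Qed.

(** The unit [w = v^* / v] has absolute value 1, so [w^2] is up to sign its norm to [Q(i)], a fourth
    root of unity. *)
Lemma conj_ratio8 n (s : {rmorphism algC -> algC}) : s 'i = 'i ->
  s (sqrtC n%:R) = - sqrtC n%:R ->
  (forall z, quad Qi (sqrtC n%:R) z -> z ^+ 2 <> 3) ->
  forall v, uni (quad Qi (sqrtC n%:R)) v -> (v^* / v) ^+ 8 = 1.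
Proof.
move=> si sw E3 v Uv; have Uv' := Uv; case: Uv' => Ev Av Av' v0.
have Ef := E_subfield n.
have Uc : uni (quad Qi (sqrtC n%:R)) v^* by apply: uni_aut => //; apply: E_conj.
have Uw : uni (quad Qi (sqrtC n%:R)) (v^* / v) by apply: uniM => //; apply: uniV.
have ww : (v^* / v) * (v^* / v)^* = 1.
  by rewrite rmorphM fmorphV /= conjCK; field; rewrite v0 conjC_eq0 v0.
have N4 := E_norm_unit4 si sw Uw.
have : ((v^* / v) ^+ 2) ^+ 4 = 1.
  by case: (E_unit_sqr si sw E3 Uw) => ->; rewrite ww mulr1 ?(exprM _ 2 2) ?sqrrN -?exprM.
by rewrite -exprM.
Qed.

(** For the ratio [w], each of [w * sm w], [w * sp w], [w * sg w] is the corresponding ratio of a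
    norm of [eta], with trivial eighth power. From [w^2 * sp (w * sm w) = (w * sp w) (w * sg w)]
    follows [w^16 = 1], and [L] has only fourth roots of unity of such order. *)
Lemma L_conj_ratio eta : uni L eta -> (eta^* / eta) ^+ 4 = 1.
Proof.
move=> [Le Ae Ae' e0].
have Lc := L_conj Le.
have U1 : uni F1 (eta * sm eta).
  have [_ _ F _ _] := L_F1 Le; split=> //; rewrite ?rpredM ?Aint_aut //.
    by rewrite invfM -fmorphV rpredM ?Aint_aut.
  by rewrite mulf_neq0 ?fmorph_eq0.
have U2 : uni F2 (eta * sp eta).
  have [_ _ F _ _] := L_F2 Le; split=> //; rewrite ?rpredM ?Aint_aut //.
    by rewrite invfM -fmorphV rpredM ?Aint_aut.
  by rewrite mulf_neq0 ?fmorph_eq0.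
have U3 : uni k (eta * sg eta).
  have [_ _ F _ _] := L_k Le; split=> //; rewrite ?rpredM ?Aint_aut //.
    by rewrite invfM -fmorphV rpredM ?Aint_aut.
  by rewrite mulf_neq0 ?fmorph_eq0.
have R1 := conj_ratio8 spi spP F1_not3 U1.
have R2 := conj_ratio8 smi smM F2_not3 U2.
have R3 := conj_ratio8 smi smD k_not3 U3.
have c1 : (sm eta)^* = sm eta^* by rewrite L_conj_sm.
have c2 : (sp eta)^* = sp eta^* by rewrite L_conj_sp.
have c3 : (sg eta)^* = sg eta^* by rewrite !sgE -L_conj_sp ?L_conj_sm //; apply: L_sm.
rewrite rmorphM /= c1 in R1; rewrite rmorphM /= c2 in R2; rewrite rmorphM /= c3 in R3.
set w := eta^* / eta.
have E1 : eta^* * sm eta^* / (eta * sm eta) = w * sm w.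
  by rewrite /w rmorphM fmorphV /= -mulf_div.
have E2 : eta^* * sp eta^* / (eta * sp eta) = w * sp w.
  by rewrite /w rmorphM fmorphV /= -mulf_div.
have E3 : eta^* * sg eta^* / (eta * sg eta) = w * sg w.
  by rewrite /w rmorphM fmorphV /= -mulf_div.
rewrite E1 in R1; rewrite E2 in R2; rewrite E3 in R3.
apply: L_root16; first by rewrite /w; sf.
have := congr1 sp R1; rewrite rmorphXn rmorphM rmorph1 /= -sgE => R1'.
transitivity ((w ^+ 2) ^+ 8 * (sp w * sg w) ^+ 8); first by rewrite R1' mulr1 -exprM.
rewrite -exprMn; transitivity (((w * sp w) * (w * sg w)) ^+ 8); first by congr (_ ^+ 8); ring.
by rewrite exprMn R2 R3 mulr1.
Qed.

Let n4m : (m %% 4)%N = 3%N.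
Proof. by rewrite -modnMm m1 mq. Qed.
Let n4d : (d %% 4)%N = 3%N.
Proof. by rewrite -modnMm -[(p1 * p %% 4)%N]modnMm m1 mp mq. Qed.

Lemma p_sqf : sqf p%:R.
Proof. by apply: sqf_prime => //; apply/eqP => E; move: mp; rewrite E. Qed.
Lemma m_sqf : sqf m%:R.
Proof.
apply: sqf_mul; [|apply: sqf_prime|apply: sqf_prime] => //.
- by rewrite prime_coprime // dvdn_prime2.
- by apply/eqP => E; move: m1; rewrite E.
- by apply/eqP => E; move: mq; rewrite E.
Qed.
Lemma d_sqf : sqf d%:R.
Proof.
have -> : d = (p * m)%N by ring.
apply: sqf_mul; [|exact: p_sqf|exact: m_sqf].
by rewrite prime_coprime // Euclid_dvdM // !dvdn_prime2 // negb_or ne3 eq_sym ne1.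
Qed.

Lemma F1_sqf_unit z t u : F1 z -> sqf t -> uni F1 u -> z ^+ 2 = t * u -> dvdi t p%:R.
Proof.
move=> Fz St Uu Ez.
have [c Ec] : exists c : nat, p = (4 * c + 1)%N.
  by exists (p %/ 4)%N; rewrite {1}(divn_eq p 4) mp mulnC.
have Ep : (4 * c%:Z + 1)%:~R = p%:R :> algC.
  by rewrite -[p%:R]/(p%:Z%:~R); congr _%:~R; rewrite {1}Ec; lia.
rewrite -Ep; apply: (@E_sqf_unit p sp spi spP P) Ez => //.
- exact: E_w.
- by rewrite Ep.
- by rewrite Ep; exact: p_sqf.
Qed.

Lemma F2_sqf_unit z t u : F2 z -> sqf t -> uni F2 u -> z ^+ 2 = t * u -> dvdi t m%:R.
Proof.
move=> Fz St Uu Ez.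
have [c Ec] : exists c : nat, m = (4 * c + 3)%N.
  by exists (m %/ 4)%N; rewrite {1}(divn_eq m 4) n4m mulnC.
have Em : (4 * (- c%:Z - 1) + 1)%:~R = - m%:R :> algC.
  by rewrite -[m%:R]/(m%:Z%:~R) -rmorphN; congr _%:~R; rewrite {1}Ec; lia.
have F2i : F2 'i by exact: E_i.
have F2M : F2 M by exact: E_w.
suff [t' Zt' Et'] : dvdi t (4 * (- c%:Z - 1) + 1)%:~R.
  by exists (- t'); [oi|rewrite mulrN -Et' Em opprK].
apply: (@E_sqf_unit m sm smi smM ('i * M)) Ez => //.
- by sf.
- by rewrite rmorphM smi smM mulrN.
- by rewrite Em exprMn sqrCi M2 mulN1r.
- by rewrite Em; apply: sqfN; exact: m_sqf.
Qed.

Lemma uni_norm (K : set algC) (s : {rmorphism algC -> algC}) eta :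
  uni L eta -> K (eta * s eta) -> uni K (eta * s eta).
Proof.
move=> [Le Ae Ae' e0] Kn; split=> //; rewrite ?rpredM ?Aint_aut //.
  by rewrite invfM -fmorphV rpredM ?Aint_aut.
by rewrite mulf_neq0 ?fmorph_eq0.
Qed.

(** When [u] has norm 1, [sp (1 + u) = (1 + u) / u], so the norm of [1 + u] times [u] is
    [(1 + u)^2]; [t] is the squarefree part of that norm. *)
Lemma hilbert90_F1 u : uni F1 u -> u * sp u = 1 -> u != -1 ->
  exists t z, [/\ sqf t, F1 z, z != 0 & t * u = z ^+ 2].
Proof.
move=> Uu N1 nu; have [Fu Au Au' u0] := Uu.
have [_ _ Qn _ _] := E_aut spi spP (sfD F1_subfield (sf1 F1_subfield) Fu).
have g0 : 1 + u != 0 by rewrite addrC addr_eq0.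
have [|t [c [St Qc c0 Et]]] := sqf_rep Qn; first by rewrite mulf_neq0 ?fmorph_eq0.
have Fc := @E_Qi p _ Qc.
exists t, ((1 + u) / c); split=> //; [by sf|by rewrite mulf_neq0 ?invr_eq0|].
have t0 : t != 0 by case: St.
rewrite expr_div_n; apply: (mulIf (expf_neq0 2 c0)); rewrite divfK ?expf_neq0 //.
rewrite -mulrA [u * _]mulrC mulrA -Et rmorphD rmorph1 /=.
transitivity ((1 + u) * (u + u * sp u)); first ring.
by rewrite N1; ring.
Qed.

(** Once [u] has norm 1 it is, modulo squares of [F1], a squarefree Gaussian integer [t] dividing
    [p]. Then [p1 t ka] is a square in [L], and the norm of [t] turns out to be a perfect square
    dividing [p^2]: so [t] is a unit or a unit times [p = P^2], and [p1] times a root of unity would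
    be a square in [L]. *)
Lemma p1_not_F1_unit y u ka : uni F1 u -> ka ^+ 4 = 1 -> L y -> y ^+ 2 <> p1%:R * u * ka.
Proof.
wlog N1 : u ka / u * sp u = 1.
  move=> W Uu k4 Ly E; have := F1_norm Uu.
  move/eqP; rewrite sqrf_eq1 => /orP[/eqP N1|/eqP N1]; first exact: (W u ka).
  (* The norm of [i] from [F1] is [i^2 = -1], so replacing [u] by [i u] corrects the sign; [ka]
     absorbs [-i]. *)
  have i4 : 'i ^+ 4 = 1 :> algC by rewrite (exprM _ 2 2) sqrCi sqrrN expr1n.
  apply: (W ('i * u) (- 'i * ka)) => //.
  - rewrite rmorphM /= spi; transitivity ('i ^+ 2 * (u * sp u)); first ring.
    by rewrite N1 sqrCi mulrNN mulr1.
  - by apply: uniM => //; apply: uni_unit4 => //; apply: E_i.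
  - by rewrite exprMn k4 mulr1 (exprM _ 2 2) sqrrN sqrCi sqrrN expr1n.
  - rewrite E; transitivity (- 'i ^+ 2 * (p1%:R * u * ka)); last ring.
    by rewrite sqrCi opprK mul1r.
move=> Uu k4 Ly E.
have [um|um] := eqVneq u (-1).
  apply: (@L_notp1 y (- ka)) => //.
    by rewrite (exprM _ 2 2) sqrrN -exprM.
  by rewrite E um; ring.
have [t [z [St Fz z0 Etz]]] := hilbert90_F1 Uu N1 um.
have [Zt t0 _] := St; have [Qt At] := Zt.
have Lz := F1_L Fz; have Lt := Qi_L Qt.
have Qka : Qi ka by case: (unit4_Zi k4).
have u0 : u != 0 by case: Uu.
have [e Ze Ee] := F1_sqf_unit Fz St Uu (esym Etz).
have Ey : (y * t / z) ^+ 2 = p1%:R * t * ka.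
  by rewrite expr_div_n exprMn -Etz E; field; rewrite u0.
have Ly' : L (y * t / z) by sf.
have Qr : Qi (p1%:R * t * ka) by sf.
have [c [j [Qc j0 Ec]]] := L_sqr_Qi Ly' Qr Ey.
have jn0 : j%:R != 0 :> algC by rewrite pnatr_eq0 -lt0n.
have nrm_nat (n : nat) : nrm n%:R = n%:R ^+ 2 by rewrite /nrm rmorph_nat.
have nka : nrm ka = 1.
  apply: Zi_unit_nrm; [exact: unit4_Zi|by apply: unit4_Zi; rewrite exprVn k4 invr1|].
  by apply/eqP => k0; move/eqP: k4; rewrite k0 expr0n eq_sym oner_eq0.
have [N EN] := Zi_nrm_nat Zt; have [T ET] := Zi_nrm_nat Ze.
(* Taking norms to [Q] in [c^2 = p1 t ka j] gives [(nrm c)^2 = p1^2 N j^2]. *)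
have sqN : nsq N.
  apply: (@Crat_sqr_nat (nrm c / (p1%:R * j%:R))).
    by apply: rpred_div; [exact: Qi_nrm_rat|rewrite rpredM ?rpred_nat].
  rewrite expr_div_n -EN; have -> : nrm c ^+ 2 = nrm (c ^+ 2) by rewrite /nrm rmorphXn exprMn.
  rewrite Ec !nrmM nka !nrm_nat; field.
  by rewrite jn0 p1_neq0.
have NT : (N * T = p ^ 2)%N.
  by apply/eqP; rewrite -(eqr_nat algC) natrM -EN -ET -nrmM -Ee nrm_nat natrX.
have /dvdn_pfactor : (N %| p ^ 2)%N by rewrite -NT dvdn_mulr.
move=> /(_ pp)[i i2 Ei].
case: i i2 Ei => [|[|[|//]]] _ Ei.
- have t4 : t ^+ 4 = 1 by apply: Zi_nrm1; rewrite // EN Ei.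
  apply: (@L_notp1 (y * t / z) (t * ka)) => //; first by rewrite exprMn t4 k4 mulr1.
  by rewrite Ey mulrA.
- move: sqN; rewrite Ei expn1; nsqt p ([::] : seq nat).
- have T1 : T = 1%N.
    move: NT; rewrite Ei => /eqP; rewrite -[X in _ == X]muln1.
    by rewrite eqn_pmul2l ?expn_gt0 ?prime_gt0 // => /eqP.
  have e4 : e ^+ 4 = 1 by apply: Zi_nrm1; rewrite // ET T1.
  have en0 : e != 0 by apply/eqP => e0; move/eqP: e4; rewrite e0 expr0n eq_sym oner_eq0.
  have Pn0 := P_neq0.
  apply: (@L_notp1 (y * t / z / P) (e^-1 * ka)); first by sf.
    by rewrite exprMn exprVn e4 k4 invr1 mulr1.
  rewrite expr_div_n Ey P2 Ee; field.
  by rewrite en0 t0.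
Qed.

(** Suppose [p1 eta = al^2]. The three relative norms of [al], divided by [p1], are units whose
    squares are the norms of [eta], and they express [eta] as a product of units of [F1], [F2] and
    [k]. The last two are roots of unity times powers of the fundamental units, so squares in [L] up
    to roots of unity; what remains is [p1] times a unit of [F1] and a root of unity, which is no
    square. *)
Lemma usq_p1_false (a b x y : int) :
  fundamental_unit (Qsqrt m) (a%:~R + b%:~R * M) ->
  fundamental_unit (Qsqrt d) (x%:~R + y%:~R * D) ->
  (exists ka z, [/\ ka ^+ 4 = 1, L z, z != 0 & a%:~R + b%:~R * M = ka * z ^+ 2]) ->
  (exists ka z, [/\ ka ^+ 4 = 1, L z, z != 0 & x%:~R + y%:~R * D = ka * z ^+ 2]) ->
  ~ usq L p1%:R.
Proof.
move=> fum fud [k1 [z1 [k14 Lz1 z10 Em]]] [k2 [z2 [k24 Lz2 z20 Ed]]].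
move=> [eta [al [Ueta Lal al0 E]]]; have [Le Ae Ae' e0] := Ueta.
have p10 := p1_neq0.
have [_ _ N1 _ _] := L_F1 Lal; have [_ _ N2 ss2 _] := L_F2 Lal; have [_ _ N3 ss3 _] := L_k Lal.
have [_ _ N1' _ _] := L_F1 Le; have [_ _ N2' _ _] := L_F2 Le; have [_ _ N3' _ _] := L_k Le.
have nuE (s : {rmorphism algC -> algC}) : (al * s al / p1%:R) ^+ 2 = eta * s eta.
  rewrite expr_div_n exprMn -rmorphXn -E rmorphM rmorph_nat /=; field.
  by [].
have U1 : uni F1 (al * sm al / p1%:R).
  by apply: uni_sqrt (nuE sm) _; [sf|apply: uni_norm].
have U2 : uni F2 (al * sp al / p1%:R).
  by apply: uni_sqrt (nuE sp) _; [sf|apply: uni_norm].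
have U3 : uni k (al * sg al / p1%:R).
  by apply: uni_sqrt (nuE sg) _; [sf|apply: uni_norm].
move: U1 U2 U3 (nuE sm) (nuE sp) (nuE sg).
set nu1 := al * sm al / p1%:R; set u2 := al * sp al / p1%:R; set u3 := al * sg al / p1%:R.
clearbody nu1 u2 u3; move=> U1 U2 U3 E1 E2 E3.
have spU1 : uni F1 (sp nu1).
  by apply: uni_aut => //; have [F _ _ _] := U1; have [] := E_aut spi spP F.
pose u1 := (sp nu1)^-1; have Uu1 : uni F1 u1 by apply: uniV.
have [_ _ _ sn0] := spU1.
(* The identity [eta^2 * sp (eta * sm eta) = (eta * sp eta) (eta * sg eta)] reads
   [(eta * sp nu1)^2 = (u2 u3)^2]. *)
have [ep [ep2 Eal]] : exists ep, ep ^+ 2 = 1 /\ al ^+ 2 = ep * p1%:R * u1 * u2 * u3.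
  have : (eta * sp nu1) ^+ 2 == (u2 * u3) ^+ 2.
    rewrite !exprMn E2 E3 -rmorphXn E1 rmorphM sgE; apply/eqP; ring.
  rewrite eqf_sqr => /orP[]/eqP H; [exists 1|exists (-1)]; rewrite ?sqrrN expr1n; split=> //.
    by rewrite -E -[eta](mulfK sn0) H /u1; ring.
  by rewrite -E -[eta](mulfK sn0) H /u1; ring.
have [Fu1 _ _ u10] := Uu1; have [Fu2 _ _ u20] := U2; have [ku3 _ _ u30] := U3.
have ep0 : ep != 0 by rewrite -sqrf_eq0 ep2 oner_neq0.
have [F1s _ _ _ _] := E_aut spi spP Fu1; have [F2s _ _ _ _] := E_aut smi smM Fu2.
have n1 := F1_norm Uu1.
have sep (s : {rmorphism algC -> algC}) : s ep = ep.
  by move/eqP: ep2; rewrite sqrf_eq1 => /orP[]/eqP ->; rewrite ?rmorphN rmorph1.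
have sgu1 : sg u1 = sp u1 by rewrite sgE (sm_F1 Fu1).
have sgu2 : sg u2 = sm u2 by rewrite sgE (sp_F2 F2s).
(* Otherwise the norm of [u2] is [i] or [-i], and [al * sg al / (p1 u3)] is a square root in [L] of
   that norm times the sign [u1 * sp u1]. The norm of [u3] is treated alike with [sp]. *)
have n2 : (u2 * sm u2) ^+ 2 = 1.
  have /unit4_cases[//|n2] := E_norm_unit4 smi smM U2.
  have LX : L (al * sg al / (p1%:R * u3)) by have := k_L N3; have := k_L ku3; move=> *; sf.
  case: (@L_noti _ (u1 * sp u1 * (u2 * sm u2)) LX); first by rewrite exprMn n1 n2 mul1r.
  rewrite expr_div_n exprMn -rmorphXn Eal !rmorphM rmorph_nat sep sgu1 sgu2 (sg_k ku3).
  transitivity (ep ^+ 2 * (u1 * sp u1 * (u2 * sm u2))); last by rewrite ep2 mul1r.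
  by field; rewrite p10 u30.
have n3 : (u3 * sp u3) ^+ 2 = 1.
  have /unit4_cases[//|n3] := E_norm_unit4 spi spD U3.
  have LX : L (al * sp al / (p1%:R * u2)) by have := F2_L N2; have := F2_L Fu2; move=> *; sf.
  case: (@L_noti _ (u1 * sp u1 * (u3 * sp u3)) LX); first by rewrite exprMn n1 n3 mul1r.
  rewrite expr_div_n exprMn -rmorphXn Eal !rmorphM rmorph_nat /= sep (sp_F2 Fu2).
  transitivity (ep ^+ 2 * (u1 * sp u1 * (u3 * sp u3))); last by rewrite ep2 mul1r.
  by field; rewrite p10 u20.
have [ka2 [l2 [ka24 Eu2]]] := eps_unit_form smi smM n4m fum F2_not3 U2 n2.
have [ka3 [l3 [ka34 Eu3]]] := eps_unit_form spi spD n4d fud k_not3 U3 n3.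
rewrite Em in Eu2; rewrite Ed in Eu3.
have z1l : z1 ^ l2 != 0 by rewrite expfz_neq0.
have z2l : z2 ^ l3 != 0 by rewrite expfz_neq0.
have sqz (ka z : algC) (l : int) : (ka * z ^+ 2) ^ l = ka ^ l * (z ^ l) ^+ 2.
  by rewrite expfzMl -[z ^+ 2]/(z ^ 2%:Z) exprzAC.
rewrite sqz in Eu2; rewrite sqz in Eu3.
have k4 (ka : algC) (l : int) : ka ^+ 4 = 1 -> (ka ^ l) ^+ 4 = 1.
  by move=> H; rewrite -[LHS]/((ka ^ l) ^ 4%:Z) exprzAC -[ka ^ _]/(ka ^+ 4) H exp1rz.
apply: (@p1_not_F1_unit (al / (z1 ^ l2 * z2 ^ l3)) u1 (ep * ka2 * k1 ^ l2 * ka3 * k2 ^ l3)) => //.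
- rewrite !exprMn ka24 ka34 !k4 // !mulr1 -[4%N]/(2 * 2)%N exprM ep2 expr1n.
  by [].
- by sf.
rewrite expr_div_n Eal Eu2 Eu3; move: (k1 ^ l2) (k2 ^ l3) => c1 c2.
by field; rewrite z1l z2l.
Qed.

(** * The ideals (t, sqrt d) of k *)

Let Oki : int_ring k 'i. Proof. by split; [exact: E_i|exact: Aint_i]. Qed.
Let OkD : int_ring k D.
Proof. by split; [exact: E_w|apply: Aint_sqr; rewrite D2; ai]. Qed.
Hint Resolve Oki OkD : core.

Lemma Zi_k t : Zi t -> int_ring k t.
Proof. by move=> [Qt At]; split=> //; apply: E_Qi. Qed.

Let d_neq0 : d%:R != 0 :> algC.
Proof. by rewrite pnatr_eq0 -lt0n !muln_gt0 !prime_gt0. Qed.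
Let D_neq0 : D != 0. Proof. by rewrite -sqrf_eq0 D2. Qed.

Let kR : exists c : int, (4 * c + 1)%:~R = - d%:R :> algC.
Proof.
exists (- (d %/ 4)%N%:Z - 1).
rewrite -[d%:R]/(d%:Z%:~R) -rmorphN; congr _%:~R.
by rewrite {2}(divn_eq d 4) n4d PoszD PoszM; lia.
Qed.

Lemma k_int_diff z : int_ring k z -> exists2 v, Zi v & z - sm z = v * ('i * D).
Proof.
move=> Oz; have [c Ec] := kR.
apply: (@E_int_diff d sm smi smD ('i * D) c) => //.
- by case: (int_ringM k_subfield Oki OkD).
- by rewrite rmorphM smi smD mulrN.
- by rewrite Ec exprMn sqrCi D2 mulN1r.
- by rewrite Ec; apply: sqfN; exact: d_sqf.
Qed.

Lemma k_sqf_dvd z t r : int_ring k z -> sqf t -> r \in Aint -> z ^+ 2 = t * r ->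
  exists2 r', r' \in Aint & d%:R * z = t * r'.
Proof.
move=> Oz St Ar Ez; have [c Ec] := kR.
have [||||r' Ar' Er'] := @E_sqf_dvd d sm smi smD ('i * D) c _ _ _ _ _ _ _ Oz St Ar Ez.
- by case: (int_ringM k_subfield Oki OkD).
- by rewrite rmorphM smi smD mulrN.
- by rewrite Ec exprMn sqrCi D2 mulN1r.
- by rewrite Ec; apply: sqfN; exact: d_sqf.
by exists (- r'); [ai|rewrite mulrN -Er' Ec mulNr opprK].
Qed.

Definition Hd (t : algC) : set algC :=
  [set z | exists r s, [/\ int_ring k r, int_ring k s & z = t * r + D * s]].

Lemma Hd_ideal t : Zi t -> is_ideal k (Hd t).
Proof.
move=> /Zi_k Ot; split.
- by move=> _ [r [s [Or Os ->]]]; oi.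
- by exists 0, 0; split; oi; ring.
- move=> _ _ [r [s [Or Os ->]]] [r' [s' [Or' Os' ->]]].
  by exists (r + r'), (s + s'); split; oi; ring.
- move=> u _ Ou [r [s [Or Os ->]]].
  by exists (u * r), (u * s); split; oi; ring.
Qed.

Lemma Hd_gen t : Hd t t. Proof. by exists 1, 0; split; oi; ring. Qed.
Lemma Hd_D t : Hd t D. Proof. by exists 0, 1; split; oi; ring. Qed.

Lemma Hd_nz t : Zi t -> nz_ideal k (Hd t).
Proof.
move=> Zt; apply/nz_idealP; split; first exact: Hd_ideal.
by exists D => //; exact: Hd_D.
Qed.

Lemma Hd_min t I : is_ideal k I -> I t -> I D -> Hd t `<=` I.
Proof.
move=> Ii It ID _ [r [s [Or Os ->]]].
by apply: (idealD Ii); apply: (idealMr Ii).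
Qed.

Lemma Hd_unit t ka : ka ^+ 4 = 1 -> Zi t -> Hd (ka * t) = Hd t.
Proof.
move=> k4 Zt; have k0 : ka != 0.
  by apply/eqP => k0; move/eqP: k4; rewrite k0 expr0n eq_sym oner_eq0.
have Zk := unit4_Zi k4; have Okk := Zi_k Zk.
have ZkV : Zi ka^-1 by apply: unit4_Zi; rewrite exprVn k4 invr1.
apply/seteqP; split; apply: Hd_min; try exact: Hd_D; try (apply: Hd_ideal; oi).
  by apply: (idealMl (Hd_ideal Zt)) => //; exact: Hd_gen.
rewrite -{2}(mulKf k0 t); have Zkt : Zi (ka * t) by oi.
by apply: (idealMl (Hd_ideal Zkt)); [exact: Zi_k|exact: Hd_gen].
Qed.

(** As [d] is squarefree, [t] and [t'] are coprime, so [D] is a combination of [t D] and [D t']. *)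
Lemma Hd_mul t t' : Zi t -> Zi t' -> dvdi (t * t') d%:R ->
  ideal_mul k (Hd t) (Hd t') = Hd (t * t').
Proof.
move=> Zt Zt' dv; have Ztt : Zi (t * t') by oi.
have Ot := Zi_k Zt; have Ot' := Zi_k Zt'.
have Hi := ideal_mul_ideal k_subfield (Hd_ideal Zt) (Hd_ideal Zt').
apply/seteqP; split.
  apply: ideal_mul_sub; first exact: Hd_ideal.
  move=> _ _ [r [s [Or Os ->]]] [r' [s' [Or' Os' ->]]].
  by exists (r * r'), (t * r * s' + s * t' * r' + D * s * s'); split; oi; ring.
have [u [v [Zu Zv Euv]]] := sqf_coprime Zt Zt' (sqf_dvd Ztt d_sqf dv).
apply: Hd_min => //; first by apply: ideal_mulI; exact: Hd_gen.
have ED : u * (t * D) + v * (D * t') = D by rewrite -[RHS]mul1r -Euv; ring.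
suff : ideal_mul k (Hd t) (Hd t') (u * (t * D) + v * (D * t')) by rewrite ED.
apply: (idealD Hi); apply: (idealMl Hi); try exact: Zi_k; apply: ideal_mulI;
  by [exact: Hd_gen|exact: Hd_D].
Qed.

(** With [d = t e] and [u t + v e = 1], the generator is [t = u t^2 + v D^2]. *)
Lemma Hd_sqr t : Zi t -> dvdi t d%:R -> ideal_mul k (Hd t) (Hd t) = principal k t.
Proof.
move=> Zt [e Ze Ee]; have Ot := Zi_k Zt; have Oe := Zi_k Ze.
have Hi := ideal_mul_ideal k_subfield (Hd_ideal Zt) (Hd_ideal Zt).
apply/seteqP; split.
  apply: ideal_mul_sub; first exact: principal_ideal.
  move=> _ _ [r [s [Or Os ->]]] [r' [s' [Or' Os' ->]]].
  exists (t * r * r' + D * (r * s' + s * r') + e * s * s'); first by oi.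
  transitivity (t ^+ 2 * r * r' + t * D * (r * s' + s * r') + t * e * s * s'); first ring.
  have DD : t * e = D * D by rewrite -Ee -expr2 D2.
  by rewrite DD; ring.
have [u [v [Zu Zv Euv]]] : exists u v, [/\ Zi u, Zi v & u * t + v * e = 1].
  by apply: sqf_coprime => //; rewrite -Ee; exact: d_sqf.
apply: principal_sub => //.
have Et : u * (t * t) + v * (D * D) = t.
  by rewrite -[D * D]expr2 D2 Ee -[RHS]mul1r -Euv; ring.
suff : ideal_mul k (Hd t) (Hd t) (u * (t * t) + v * (D * D)) by rewrite Et.
apply: (idealD Hi); apply: (idealMl Hi); try exact: Zi_k; apply: ideal_mulI;
  by [exact: Hd_gen|exact: Hd_D].
Qed.

(** The trace of [y] to [Q(i)] is divisible by [t], since its square is, and [y - sm y] is a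
    multiple of [D]; so [2 y] is in the ideal. So is [d y = D (D y)], and [d] is odd. *)
Lemma Hd_sqrt t y r : Zi t -> dvdi t d%:R -> int_ring k y -> r \in Aint ->
  y ^+ 2 = t * r -> Hd t y.
Proof.
move=> Zt dv Oy Ar Ey; have [ky Ay] := Oy.
have [[Qt At] t0 Ht] := sqf_dvd Zt d_sqf dv.
have [ksy Qtr Qn ss _] := E_aut smi smD ky.
have smt : sm t = t by exact: aut_Qi.
have Esy : sm y ^+ 2 = t * sm r by rewrite -rmorphXn Ey rmorphM /= smt.
have An : y * sm y / t \in Aint.
  apply: Aint_sqr.
  have -> : (y * sm y / t) ^+ 2 = r * sm r by rewrite expr_div_n exprMn Ey Esy; field.
  by rewrite rpredM ?Aint_aut.
have Asr : sm r \in Aint by rewrite Aint_aut.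
have Asy : sm y \in Aint by rewrite Aint_aut.
have Ztr : Zi (y + sm y) by split=> //; rewrite /=; ai.
have [s Zs Es] : dvdi t (y + sm y).
  apply: Ht => //; apply: (@dvdi_Aint _ _ (r + sm r + 2 * (y * sm y / t))) => //; [by sf|by ai|].
  transitivity (y ^+ 2 + sm y ^+ 2 + 2 * (y * sm y)); first ring.
  by rewrite Ey Esy; field.
have [v Zv Ev] := k_int_diff Oy.
have Hi := Hd_ideal Zt.
have H2y : Hd t (2 * y).
  exists s, ('i * v); split; [exact: Zi_k|by have := Zi_k Zv; move=> Ov; oi|].
  transitivity ((y + sm y) + (y - sm y)); first ring.
  by rewrite Es Ev; ring.
have Hdy : Hd t (d%:R * y).
  by rewrite -D2 expr2 -mulrA; apply: (idealMr Hi); [oi|exact: Hd_D].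
have [j Ej] := mod4_odd n4d.
have -> : y = d%:R * y + (- j%:R) * (2 * y) by rewrite Ej natrD natrM; ring.
by apply: (idealD Hi) => //; apply: (idealMl Hi) => //; oi.
Qed.

(** The root criterion puts [J] inside [Hd t]. For [h] in [Hd t], each [y h] with [y] in [J] lies in
    the square of [Hd t], which is [(t)]; hence [h] times [J^2 = (t)] lies in [t J], and [h] is in
    [J]. *)
Lemma Hd_unique J t : is_ideal k J -> Zi t -> dvdi t d%:R ->
  ideal_mul k J J = principal k t -> J = Hd t.
Proof.
move=> Ji Zt dv EJ.
have JH : J `<=` Hd t.
  move=> y Jy.
  have [r [_ Ar] Er] : principal k t (y * y) by rewrite -EJ; apply: ideal_mulI.
  by apply: (@Hd_sqrt t y r) => //; exact: (ideal_sub Ji Jy).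
apply/seteqP; split=> // h Hh.
have [_ t0 _] := sqf_dvd Zt d_sqf dv.
have Oh := ideal_sub (Hd_ideal Zt) Hh.
suff S : ideal_mul k J J `<=` [set z | int_ring k z /\ exists2 j, J j & z * h = t * j].
  have [] := S t; first by rewrite EJ; apply: principal_self.
  by move=> _ [j Jj /(mulfI t0) ->].
apply: ideal_mul_sub.
  split.
  - by move=> z [].
  - by split; [oi|exists 0; [exact: (ideal0 Ji)|ring]].
  - move=> x y [Ox [j Jj Ex]] [Oy [j' Jj' Ey]]; split; first by oi.
    by exists (j + j'); [exact: (idealD Ji)|rewrite mulrDl Ex Ey; ring].
  - move=> r x Or [Ox [j Jj Ex]]; split; first by oi.
    by exists (r * j); [exact: (idealMl Ji)|rewrite -mulrA Ex; ring].
move=> x y Jx Jy; split.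
  by have Ox := ideal_sub Ji Jx; have Oy := ideal_sub Ji Jy; oi.
have [r Or Er] : principal k t (y * h).
  by rewrite -(Hd_sqr Zt dv); apply: ideal_mulI => //; apply: JH.
by exists (x * r); [exact: (idealMr Ji)|rewrite -mulrA -Er; ring].
Qed.

(** [H] contains [D], since [D^2 = d] is a multiple of [pi]. For [x] in [H], [sm x] differs from [x]
    by a multiple of [D], so trace and norm of [x] lie in [H] and in [Z[i]], hence in [(pi)];
    therefore [pi] divides [x^2]. *)
Lemma prime_over_Hd pi H : Zi pi -> dvdi pi d%:R -> prime_lying_over k pi H -> H = Hd pi.
Proof.
move=> Zpi dv [[[Hi _] _ Hprime] Hpi].
have [e Ze Ee] := dv.
have Hpi' : H pi.
  have : principal Qi pi pi by apply: principal_self.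
  by rewrite -Hpi => -[].
have HD : H D.
  have : H (D * D) by rewrite -expr2 D2 Ee; apply: (idealMr Hi) => //; exact: Zi_k.
  by move/(Hprime _ _ OkD OkD) => [].
apply/seteqP; split; last exact: Hd_min.
move=> x Hx; have Ox := ideal_sub Hi Hx; have [kx Ax] := Ox.
have [ksx Qtr Qn ss _] := E_aut smi smD kx.
have Asx : sm x \in Aint by rewrite Aint_aut.
have Osx : int_ring k (sm x) by split.
have [v Zv Ev] := k_int_diff Ox.
have Hsx : H (sm x).
  have -> : sm x = x + (- v * 'i) * D.
    by rewrite -[LHS](subKr x) Ev; ring.
  by apply: (idealD Hi) => //; apply: (idealMl Hi) => //; have Ov := Zi_k Zv; oi.
have inZ z : Zi z -> H z -> dvdi pi z.
  move=> Zz Hz; have : (H `&` Zi) z by split.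
  by rewrite Hpi => -[r Zr <-]; exists r.
have [t Zt Et] : dvdi pi (x + sm x).
  by apply: inZ; [split=> //; rewrite /=; ai|exact: (idealD Hi)].
have [n Zn En] : dvdi pi (x * sm x).
  by apply: inZ; [split=> //; rewrite /=; ai|exact: (idealMr Hi)].
apply: (@Hd_sqrt pi x (x * t - n)) => //.
  by case: Zt => _ At; case: Zn => _ An; ai.
transitivity (x * (x + sm x) - x * sm x); first ring.
by rewrite Et En; ring.
Qed.

(** From [D^2 = t e] one has [e (t, D) = D (e, D)]. *)
Lemma Hd_compl_class t e : Zi t -> Zi e -> d%:R = t * e ->
  ideal_class k (Hd t) = ideal_class k (Hd e).
Proof.
move=> Zt Ze Ed.
have e0 : e != 0 by apply: contraNneq d_neq0 => e0; rewrite Ed e0 mulr0.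
have Oe := Zi_k Ze; have Ot := Zi_k Zt.
apply: ideal_class_eq => //; exists e, D; split=> //.
have dve : dvdi e d%:R by exists t; rewrite // mulrC.
have [u [v [Zu Zv Euv]]] : exists u v, [/\ Zi u, Zi v & u * t + v * e = 1].
  by apply: sqf_coprime => //; rewrite -Ed; exact: d_sqf.
have Ou := Zi_k Zu; have Ov := Zi_k Zv.
have DD : D * D = t * e by rewrite -expr2 D2.
apply/seteqP; split=> _ [_ [r [s [Or Os ->]]] <-].
  exists (e * s + D * r); first by exists s, r.
  transitivity (D * D * r + D * e * s); first ring.
  by rewrite DD; ring.
exists (t * s + D * r); first by exists s, r.
by transitivity (t * e * s + D * e * r); [ring|rewrite -DD; ring].
Qed.

Lemma Hd_class_one t : Zi t -> dvdi t d%:R -> usq k t ->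
  ideal_class k (Hd t) = class_one k.
Proof.
move=> Zt dv [u [z [[ku Au Au' u0] kz z0 E]]].
have [_ At] := Zt.
have Oz : int_ring k z by split=> //; apply: Aint_sqr; rewrite -E; ai.
have Ou : int_ring k u by split.
have -> : Hd t = principal k z; last exact: principal_equiv.
apply: ideal_sqrt_principal => //; first exact: Hd_ideal.
have kuV : k u^-1 by sf.
rewrite Hd_sqr // -E; apply/seteqP; split=> _ [r Or <-].
  exists (u^-1 * r); last by field.
  by apply: int_ringM => //; split.
by exists (u * r); [oi|ring].
Qed.

(** * Capitulating classes are classes of (t, sqrt d) *)

Let th := (1 + P) / 2.
(** A root of [X^2 - X - (p - 1)/4]; this is where [p = 1 mod 4] supplies the integer of trace 1. *)
Lemma th_int : int_ring L th.
Proof.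
split; first by rewrite /th; sf.
apply: (@Aint_quadratic _ (-1) (- (p %/ 4)%N%:Z)).
have Ep : P ^+ 2 = 4 * (p %/ 4)%N%:R + 1.
  rewrite P2 {1}(divn_eq p 4) mp natrD natrM; ring.
rewrite /th expr_div_n sqrrD Ep !rmorphN /= -[(_)%:~R in X in _ - X]/((p %/ 4)%N%:R : algC).
by field.
Qed.

Lemma th_trace : th + sg th = 1.
Proof.
have sth (s : {rmorphism algC -> algC}) : s th = (1 + s P) / 2.
  by rewrite /th fmorph_div rmorphD rmorph1 (rmorph_nat s 2).
have E : sg th = (1 - P) / 2 by rewrite sth sgE smP spP.
by rewrite E /th; field.
Qed.

Lemma kappa_subgroup : Cl_subgroup k (cap_kernel k L).
Proof. exact: (cap_kernel_subgroup k_subfield L_subfield k_L sg_k L_k th_int th_trace). Qed.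

Lemma Hd_capitulates t : Zi t -> dvdi t d%:R -> usq L t ->
  cap_kernel k L (ideal_class k (Hd t)).
Proof.
move=> Zt dv [u [z [Uu Lz z0 E]]].
apply/(cap_kernelP k_subfield L_subfield k_L (Hd_nz Zt)); exists z.
apply: (sqrt_capitulates k_subfield L_subfield k_L (Hd_ideal Zt) (Zi_k Zt) (Hd_sqr Zt dv) Uu) => //.
Qed.

Lemma sp_sm_k x : k x -> sp x = sm x.
Proof.
move=> [a [b [Qa Qb ->]]].
have E (s : {rmorphism algC -> algC}) : s 'i = 'i -> s D = - D -> s (a + b * D) = a - b * D.
  by move=> si sD; rewrite rmorphD (rmorphM s b) sD (aut_Qi si Qa) (aut_Qi si Qb) mulrN.
by rewrite (E sp spi spD) (E sm smi smD).
Qed.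

Lemma k_denom z : k z -> exists2 n : nat, (0 < n)%N & n%:R * z \in Aint.
Proof.
move=> [a [b [/Qi_denom[n n0 [_ An]] /Qi_denom[j j0 [_ Aj]] ->]]].
exists (n * j)%N; first by rewrite muln_gt0 n0.
have [_ AD] := OkD.
have -> : (n * j)%:R * (a + b * D) = j%:R * (n%:R * a) + n%:R * (j%:R * b) * D.
  by rewrite (natrM _ n j); ring.
by ai.
Qed.

Lemma pm_bezout : exists u v : int, u%:~R * p%:R + v%:~R * m%:R = 1 :> algC.
Proof.
have [u [v Euv]] := Bezoutz p%:Z m%:Z; exists u, v.
rewrite -[p%:R]/(p%:Z%:~R) -[m%:R]/(m%:Z%:~R) -!rmorphM -rmorphD /= Euv /gcdz /=.
suff /eqP -> : coprime p m by [].
by rewrite prime_coprime // Euclid_dvdM // !dvdn_prime2 // negb_or ne3 eq_sym ne1.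
Qed.

(* The squarefree part of this norm divides [p] (descent to [F1]) and [m] (descent
   to [F2]), so it is a unit; [i] and [-i] are excluded because [F1] has no unit of
   norm [+-i]. *)
Lemma norm_norm_sqr al : L al -> al != 0 -> uni L (al / sg al) ->
  exists2 c, Qi c & c != 0 /\ (al * sg al) * sm (al * sg al) = c ^+ 2.
Proof.
move=> Lal al0 Ue; set be := al * sg al; set eta := al / sg al in Ue.
have [_ _ kbe ssg _] := L_k Lal; rewrite -/be in kbe.
have [Le Ae Ae' e0] := Ue.
have sal0 : sg al != 0 by rewrite fmorph_eq0.
have be0 : be != 0 by rewrite mulf_neq0.
have Eal : al ^+ 2 = be * eta by rewrite /be /eta; field.
have se : sg eta = eta^-1 by rewrite /eta rmorphM fmorphV ssg invfM invrK mulrC.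
clearbody eta be.
have [_ _ Qb _ _] := E_aut smi smD kbe; set b := be * sm be in Qb.
have b0 : b != 0 by rewrite mulf_neq0 ?fmorph_eq0.
have [t [c [St Qc c0 Eb]]] := sqf_rep Qb b0.
have [Zt t0 _] := St; have [Qt At] := Zt.
have [_ _ Fn1 _ _] := L_F1 Le; have [_ _ Fn2 spsp _] := L_F2 Le.
have U1 := uni_norm Ue Fn1; have U2 := uni_norm Ue Fn2.
(* On [k] the maps [sp] and [sm] agree, so either one sends [al^2 = be eta] to a partner whose
   product with it is [b = t c^2] times a norm of [eta]. *)
have Ez (s : {rmorphism algC -> algC}) : s be = sm be ->
    (al * s al / c) ^+ 2 = t * (eta * s eta).
  move=> sb; rewrite expr_div_n exprMn -rmorphXn Eal rmorphM sb.
  transitivity (b * (eta * s eta) / c ^+ 2); first by rewrite /b; field.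
  by rewrite Eb; field.
have [_ _ Fa1 _ _] := L_F1 Lal; have [_ _ Fa2 _ _] := L_F2 Lal.
have Fc1 := @E_Qi p _ Qc; have Fc2 := @E_Qi m _ Qc.
have E1 := Ez sm erefl; have E2 := Ez sp (sp_sm_k kbe).
have F1z : F1 (al * sm al / c) by sf.
have F2z : F2 (al * sp al / c) by sf.
have [r Zr Er] := F1_sqf_unit F1z St U1 E1.
have [s Zs Es] := F2_sqf_unit F2z St U2 E2.
(* [t] divides both [p] and [m], which are coprime. *)
have t4 : t ^+ 4 = 1.
  have [u [v Euv]] := pm_bezout.
  have tV : t * (u%:~R * r + v%:~R * s) = 1 by rewrite -[RHS]Euv Er Es; ring.
  apply: Zi_unit4 => //.
  have -> : t^-1 = u%:~R * r + v%:~R * s by apply: (mulfI t0); rewrite tV mulfV.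
  by oi.
have t2 : t ^+ 2 = 1.
  (* If [t] were [i] or [-i], then [al * sm al / c] would be a unit of [F1] whose norm has square
     [t^2 = -1]; the contribution of [eta] cancels because [sg eta = eta^-1]. *)
  case/unit4_cases: t4 => // t2; exfalso.
  have Ut : uni F1 (t * (eta * sm eta)).
    by apply: uniM => //; apply: uni_unit4; [exact: F1_subfield|exact: E_i|rewrite (exprM _ 2 2) t2 sqrrN expr1n].
  have Us := uni_sqrt F1z E1 Ut.
  have sqX (X : algC) : (X * sp X) ^+ 2 = X ^+ 2 * sp (X ^+ 2) by rewrite rmorphXn exprMn.
  have := F1_norm Us; rewrite sqX E1 !rmorphM (aut_Qi spi Qt) -sgE.
  have sme : sm eta = (sp eta)^-1.
    have [_ _ _ <- _] := L_F2 (L_sm Le).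
    by rewrite -sgE se fmorphV.
  have spe0 : sp eta != 0 by rewrite fmorph_eq0.
  rewrite sme se.
  have -> : t * (eta * (sp eta)^-1) * (t * (sp eta * eta^-1)) = t ^+ 2.
    by field; rewrite e0 spe0.
  by move/eqP; rewrite t2 -subr_eq0 -opprD oppr_eq0 -[1 + 1]/(2%:R) pnatr_eq0.
move/eqP: t2; rewrite sqrf_eq1 => /orP[]/eqP t1.
  by exists c => //; rewrite -/b Eb t1 mul1r.
exists ('i * c); first by sf.
by rewrite mulf_neq0 ?neq0Ci // -/b Eb t1 exprMn sqrCi.
Qed.

(** The quotient [be / c] has norm 1, so with [g = 1 + be / c] one finds
    [be = (c / (g * sm g)) g^2]; when [g = 0], [be = -c] already lies in [Q(i)]. The squarefree part
    of the factor in [Q(i)] is [t]. *)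
Lemma hilbert90_k be c : k be -> be != 0 -> Qi c -> c != 0 -> be * sm be = c ^+ 2 ->
  exists t nu, [/\ sqf t, k nu, nu != 0 & be = t * nu ^+ 2].
Proof.
move=> kbe be0 Qc c0 Eb.
have [r [g [Qr r0 kg [g0 Er]]]] : exists r g, [/\ Qi r, r != 0, k g & g != 0 /\ be = r * g ^+ 2].
  have kc := @E_Qi d _ Qc.
  have [b1|b1] := eqVneq (be / c) (-1).
    exists (- c), 1; split; [by sf|by rewrite oppr_eq0|by sf|split; first exact: oner_neq0].
    by rewrite expr1n mulr1 -[be](divfK c0) b1 mulN1r.
  have g0 : 1 + be / c != 0 by rewrite addrC addr_eq0.
  have kg : k (1 + be / c) by sf.
  have [_ _ Qn _ _] := E_aut smi smD kg.
  have n0 : (1 + be / c) * sm (1 + be / c) != 0 by rewrite mulf_neq0 ?fmorph_eq0.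
  exists (c / ((1 + be / c) * sm (1 + be / c))), (1 + be / c).
  split; [by sf|by rewrite mulf_neq0 ?invr_eq0|by []|split=> //].
  apply: (mulIf n0); rewrite [RHS]mulrAC divfK //.
  rewrite !rmorphD fmorph_div rmorph1 (aut_Qi smi Qc).
  have -> : be * ((1 + be / c) * (1 + sm be / c)) = (1 + be / c) * (be + be * sm be / c) by ring.
  by rewrite Eb; field.
have [t [e [St Qe e0 Et]]] := sqf_rep Qr r0.
have ke := @E_Qi d _ Qe.
exists t, (e * g); split=> //; [by sf|by rewrite mulf_neq0|].
by rewrite Er Et; ring.
Qed.

(** With [be = t nu^2], the set [J = nu^-1 I] consists of integers, because their squares are
    multiples of [t], and its square is [(t)]. The unit times square in [L] is
    [t eta = (al / nu)^2]. *)
Lemma cap_kernel_Hd A : cap_kernel k L A ->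
  exists t, [/\ Zi t, dvdi t d%:R, A = ideal_class k (Hd t) & usq L t].
Proof.
move=> HA; case: (HA) => -[I In EA] _; rewrite -EA in HA *; have [Ii _] := In.
have [al Hal] := (cap_kernelP k_subfield L_subfield k_L In).1 HA.
have [EII Obe Ue] := capitulates_norm k_subfield L_subfield k_L sg_k L_k th_int th_trace Ii Hal.
case: Hal => -[Lal Aal] al0 _.
have [c Qc [c0 Ec]] := norm_norm_sqr Lal al0 Ue.
have sal0 : sg al != 0 by rewrite fmorph_eq0.
have be0 : al * sg al != 0 by rewrite mulf_neq0.
have Eal : al ^+ 2 = al * sg al * (al / sg al) by field.
move: (al * sg al) (al / sg al) be0 Ec EII Obe Ue Eal => be eta be0 Ec EII Obe Ue Eal.
have [kbe Abe] := Obe.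
have [t [nu [St knu nu0 Ebe]]] := hilbert90_k kbe be0 Qc c0 Ec.
have [Zt t0 Ht] := St; have [Qt At] := Zt; have Ot := Zi_k Zt; have [kt _] := Ot.
pose J : set algC := [set y | I (nu * y)].
have Jsq y y' : J y -> J y' -> k y /\ principal k t (y * y').
  move=> Jy Jy'; have [ky _] := ideal_sub Ii Jy; have [ky' _] := ideal_sub Ii Jy'.
  split; first by rewrite -(mulKf nu0 y); sf.
  have [r Or Er] : principal k be ((nu * y) * (nu * y')) by rewrite -EII; apply: ideal_mulI.
  exists r => //; apply: (mulfI (expf_neq0 2 nu0)).
  by transitivity (be * r); [rewrite Ebe; ring|rewrite Er; ring].
have JO y : J y -> int_ring k y.
  move=> Jy; have [ky [r [_ Ar] Er]] := Jsq y y Jy Jy; split=> //.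
  by apply: Aint_sqr; rewrite expr2 -Er; ai.
have Ji : is_ideal k J.
  split=> //.
  - by rewrite /J /= mulr0; exact: (ideal0 Ii).
  - by move=> x y Jx Jy; rewrite /J /= mulrDr; exact: (idealD Ii).
  - by move=> r x Or Jx; rewrite /J /= mulrCA; exact: (idealMl Ii).
have JJi := ideal_mul_ideal k_subfield Ji Ji.
have EJJ : ideal_mul k J J = principal k t.
  apply/seteqP; split.
    by apply: ideal_mul_sub; [exact: principal_ideal|move=> y y' Jy Jy'; have [] := Jsq y y' Jy Jy'].
  apply: principal_sub => //.
  suff S : ideal_mul k I I `<=` [set z | int_ring k z /\ exists2 v, ideal_mul k J J v & z = nu ^+ 2 * v].
    have [] := S be; first by rewrite EII; apply: principal_self.
    move=> _ [v JJv Ev]; suff -> : t = v by [].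
    by apply: (mulfI (expf_neq0 2 nu0)); rewrite -Ev Ebe mulrC.
  apply: ideal_mul_sub.
    split.
    - by move=> z [].
    - by split; [oi|exists 0; [exact: (ideal0 JJi)|ring]].
    - move=> x y [Ox [v Jv Ex]] [Oy [v' Jv' Ey]]; split; first by oi.
      by exists (v + v'); [exact: (idealD JJi)|rewrite Ex Ey; ring].
    - move=> r x Or [Ox [v Jv Ex]]; split; first by oi.
      by exists (r * v); [exact: (idealMl JJi)|rewrite Ex; ring].
  move=> x y Ix Iy; split.
    by have Ox := ideal_sub Ii Ix; have Oy := ideal_sub Ii Iy; oi.
  exists (x / nu * (y / nu)); last by field.
  by apply: ideal_mulI; rewrite /J /= mulrC divfK.
(* Every [y] in [J] has [d y] divisible by [t], so [d^2 J^2] is divisible by [t^2]. As [t] is in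
   [J^2], it divides [d^2], hence [d]. *)
have dv : dvdi t d%:R.
  apply: Ht; first by oi.
  suff S : ideal_mul k J J `<=`
      [set z | int_ring k z /\ exists2 r, r \in Aint & d%:R ^+ 2 * z = t ^+ 2 * r].
    have [] := S t; first by rewrite EJJ; apply: principal_self.
    move=> _ [r Ar Er]; apply: (@dvdi_Aint _ _ r) => //; first by sf.
    by apply: (mulIf t0); rewrite Er; ring.
  apply: ideal_mul_sub.
    split.
    - by move=> z [].
    - by split; [oi|exists 0; [ai|rewrite !mulr0]].
    - move=> x y [Ox [v Jv Ex]] [Oy [v' Jv' Ey]]; split; first by oi.
      by exists (v + v'); [ai|rewrite mulrDr Ex Ey mulrDr].
    - move=> r x Or [Ox [v Jv Ex]]; split; first by oi.
      by exists (r * v); [case: Or => _ Ar; ai|rewrite mulrCA Ex; ring].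
  have Jd y : J y -> exists2 r, r \in Aint & d%:R * y = t * r.
    move=> Jy; have [_ [r [_ Ar] Er]] := Jsq y y Jy Jy.
    by apply: (@k_sqf_dvd y t r) => //; exact: JO.
  move=> x y Jx Jy; split; first by have Ox := JO x Jx; have Oy := JO y Jy; oi.
  have [r Ar Er] := Jd x Jx; have [s As Es] := Jd y Jy.
  exists (r * s); first by ai.
  by transitivity ((d%:R * x) * (d%:R * y)); [ring|rewrite Er Es; ring].
exists t; split=> //; last first.
  exists eta, (al / nu); split=> //; [by have := k_L knu; move=> Lnu; sf|by rewrite mulf_neq0 ?invr_eq0|].
  by rewrite expr_div_n Eal Ebe; field.
rewrite -(Hd_unique Ji Zt dv EJJ); apply: ideal_class_eq => //.
have [n n0 An] := k_denom knu.
have nn0 : n%:R != 0 :> algC by rewrite pnatr_eq0 -lt0n.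
exists n%:R, (n%:R * nu); split; [by oi|by split=> //; sf|by []|by rewrite mulf_neq0|].
apply/seteqP; split=> _ [x Hx <-].
  exists (x / nu); last by field.
  by rewrite /J /= mulrC divfK.
by exists (nu * x); rewrite ?mulrA.
Qed.

(** * Divisors of d in Z[i] *)

Definition gprime (pi : algC) : Prop :=
  [/\ Zi pi, pi != 0 & forall x y, Zi x -> Zi y -> dvdi pi (x * y) -> dvdi pi x \/ dvdi pi y].

Lemma prime_over_gprime pi H : Zi pi -> pi != 0 -> prime_lying_over k pi H -> gprime pi.
Proof.
move=> Zpi pi0 [[[Hi _] _ Hprime] Hpi]; split=> // x y Zx Zy [t Zt Et].
have HZ z : (H `&` Zi) z -> dvdi pi z by rewrite Hpi => -[r Zr <-]; exists r.
have Hp : H pi.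
  have : principal Qi pi pi by apply: principal_self.
  by rewrite -Hpi => -[].
have : H (x * y) by rewrite Et; apply: (idealMr Hi) => //; exact: Zi_k.
by case/(Hprime _ _ (Zi_k Zx) (Zi_k Zy)) => Hz; [left|right]; apply: HZ.
Qed.

Lemma gprime_split pi n t : gprime pi -> Zi n -> Zi t -> dvdi t (pi * n) ->
  exists (e : bool) t', [/\ Zi t', dvdi t' n & t = pi ^+ e * t'].
Proof.
move=> [Zpi pi0 Hpi] Zn Zt [e Ze Ee].
have [|[t' Zt' Et]|[e' Ze' Ee']] := Hpi t e Zt Ze.
- by exists n.
- exists true, t'; split=> //; exists e => //.
  by apply: (mulfI pi0); rewrite Ee Et mulrA.
exists false, t; split=> //; last by rewrite mul1r.
by exists e' => //; apply: (mulfI pi0); rewrite Ee Ee' mulrCA.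
Qed.

(** [q] is inert: a proper divisor would have norm [q], but a prime that is 3 modulo 4 is not a sum
    of two squares. *)
Lemma dvdi_q t : Zi t -> dvdi t q%:R -> t ^+ 4 = 1 \/ exists2 ka, ka ^+ 4 = 1 & t = ka * q%:R.
Proof.
move=> Zt [e Ze Ee]; have [N EN] := Zi_nrm_nat Zt; have [T ET] := Zi_nrm_nat Ze.
have NT : (N * T = q ^ 2)%N.
  by apply/eqP; rewrite -(eqr_nat algC) natrM -EN -ET -nrmM -Ee natrX /nrm rmorph_nat.
have q0 := prime_gt0 pq.
have /dvdn_pfactor : (N %| q ^ 2)%N by rewrite -NT dvdn_mulr.
move=> /(_ pq)[i i2 Ei].
case: i i2 Ei => [|[|[|//]]] _ Ei.
- by left; apply: Zi_nrm1; rewrite // EN Ei.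
- exfalso; move: EN; rewrite Ei expn1; case/ZiP: Zt => a [b ->].
  rewrite /nrm rmorphD rmorphM /= !rmorph_int conjCi => E.
  have {}E : a ^+ 2 + b ^+ 2 = q%:Z.
    apply: (@intr_inj algC); rewrite rmorphD !rmorphXn /= -[q%:~R]/(q%:R : algC) -E.
    by transitivity (a%:~R ^+ 2 - b%:~R ^+ 2 * 'i ^+ 2 : algC); [rewrite sqrCi; ring|ring].
  move: E; have [j ->] : exists j, q = (4 * j + 3)%N.
    by exists (q %/ 4)%N; rewrite {1}(divn_eq q 4) mq mulnC.
  have [u Eu] := int_mod2 a; have [v Ev] := int_mod2 b; rewrite !expr2.
  by case: Eu => ->; case: Ev => -> H; lia.
- have T1 : T = 1%N.
    move: NT; rewrite Ei => /eqP; rewrite -[X in _ == X]muln1.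
    by rewrite eqn_pmul2l ?expn_gt0 ?q0 // => /eqP.
  have e4 : e ^+ 4 = 1 by apply: Zi_nrm1; rewrite // ET T1.
  have en0 : e != 0 by apply/eqP => e0; move/eqP: e4; rewrite e0 expr0n eq_sym oner_eq0.
  right; exists e^-1; first by rewrite exprVn e4 invr1.
  by rewrite Ee mulrC mulfK.
Qed.

(** If [t eta = al^2], then [al al^* / (eta P^j)] has square [p1] times [eta^* / eta], and the
    latter is a fourth root of unity; [p1] times such a root is not a square in [L]. *)
Lemma usq_norm_p1 t j : L t -> usq L t -> nrm t <> p1%:R * p%:R ^+ j.
Proof.
move=> Lt [eta [al [Ue Lal al0 E]]] Nt.
have k4 := L_conj_ratio Ue; have [Le _ _ e0] := Ue.
have Lc := L_conj Lal; have Pj : P ^+ j != 0 by rewrite expf_neq0 // P_neq0.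
have p0 : p%:R ^+ j != 0 :> algC by rewrite expf_neq0 // p_neq0.
apply: (@L_notp1 (al * al^* / (eta * P ^+ j)) (eta^* / eta)) => //; first by sf.
have -> : (al * al^* / (eta * P ^+ j)) ^+ 2 = nrm (al ^+ 2) / (eta ^+ 2 * p%:R ^+ j).
  rewrite /nrm expr_div_n (exprMn _ eta) -(exprM P) mulnC (exprM P 2) P2 rmorphXn /=.
  by congr (_ / _); ring.
rewrite -E nrmM Nt /nrm; move: (p%:R ^+ j) p0 => y y0; field.
by rewrite e0 y0.
Qed.

(** The product of [Hd t] and [Hd t'] is some [(z)] and the square of [Hd t'] is [(t')], so
    [t' Hd t = z Hd t']. *)
Lemma Hd_class_swap t t' : Zi t -> Zi t' -> dvdi (t * t') d%:R -> usq k (t * t') ->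
  ideal_class k (Hd t) = ideal_class k (Hd t').
Proof.
move=> Zt Zt' dv [u [z [[ku Au Au' u0] kz z0 E]]].
have Ztt : Zi (t * t') by oi.
have dv' : dvdi t' d%:R by apply: dvdi_trans dv; exists t; rewrite // mulrC.
have [_ Att] := Ztt; have Ot' := Zi_k Zt'.
have [_ t0 _] := sqf_dvd Zt' d_sqf dv'.
have Oz : int_ring k z by split=> //; apply: Aint_sqr; rewrite -E; ai.
have Ou : int_ring k u by split.
have OuV : int_ring k u^-1 by split=> //; sf.
have Ez : ideal_mul k (Hd t) (Hd t') = principal k z.
  rewrite Hd_mul //; apply: ideal_sqrt_principal => //; first exact: Hd_ideal.
  rewrite Hd_sqr // -E; apply/seteqP; split=> _ [r Or <-].
    by exists (u^-1 * r); [oi|field].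
  by exists (u * r); [oi|ring].
have E2 := Hd_sqr Zt' dv'.
have Hi := Hd_ideal Zt; have Hi' := Hd_ideal Zt'.
apply: ideal_class_eq => //; exists t', z; split=> //.
have idS (I : set algC) (c x : algC) : is_ideal k I ->
    is_ideal k [set w | int_ring k w /\ exists2 y, I y & c * y = w * x].
  move=> Ii; split.
  - by move=> w [].
  - by split; [oi|exists 0; [exact: (ideal0 Ii)|ring]].
  - move=> w v [Ow [y Iy Ey]] [Ov [y' Iy' Ey']]; split; first by oi.
    by exists (y + y'); [exact: (idealD Ii)|rewrite mulrDr Ey Ey'; ring].
  - move=> r w Or [Ow [y Iy Ey]]; split; first by oi.
    by exists (r * y); [exact: (idealMl Ii)|rewrite mulrCA Ey mulrA].
apply/seteqP; split=> _ [x Hx <-].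
  suff S : ideal_mul k (Hd t') (Hd t') `<=`
      [set w | int_ring k w /\ exists2 y, Hd t' y & z * y = w * x].
    by have [_ [y Hy Ey]] := S t' (eq_ind_r (fun X => X t') (principal_self k_subfield t') E2); exists y.
  apply: ideal_mul_sub; first exact: idS.
  move=> v v' Hv Hv'; split.
    by have Ov := ideal_sub Hi' Hv; have Ov' := ideal_sub Hi' Hv'; oi.
  have [r Or Er] : principal k z (x * v) by rewrite -Ez; apply: ideal_mulI.
  by exists (r * v'); [exact: (idealMl Hi')|rewrite mulrA Er; ring].
suff S : ideal_mul k (Hd t) (Hd t') `<=`
    [set w | int_ring k w /\ exists2 y, Hd t y & t' * y = w * x].
  by have [_ [y Hy Ey]] := S z (eq_ind_r (fun X => X z) (principal_self k_subfield z) Ez); exists y.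
apply: ideal_mul_sub; first exact: idS.
move=> v v' Hv Hv'; split.
  by have Ov := ideal_sub Hi Hv; have Ov' := ideal_sub Hi' Hv'; oi.
have [r Or Er] : principal k t' (v' * x) by rewrite -E2; apply: ideal_mulI.
by exists (r * v); [exact: (idealMl Hi)|rewrite mulrA Er; ring].
Qed.

(** * The primes above p become units times squares in L *)

Lemma usq_mono (K K' : set algC) x : (forall z, K z -> K' z) -> usq K x -> usq K' x.
Proof.
move=> KK [u [z [[Ku Au Au' u0] Kz z0 E]]]; exists u, z; split=> //; last exact: KK.
by split=> //; exact: KK.
Qed.

Lemma usq_L_p : usq L p%:R.
Proof. by have := usq_sqr L_subfield L_P P_neq0; rewrite P2. Qed.

Lemma two_i : 2 = - 'i * (1 + 'i) ^+ 2 :> algC.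
Proof.
have -> : (1 + 'i) ^+ 2 = 2 * 'i :> algC by rewrite sqrrD sqrCi; ring.
by transitivity (- 'i ^+ 2 * 2 : algC); [rewrite sqrCi; ring|ring].
Qed.

Lemma one_i_neq0 : 1 + 'i != 0 :> algC.
Proof.
apply/eqP => H; have := @Ci_coord 1 1 (rpred1 _) (rpred1 _); rewrite mul1r => /(_ H)[/eqP].
by rewrite oner_eq0.
Qed.

Lemma mi4 : (- 'i) ^+ 4 = 1 :> algC.
Proof. by rewrite (exprM _ 2 2) sqrrN sqrCi sqrrN expr1n. Qed.

(* For the unit [eps = s + t sqrt p] of norm [-1], [(eps + i)^2 = 2 (s + i) eps]. *)
Lemma usq_pell pi (s t : nat) : Zi pi -> pi * pi^* = p%:R -> (s ^ 2 + 1 = p * t ^ 2)%N ->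
  dvdi pi (s%:R + 'i) -> usq L pi.
Proof.
move=> Zpi Epi Est [x Zx Ex].
have Lpi := Qi_L (proj1 Zpi); have Zpc := Zi_conj Zpi; have Zxc := Zi_conj Zx.
have Estc : s%:R ^+ 2 + 1 = p%:R * t%:R ^+ 2 :> algC.
  by rewrite -!natrX -natrM -Est natrD.
have Exc : s%:R - 'i = pi^* * x^*.
  by rewrite -rmorphM /= -Ex rmorphD rmorph_nat /= conjCi.
have Exx : x * x^* = t%:R ^+ 2.
  apply: (mulfI p_neq0); rewrite -Estc -Epi.
  transitivity ((s%:R + 'i) * (s%:R - 'i) : algC); first by rewrite Ex Exc; ring.
  by transitivity (s%:R ^+ 2 - 'i ^+ 2 : algC); [ring|rewrite sqrCi; ring].
(* [t] is odd, since [s^2 + 1] is never divisible by 4. *)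
have [j Ej] : exists j, (t ^ 2 = 2 * j + 1)%N.
  have ot : odd t.
    apply/negPn/negP => et; move: Est; rewrite -(odd_double_half t) (negbTE et) add0n -!mulnn.
    by rewrite -(odd_double_half s); case: (odd s) => /=; rewrite -!muln2; nia.
  exists ((t ^ 2) %/ 2)%N; rewrite {1}(divn_eq (t ^ 2) 2) modn2 oddX ot orbT; lia.
have Etj : t%:R ^+ 2 = 2 * j%:R + 1 :> algC by rewrite -natrX Ej natrD natrM.
have x0 : x != 0.
  apply/eqP => x0; move/eqP: Exx; rewrite x0 mul0r eq_sym Etj -natrM -[1]/(1%:R) -natrD.
  by rewrite pnatr_eq0; lia.
(* Coprimality of [x] and its conjugate: [pi x - pi^* x^*] is [(s + i) - (s - i) = 2 i], and
   multiplying it by [i j] removes the even part of [x x^* = t^2 = 2 j + 1]. *)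
have Euv : (x^* + 'i * j%:R * pi) * x + (- 'i * j%:R * pi^*) * x^* = 1.
  transitivity (x * x^* + 'i * j%:R * (pi * x - pi^* * x^*)); first ring.
  rewrite -Ex -Exc Exx Etj.
  by transitivity (2 * j%:R + 1 + 2 * 'i ^+ 2 * j%:R : algC); [ring|rewrite sqrCi; ring].
have [|||e [g [e4 Zg Eg]]] := Zi_square_factor Zx Zxc _ _ _ x0 Exx Euv; try by oi.
have g0 : g != 0 by apply: contraNneq x0 => g0; rewrite Eg g0 expr0n mulr0.
pose eps := s%:R + t%:R * P.
have AP : P \in Aint by apply: Aint_sqr; rewrite P2; ai.
have Een : eps * (t%:R * P - s%:R) = 1.
  transitivity (t%:R ^+ 2 * P ^+ 2 - s%:R ^+ 2); first by rewrite /eps; ring.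
  by rewrite P2 mulrC -Estc; ring.
have e0 : eps != 0 by apply/eqP => e0; move/eqP: Een; rewrite e0 mul0r eq_sym oner_eq0.
have Ue : uni L eps.
  split=> //; [by rewrite /eps; sf|by rewrite /eps; ai|].
  have -> : eps^-1 = t%:R * P - s%:R by apply: (mulfI e0); rewrite Een mulfV.
  by ai.
have Eei : (eps + 'i) ^+ 2 = 2 * (s%:R + 'i) * eps.
  transitivity (s%:R ^+ 2 + P ^+ 2 * t%:R ^+ 2 + 2 * s%:R * t%:R * P + 2 * 'i * eps + 'i ^+ 2).
    by rewrite /eps; ring.
  by rewrite P2 -Estc sqrCi /eps; ring.
have si0 : s%:R + 'i != 0 :> algC.
  rewrite Ex mulf_neq0 //; apply/eqP => pi0.
  by move: p_neq0; rewrite -Epi pi0 mul0r eqxx.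
have ei0 : eps + 'i != 0 by rewrite -sqrf_eq0 Eei !mulf_neq0 ?pnatr_eq0.
have Lg := Qi_L (proj1 Zg); have i10 := one_i_neq0.
(* Substitute [s + i = pi e g^2] and [2 = -i (1 + i)^2] in [(eps + i)^2 = 2 (s + i) eps]. *)
exists (e * eps * - 'i), ((eps + 'i) / (g * (1 + 'i))); split.
- apply: uniM => //; last by apply: uni_unit4 => //; exact: mi4.
  by apply: uniM => //; apply: uni_unit4.
- by case: Ue => Leps _ _ _; sf.
- by rewrite mulf_neq0 ?invr_eq0 ?mulf_neq0.
rewrite expr_div_n Eei Ex Eg exprMn; have := two_i; move: (1 + 'i) i10 => y y0 ->.
by field; rewrite g0 y0.
Qed.

(** [pi] divides [s^2 + 1 = (s + i) (s - i)]. If it divides the second factor, its conjugate divides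
    the first, and the two have product [p = P^2]. *)
Lemma usq_pi pi : gprime pi -> pi * pi^* = p%:R -> usq L pi.
Proof.
move=> [Zpi pi0 Hpi] Epi; have [s [t Est]] := negative_pell pp mp.
have Zs : Zi (s%:R + 'i) by oi.
have Zsc : Zi (s%:R - 'i) by oi.
have [|H|[x Zx Ex]] := Hpi _ _ Zs Zsc.
- exists (pi^* * t%:R ^+ 2); first by have := Zi_conj Zpi; move=> Zc; oi.
  rewrite mulrA Epi -natrX -natrM -Est natrD natrX.
  by transitivity (s%:R ^+ 2 - 'i ^+ 2 : algC); [ring|rewrite sqrCi; ring].
- exact: usq_pell Est H.
have : usq L pi^*.
  apply: usq_pell Est _; [exact: Zi_conj|by rewrite conjCK mulrC|].
  exists x^*; first exact: Zi_conj.
  by rewrite -rmorphM /= -Ex rmorphB rmorph_nat /= conjCi opprK.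
by apply: usq_divl => //; rewrite mulrC Epi; exact: usq_L_p.
Qed.

(** When [c c'] is [n] times a square, [c] and [c'] differ by a square of [Q(sqrt n)]. *)
Lemma quad_sqr_compl (n c c' r : nat) (z y : algC) : (0 < n)%N -> (0 < r)%N -> (0 < c')%N ->
  (c * c' = n * r ^ 2)%N -> quad Qi (sqrtC n%:R) z -> z ^+ 2 = c%:R * y ->
  exists2 z', quad Qi (sqrtC n%:R) z' & z' ^+ 2 = c'%:R * y.
Proof.
move=> n0 r0 c0 E Ez Hz; have Ef := E_subfield n.
have Ew : quad Qi (sqrtC n%:R) (sqrtC n%:R) by exact: E_w.
exists (z * c'%:R / (sqrtC n%:R * r%:R)); first by sf.
rewrite expr_div_n !exprMn Hz sqrtCK.
have Ec : c%:R * c'%:R = n%:R * r%:R ^+ 2 :> algC by rewrite -natrM E natrM natrX.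
have nn0 : n%:R != 0 :> algC by rewrite pnatr_eq0 -lt0n.
have rr0 : r%:R != 0 :> algC by rewrite pnatr_eq0 -lt0n.
transitivity (c%:R * c'%:R * y * c'%:R / (n%:R * r%:R ^+ 2)); first by field; rewrite nn0 rr0.
by rewrite Ec; field; rewrite nn0 rr0.
Qed.

(** * Conditions on a and x in terms of units times squares *)

Section Eps.
Variables (a b x y : int).
Hypothesis fum : fundamental_unit (Qsqrt m) (a%:~R + b%:~R * M).
Hypothesis fud : fundamental_unit (Qsqrt d) (x%:~R + y%:~R * D).

Let p10 := prime_gt0 pp1. Let p0 := prime_gt0 pp. Let q0 := prime_gt0 pq.
Let m0 : (0 < m)%N. Proof. by rewrite muln_gt0 p10. Qed.
Let d0 : (0 < d)%N. Proof. by rewrite !muln_gt0 p10 p0. Qed.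

(** The eight subproducts of 2, [p1], [q] reduce, by complement in [m = p1 q], to 1, 2, [p1] and
    [2 p1]. The hypothesis excludes 1, non-squareness of [eps] excludes 2, and the other two make
    [p1] a unit times a square. *)
Lemma nonsquare_a_usq : ~ square_pm 1 a -> usq L p1%:R.
Proof.
move=> na; apply: (usq_mono F2_L).
have [||bs sz [z Fz Ez]] := @eps_mask_primes m sm a b smM n4m fum [:: 2; p1; q]%N.
- by rewrite /= pp1 pq.
- move=> l pl; rewrite !Euclid_dvdM // !dvdn_prime2 // !inE.
  by case/orP=> [->|/orP[->|->]]; rewrite ?orbT.
have n1 z' : F2 z' -> z' ^+ 2 = 1%:R * (a + 1)%:~R -> False.
  by move=> Fz' Ez'; apply: na; apply/(square_pmP smM n4m fum (c := 1)) => //; exists z'.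
have n2 z' : F2 z' -> z' ^+ 2 = 2%:R * (a + 1)%:~R -> False.
  by move=> Fz'; apply: (eps_not_double smM n4m fum).
have y1 z' : F2 z' -> z' ^+ 2 = p1%:R * (a + 1)%:~R -> usq F2 p1%:R.
  by move=> Fz' Ez'; apply: (eps_usq smM n4m fum p10 Fz'); left.
have y2 z' : F2 z' -> z' ^+ 2 = (2 * p1)%N%:R * (a + 1)%:~R -> usq F2 p1%:R.
  by move=> Fz' Ez'; apply: (eps_usq smM n4m fum p10 Fz'); right; rewrite Ez' natrM.
have cpl c c' r : (0 < r)%N -> (0 < c')%N -> (c * c' = m * r ^ 2)%N ->
    z ^+ 2 = c%:R * (a + 1)%:~R -> exists2 z', F2 z' & z' ^+ 2 = c'%:R * (a + 1)%:~R.
  by move=> r0 c0 Ec; apply: quad_sqr_compl Ec Fz.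
have dir c c' : c = c' -> z ^+ 2 = c%:R * (a + 1)%:~R ->
    exists2 z', F2 z' & z' ^+ 2 = c'%:R * (a + 1)%:~R by move=> <-; exists z.
have p20 : (0 < 2 * p1)%N by rewrite muln_gt0 p10.
case: bs sz Ez => [|[] [|[] [|[] [|//]]]] //= _ Ez.
- by have [|z' kz' /n2[]] := cpl _ 2%N 2%N isT isT _ Ez; first by ring.
- by have [|z' kz' /y2] := dir _ (2 * p1)%N _ Ez; [ring|apply].
- by have [|z' kz' /y2] := cpl _ (2 * p1)%N 2%N isT p20 _ Ez; [ring|apply].
- by have [|z' kz' /n2[]] := dir _ 2%N _ Ez; first by ring.
- by have [|z' kz' /n1[]] := cpl _ 1%N 1%N isT isT _ Ez; first by ring.
- by have [|z' kz' /y1] := dir _ p1 _ Ez; [ring|apply].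
- by have [|z' kz' /y1] := cpl _ p1 1%N isT p10 _ Ez; [ring|apply].
- by have [|z' kz' /n1[]] := dir _ 1%N _ Ez; first by ring.
Qed.

Lemma square_x_usq : square_pm p%:Z x \/ square_pm (2 * p%:Z) x -> usq k p%:R.
Proof.
have p20 : (0 < 2 * p)%N by rewrite muln_gt0 p0.
case=> [/(square_pmP smD n4d fud p0)[z kz Ez]|].
  by apply: (eps_usq smD n4d fud p0 kz); left.
rewrite -PoszM => /(square_pmP smD n4d fud p20)[z kz Ez].
by apply: (eps_usq smD n4d fud p0 kz); right; rewrite Ez natrM.
Qed.

(** The sixteen subproducts of 2, [p1], [p], [q] reduce, by complement in [d], to the divisors of
    [2 p1 p]. Those prime to [p1] are excluded, 2 because [eps] is not a square and 1, [p], [2 p] by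
    hypothesis. *)
Lemma nonsquare_x_usq : ~ square_pm 1 x -> ~ square_pm p%:Z x -> ~ square_pm (2 * p%:Z) x ->
  usq k p1%:R \/ usq k (p1 * p)%N%:R.
Proof.
move=> nx1 nxp nx2p.
have p20 : (0 < 2 * p)%N by rewrite muln_gt0 p0.
have p1p0 : (0 < p1 * p)%N by rewrite muln_gt0 p10.
have [||bs sz [z kz Ez]] := @eps_mask_primes d sm x y smD n4d fud [:: 2; p1; p; q]%N.
- by rewrite /= pp1 pp pq.
- move=> l pl; rewrite !Euclid_dvdM // !dvdn_prime2 // !inE.
  by case/orP=> [->|/orP[/orP[->|->]|->]]; rewrite ?orbT.
have n1 z' : k z' -> z' ^+ 2 = 1%:R * (x + 1)%:~R -> False.
  by move=> kz' Ez'; apply: nx1; apply/(square_pmP smD n4d fud (c := 1)) => //; exists z'.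
have n2 z' : k z' -> z' ^+ 2 = 2%:R * (x + 1)%:~R -> False.
  by move=> kz'; apply: (eps_not_double smD n4d fud).
have n3 z' : k z' -> z' ^+ 2 = p%:R * (x + 1)%:~R -> False.
  by move=> kz' Ez'; apply: nxp; apply/(square_pmP smD n4d fud p0) => //; exists z'.
have n4 z' : k z' -> z' ^+ 2 = (2 * p)%N%:R * (x + 1)%:~R -> False.
  by move=> kz' Ez'; apply: nx2p; rewrite -PoszM; apply/(square_pmP smD n4d fud p20) => //; exists z'.
have y1 z' : k z' -> z' ^+ 2 = p1%:R * (x + 1)%:~R -> usq k p1%:R.
  by move=> kz' Ez'; apply: (eps_usq smD n4d fud p10 kz'); left.
have y2 z' : k z' -> z' ^+ 2 = (2 * p1)%N%:R * (x + 1)%:~R -> usq k p1%:R.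
  by move=> kz' Ez'; apply: (eps_usq smD n4d fud p10 kz'); right; rewrite Ez' natrM.
have y3 z' : k z' -> z' ^+ 2 = (p1 * p)%N%:R * (x + 1)%:~R -> usq k (p1 * p)%N%:R.
  by move=> kz' Ez'; apply: (eps_usq smD n4d fud p1p0 kz'); left.
have y4 z' : k z' -> z' ^+ 2 = (2 * (p1 * p))%N%:R * (x + 1)%:~R -> usq k (p1 * p)%N%:R.
  by move=> kz' Ez'; apply: (eps_usq smD n4d fud p1p0 kz'); right; rewrite Ez' natrM.
have cpl c c' r : (0 < r)%N -> (0 < c')%N -> (c * c' = d * r ^ 2)%N ->
    z ^+ 2 = c%:R * (x + 1)%:~R -> exists2 z', k z' & z' ^+ 2 = c'%:R * (x + 1)%:~R.
  by move=> r0 c0 Ec; apply: quad_sqr_compl Ec kz.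
have dir c c' : c = c' -> z ^+ 2 = c%:R * (x + 1)%:~R ->
    exists2 z', k z' & z' ^+ 2 = c'%:R * (x + 1)%:~R by move=> <-; exists z.
have p120 : (0 < 2 * p1)%N by rewrite muln_gt0 p10.
have p1p20 : (0 < 2 * (p1 * p))%N by rewrite muln_gt0 p1p0.
case: bs sz Ez => [|[] [|[] [|[] [|[] [|//]]]]] //= _ Ez.
- by have [|z' kz' /n2[]] := cpl _ 2%N 2%N isT isT _ Ez; first by ring.
- by right; have [|z' kz' /y4] := dir _ (2 * (p1 * p))%N _ Ez; [ring|apply].
- by have [|z' kz' /n4[]] := cpl _ (2 * p)%N 2%N isT p20 _ Ez; first by ring.
- by left; have [|z' kz' /y2] := dir _ (2 * p1)%N _ Ez; [ring|apply].
- by left; have [|z' kz' /y2] := cpl _ (2 * p1)%N 2%N isT p120 _ Ez; [ring|apply].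
- by have [|z' kz' /n4[]] := dir _ (2 * p)%N _ Ez; first by ring.
- by right; have [|z' kz' /y4] := cpl _ (2 * (p1 * p))%N 2%N isT p1p20 _ Ez; [ring|apply].
- by have [|z' kz' /n2[]] := dir _ 2%N _ Ez; first by ring.
- by have [|z' kz' /n1[]] := cpl _ 1%N 1%N isT isT _ Ez; first by ring.
- by right; have [|z' kz' /y3] := dir _ (p1 * p)%N _ Ez; [ring|apply].
- by have [|z' kz' /n3[]] := cpl _ p 1%N isT p0 _ Ez; first by ring.
- by left; have [|z' kz' /y1] := dir _ p1 _ Ez; [ring|apply].
- by left; have [|z' kz' /y1] := cpl _ p1 1%N isT p10 _ Ez; [ring|apply].
- by have [|z' kz' /n3[]] := dir _ p _ Ez; first by ring.
- by right; have [|z' kz' /y3] := cpl _ (p1 * p)%N 1%N isT p1p0 _ Ez; [ring|apply].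
- by have [|z' kz' /n1[]] := dir _ 1%N _ Ez; first by ring.
Qed.

Lemma square_sim (w0 c : algC) : L w0 -> w0 != 0 -> c = 1 \/ c = p%:R \/ c = 2 * p%:R ->
  exists ka z, [/\ ka ^+ 4 = 1, L z, z != 0 & 2 * c * w0 ^+ 2 = ka * z ^+ 2].
Proof.
move=> Lw w00 Hc; have i10 := one_i_neq0; have Pn0 := P_neq0.
have n2 : (2 : algC) != 0 by rewrite pnatr_eq0.
case: Hc => [->|[->|->]].
- exists (- 'i), ((1 + 'i) * w0); split; [exact: mi4|by sf|by rewrite mulf_neq0|].
  by transitivity (- 'i * (1 + 'i) ^+ 2 * w0 ^+ 2); [rewrite -two_i; ring|ring].
- exists (- 'i), ((1 + 'i) * P * w0); split; [exact: mi4|by sf|by rewrite !mulf_neq0|].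
  transitivity (- 'i * (1 + 'i) ^+ 2 * P ^+ 2 * w0 ^+ 2); last ring.
  by rewrite -two_i P2.
- exists 1, (2 * P * w0); split; [by rewrite expr1n|by sf|by rewrite !mulf_neq0|].
  by transitivity (4 * P ^+ 2 * w0 ^+ 2); [rewrite P2; ring|ring].
Qed.

(** Modulo squares [eps_m] is 2 and [eps_d] is one of 2, [2 p], [p]; as [p = P^2] and 2 is [-i]
    times a square, both are roots of unity times squares in [L]. *)
Lemma squares_not_usq : square_pm 1 a ->
  square_pm 1 x \/ square_pm p%:Z x \/ square_pm (2 * p%:Z) x -> ~ usq L p1%:R.
Proof.
move=> Ha Hx; apply: (usq_p1_false fum fud).
  have /(square_pmP smM n4m fum (c := 1))[] // := Ha => z Fz Ez.
  have [w0 Fw [w00 ->]] := eps_sim smM n4m fum (c := 1) isT Fz Ez.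
  by apply: square_sim => //; [exact: F2_L|left].
have p20 : (0 < 2 * p)%N by rewrite muln_gt0 p0.
have fin (c : nat) z : (0 < c)%N -> k z -> z ^+ 2 = c%:R * (x + 1)%:~R ->
    c%:R = 1 :> algC \/ c%:R = p%:R :> algC \/ c%:R = 2 * p%:R :> algC ->
    exists ka z, [/\ ka ^+ 4 = 1, L z, z != 0 & x%:~R + y%:~R * D = ka * z ^+ 2].
  move=> c0 kz Ez Hc; have [w0 kw [w00 ->]] := eps_sim smD n4d fud c0 kz Ez.
  by apply: square_sim => //; exact: k_L.
case: Hx => [|[|]].
- move/(square_pmP smD n4d fud (c := 1)) => -/(_ isT)[z kz Ez].
  by apply: (fin 1%N z) => //; left.
- move/(square_pmP smD n4d fud p0) => [z kz Ez].
  by apply: (fin p z) => //; right; left.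
rewrite -PoszM => /(square_pmP smD n4d fud p20)[z kz Ez].
by apply: (fin (2 * p)%N z) => //; right; right; rewrite natrM.
Qed.

End Eps.

(** * Generators of the kernel and the four cases *)

Section Classes.
Variables pi1 pi2 pi3 pi4 : algC.
Hypotheses (g1 : gprime pi1) (g2 : gprime pi2) (g3 : gprime pi3) (g4 : gprime pi4).
Hypotheses (c2 : pi2 = pi1^*) (c4 : pi4 = pi3^*).
Hypotheses (E12 : pi1 * pi2 = p1%:R) (E34 : pi3 * pi4 = p%:R).

Let Z1 : Zi pi1. Proof. by case: g1. Qed.
Let Z2 : Zi pi2. Proof. by case: g2. Qed.
Let Z3 : Zi pi3. Proof. by case: g3. Qed.
Let Z4 : Zi pi4. Proof. by case: g4. Qed.

Lemma d_factor : d%:R = pi1 * (pi2 * (pi3 * (pi4 * q%:R))).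
Proof. by rewrite !natrM -E12 -E34; ring. Qed.

(** The divisors of [d] up to units that omit [q]; a divisor [t] containing [q] is replaced by
    [d / t], which gives the same ideal class. *)
Definition mon (e1 e2 e3 e4 : bool) := pi1 ^+ e1 * (pi2 ^+ e2 * (pi3 ^+ e3 * pi4 ^+ e4)).

Lemma mon_Zi e1 e2 e3 e4 : Zi (mon e1 e2 e3 e4).
Proof. by rewrite /mon; oi. Qed.

Lemma mon_compl e1 e2 e3 e4 :
  mon e1 e2 e3 e4 * mon (~~ e1) (~~ e2) (~~ e3) (~~ e4) * q%:R = d%:R.
Proof.
have E (x : algC) (e : bool) : x ^+ e * x ^+ (~~ e) = x by case: e; rewrite /= ?mulr1 ?mul1r.
rewrite d_factor /mon; move: (E pi1 e1) (E pi2 e2) (E pi3 e3) (E pi4 e4).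
move: (pi1 ^+ e1) (pi1 ^+ ~~ e1) (pi2 ^+ e2) (pi2 ^+ ~~ e2) (pi3 ^+ e3) (pi3 ^+ ~~ e3)
      (pi4 ^+ e4) (pi4 ^+ ~~ e4) => x1 y1 x2 y2 x3 y3 x4 y4 <- <- <- <-.
by ring.
Qed.

Lemma mon_dvd e1 e2 e3 e4 : dvdi (mon e1 e2 e3 e4) d%:R.
Proof.
rewrite -(mon_compl e1 e2 e3 e4) -mulrA; exists (mon (~~ e1) (~~ e2) (~~ e3) (~~ e4) * q%:R) => //.
by have := mon_Zi (~~ e1) (~~ e2) (~~ e3) (~~ e4); move=> Zm; oi.
Qed.

Lemma usq_L_d : usq L d%:R.
Proof. by have := usq_sqr L_subfield L_D D_neq0; rewrite D2. Qed.

Lemma cap_kernel_mon A : cap_kernel k L A ->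
  exists e1 e2 e3 e4, A = ideal_class k (Hd (mon e1 e2 e3 e4)) /\ usq L (mon e1 e2 e3 e4).
Proof.
case/cap_kernel_Hd => t [Zt dv EA Ut].
have Zq : Zi q%:R by oi.
rewrite d_factor in dv.
have [|e1 [t1 [Zt1 dv1 E1]]] := gprime_split g1 _ Zt dv; first by oi.
have [|e2 [t2 [Zt2 dv2 E2]]] := gprime_split g2 _ Zt1 dv1; first by oi.
have [|e3 [t3 [Zt3 dv3 E3]]] := gprime_split g3 _ Zt2 dv2; first by oi.
have [e4 [t4 [Zt4 dv4 E4]]] := gprime_split g4 Zq Zt3 dv3.
have Et : t = t4 * mon e1 e2 e3 e4 by rewrite E1 E2 E3 E4 /mon; ring.
have Zm := mon_Zi e1 e2 e3 e4.
case: (dvdi_q Zt4 dv4) => [k4|[ka k4 Eka]].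
  exists e1, e2, e3, e4; split; first by rewrite EA Et Hd_unit.
  by rewrite Et in Ut; apply: (usq_divl L_subfield Ut); apply: usq_uni => //; apply: uni_unit4.
exists (~~ e1), (~~ e2), (~~ e3), (~~ e4).
have Zm' := mon_Zi (~~ e1) (~~ e2) (~~ e3) (~~ e4).
have k0 : ka != 0 by apply/eqP => k0; move/eqP: k4; rewrite k0 expr0n eq_sym oner_eq0.
have kV4 : ka^-1 ^+ 4 = 1 by rewrite exprVn k4 invr1.
have Ed : d%:R = t * (ka^-1 * mon (~~ e1) (~~ e2) (~~ e3) (~~ e4)).
  by rewrite -(mon_compl e1 e2 e3 e4) Et Eka; field.
split.
  have ZkV := unit4_Zi kV4.
  by rewrite EA (Hd_compl_class Zt _ Ed) ?(Hd_unit kV4 Zm') //; oi.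
have U : usq L (t * (ka^-1 * mon (~~ e1) (~~ e2) (~~ e3) (~~ e4))).
  by rewrite -Ed; exact: usq_L_d.
apply: (usq_divl L_subfield (usq_divl L_subfield U Ut)).
by apply: usq_uni => //; apply: uni_unit4.
Qed.

Lemma mon_nrm e1 e2 e3 e4 :
  nrm (mon e1 e2 e3 e4) = p1%:R ^+ (e1 + e2) * p%:R ^+ (e3 + e4).
Proof.
have n1 : nrm pi1 = p1%:R by rewrite /nrm -c2.
have n2 : nrm pi2 = p1%:R by rewrite /nrm c2 conjCK mulrC -c2.
have n3 : nrm pi3 = p%:R by rewrite /nrm -c4.
have n4 : nrm pi4 = p%:R by rewrite /nrm c4 conjCK mulrC -c4.
have nX z (e : bool) : nrm (z ^+ e) = nrm z ^+ e by case: e => //=; rewrite /nrm rmorph1 mulr1.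
by rewrite /mon !nrmM !nX n1 n2 n3 n4 !exprD; ring.
Qed.

(** If exactly one of [pi1], [pi2] occurred, the norm would be [p1] times a power of [p], which
    cannot happen for a unit times a square in [L]. *)
Lemma cap_kernel_class A : cap_kernel k L A ->
  exists e0 e3 e4, A = ideal_class k (Hd (mon e0 e0 e3 e4)) /\ usq L (mon e0 e0 e3 e4).
Proof.
case/cap_kernel_mon => e1 [e2 [e3 [e4 [EA Um]]]].
suff E : e1 = e2 by exists e1, e3, e4; rewrite {2 4}E.
apply/eqP; apply/negPn/negP => ne.
apply: (usq_norm_p1 (j := (e3 + e4)%N) _ Um); first by apply: Qi_L; case: (mon_Zi e1 e2 e3 e4).
by rewrite mon_nrm; case: e1 e2 ne {EA Um} => -[].
Qed.

Lemma usq_pi3 : usq L pi3. Proof. by apply: usq_pi => //; rewrite -c4. Qed.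
Lemma usq_pi4 : usq L pi4.
Proof. by apply: usq_pi => //; rewrite c4 conjCK mulrC -c4. Qed.

Lemma usq_mon_p1 e3 e4 : usq L (mon true true e3 e4) -> usq L p1%:R.
Proof.
have -> : mon true true e3 e4 = (pi3 ^+ e3 * pi4 ^+ e4) * p1%:R by rewrite -E12 /mon /=; ring.
move/(usq_divl L_subfield); apply.
have U1 : usq L 1 by have := usq_sqr L_subfield (sf1 L_subfield) (oner_neq0 _); rewrite expr1n.
by apply: usqM => //; [case: e3|case: e4] => //=; [exact: usq_pi3|exact: usq_pi4].
Qed.

Let dv3 : dvdi pi3 d%:R.
Proof. by have := mon_dvd false false true false; rewrite /mon /= !mulr1 !mul1r. Qed.
Let dv4 : dvdi pi4 d%:R.
Proof. by have := mon_dvd false false false true; rewrite /mon /= !mul1r. Qed.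
Let dv34 : dvdi (pi3 * pi4) d%:R.
Proof. by have := mon_dvd false false true true; rewrite /mon /= !mul1r. Qed.
Let dv12 : dvdi (pi1 * pi2) d%:R.
Proof. by have := mon_dvd true true false false; rewrite /mon /= !mulr1. Qed.
Let dv1 : dvdi pi1 d%:R.
Proof. by have := mon_dvd true false false false; rewrite /mon /= !mulr1. Qed.
Let dv2 : dvdi pi2 d%:R.
Proof. by have := mon_dvd false true false false; rewrite /mon /= !mulr1 !mul1r. Qed.

Section Subgroup.
Variable G : set (set (set algC)).
Hypothesis Gs : Cl_subgroup k G.

Lemma subgroup_Hd_mul t t' : Zi t -> Zi t' -> dvdi (t * t') d%:R ->
  G (ideal_class k (Hd t)) -> G (ideal_class k (Hd t')) -> G (ideal_class k (Hd (t * t'))).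
Proof.
move=> Zt Zt' dv Gt Gt'; rewrite -Hd_mul // -class_mulE //; try exact: Hd_nz.
by case: Gs => _ _ H _; apply: H.
Qed.

Lemma subgroup_Hd1 : G (ideal_class k (Hd 1)).
Proof.
rewrite Hd_class_one; [by case: Gs|by oi|by exists d%:R; [oi|rewrite mul1r]|].
by have := usq_sqr k_subfield (sf1 k_subfield) (oner_neq0 _); rewrite expr1n.
Qed.

Lemma subgroup_mon (e0 e3 e4 : bool) :
  (e0 -> G (ideal_class k (Hd (pi1 * pi2)))) ->
  G (ideal_class k (Hd pi3)) -> G (ideal_class k (Hd pi4)) ->
  G (ideal_class k (Hd (mon e0 e0 e3 e4))).
Proof.
move=> G0 G3 G4.
have GX t (e : bool) : G (ideal_class k (Hd t)) -> G (ideal_class k (Hd (t ^+ e))).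
  by case: e => //= _; exact: subgroup_Hd1.
have Em : mon e0 e0 e3 e4 = (pi1 * pi2) ^+ e0 * (pi3 ^+ e3 * pi4 ^+ e4).
  by rewrite /mon exprMn !mulrA.
have G34 : G (ideal_class k (Hd (pi3 ^+ e3 * pi4 ^+ e4))).
  apply: subgroup_Hd_mul; [by oi|by oi| |exact: GX|exact: GX].
  by have := mon_dvd false false e3 e4; rewrite /mon /= !mul1r.
rewrite Em; apply: subgroup_Hd_mul => //; [by oi|by oi|by rewrite -Em; exact: mon_dvd|].
by case: e0 G0 {Em} => [H|_]; [apply: GX; apply: H|exact: subgroup_Hd1].
Qed.

End Subgroup.

Variables H1 H2 H3 H4 : set algC.
Hypotheses (P1 : prime_lying_over k pi1 H1) (P2' : prime_lying_over k pi2 H2).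
Hypotheses (P3 : prime_lying_over k pi3 H3) (P4 : prime_lying_over k pi4 H4).
Variables (a b x y : int).
Hypothesis fum : fundamental_unit (Qsqrt m) (a%:~R + b%:~R * M).
Hypothesis fud : fundamental_unit (Qsqrt d) (x%:~R + y%:~R * D).

Let EH3 : H3 = Hd pi3. Proof. exact: prime_over_Hd. Qed.
Let EH4 : H4 = Hd pi4. Proof. exact: prime_over_Hd. Qed.
Let EH12 : ideal_mul k H1 H2 = Hd (pi1 * pi2).
Proof. by rewrite (prime_over_Hd Z1 dv1 P1) (prime_over_Hd Z2 dv2 P2') Hd_mul. Qed.

Let cap3 : cap_kernel k L (ideal_class k H3).
Proof. by rewrite EH3; apply: Hd_capitulates => //; exact: usq_pi3. Qed.
Let cap4 : cap_kernel k L (ideal_class k H4).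
Proof. by rewrite EH4; apply: Hd_capitulates => //; exact: usq_pi4. Qed.
Let cap12 : usq L p1%:R -> cap_kernel k L (ideal_class k (ideal_mul k H1 H2)).
Proof. by move=> U; rewrite EH12; apply: Hd_capitulates; [oi|exact: dv12|rewrite E12]. Qed.

(** Reduces each case to three classes. That of [H1 H2] is required only when [p1] is a unit times a
    square in [L], because otherwise no divisor containing [pi1 pi2] capitulates. *)
Lemma cap_kernel_gen S : S `<=` cap_kernel k L ->
  (forall G, Cl_subgroup k G -> S `<=` G ->
     [/\ usq L p1%:R -> G (ideal_class k (Hd (pi1 * pi2))),
         G (ideal_class k (Hd pi3)) & G (ideal_class k (Hd pi4))]) ->
  cap_kernel k L = Cl_gen k S.
Proof.
move=> SK HG; apply/seteqP; split=> [A KA G [Gs SG]|A].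
  have [e0 [e3 [e4 [-> Um]]]] := cap_kernel_class KA.
  have [G0 G3 G4] := HG G Gs SG.
  apply: subgroup_mon => // e0t; apply: G0; apply: (@usq_mon_p1 e3 e4).
  by move: Um; rewrite e0t.
by apply; split=> //; exact: kappa_subgroup.
Qed.

Let swap34 : usq k p%:R -> ideal_class k (Hd pi4) = ideal_class k (Hd pi3).
Proof.
move=> U; apply: Hd_class_swap => //; first by rewrite mulrC; exact: dv34.
by rewrite mulrC E34.
Qed.

Theorem kappa_cases :
  let case1 := square_pm 1 x /\ ~ square_pm 1 a in
  let case2 := square_pm 1 a /\
               (square_pm p%:Z x \/ square_pm (2 * p%:Z) x) in
  let case3 := ~ square_pm 1 a /\
               (square_pm p%:Z x \/ square_pm (2 * p%:Z) x) in
  [/\ case1 ->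
        cap_kernel k L =
        Cl_gen k [set ideal_class k H3; ideal_class k H4;
                      ideal_class k (ideal_mul k H1 H2)],
      case2 ->
        cap_kernel k L = Cl_gen k [set ideal_class k H3],
      case3 ->
        cap_kernel k L =
        Cl_gen k [set ideal_class k H3; ideal_class k (ideal_mul k H1 H2)] &
      ~ case1 -> ~ case2 -> ~ case3 ->
        cap_kernel k L =
        Cl_gen k [set ideal_class k H3; ideal_class k H4]].
Proof.
move=> case1 case2 case3; split.
- move=> [Hx Ha]; have U := nonsquare_a_usq fum Ha.
  apply: cap_kernel_gen => [A [[]|]|G Gs SG]; try move=> ->.
  + exact: cap3.
  + exact: cap4.
  + exact: cap12.
  rewrite -EH12 -EH3 -EH4; split; [move=> _|..]; apply: SG.
  + by right.
  + by left; left.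
  + by left; right.
- move=> [Ha Hx]; have U := square_x_usq fud Hx.
  have nU := squares_not_usq fum fud Ha (or_intror Hx).
  apply: cap_kernel_gen => [A /= ->|G Gs SG]; first exact: cap3.
  (* [p] is a unit times a square in [k], so [H3] and [H4] have the same class, and [p1] contributes
     nothing. *)
  by split=> [/nU[]||]; rewrite ?(swap34 U) -EH3; apply: SG.
- move=> [Ha Hx]; have U := square_x_usq fud Hx; have U1 := nonsquare_a_usq fum Ha.
  apply: cap_kernel_gen => [A [|]|G Gs SG]; try move=> ->.
  + exact: cap3.
  + exact: cap12.
  by split=> [_||]; rewrite ?(swap34 U) -?EH12 -?EH3; apply: SG; [right|left|left].
move=> n1 n2 n3.
apply: cap_kernel_gen => [A [|]|G Gs SG]; try move=> ->.
- exact: cap3.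
- exact: cap4.
have G3 : G (ideal_class k (Hd pi3)) by rewrite -EH3; apply: SG; left.
have G4 : G (ideal_class k (Hd pi4)) by rewrite -EH4; apply: SG; right.
split=> // U.
have nx : ~ (square_pm p%:Z x \/ square_pm (2 * p%:Z) x).
  by move=> Hx; have [Ha|Ha] := pselect (square_pm 1 a); [apply: n2|apply: n3].
(* If [x + 1] or [x - 1] is a square, then so is [a + 1] or [a - 1], case 1 being excluded, and [p1]
   is not a unit times a square in [L]. *)
have [Hx|Hx] := pselect (square_pm 1 x).
  have Ha : square_pm 1 a by apply: contrapT => Ha; apply: n1.
  by have nU := squares_not_usq fum fud Ha (or_introl Hx); case: (nU U).
(* Otherwise [p1] or [p1 p] is a unit times a square already in [k]: the class of [H1 H2] is
   trivial, or equal to that of [H3 H4]. *)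
have [||Uk|Uk] := nonsquare_x_usq fud Hx.
- by move=> H; apply: nx; left.
- by move=> H; apply: nx; right.
- by rewrite Hd_class_one; [case: Gs|oi|exact: dv12|rewrite E12].
have -> : ideal_class k (Hd (pi1 * pi2)) = ideal_class k (Hd (pi3 * pi4)).
  apply: Hd_class_swap; [by oi|by oi| |by rewrite E12 E34 -natrM].
  by have := mon_dvd true true true true; rewrite /mon /= !mulrA.
exact: subgroup_Hd_mul.
Qed.

End Classes.

End Fields.

(** * Identification of the fields and choice of the automorphisms *)

Lemma field_k d : field_gen [set sqrtC d%:R; 'i] = quad Qi (sqrtC d%:R).
Proof.
apply: quad_eq_field => //.
- by rewrite sqrtCK; sf.
- apply: field_gen_min; first exact: field_gen_subfield.
  by move=> _ /= ->; apply: field_gen_sub; right.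
- by apply: field_gen_sub; left.
- move=> z [->|->]; first exact: quad_gen.
  exact: quad_base.
Qed.

Lemma adjoin_quad K w : subfield K -> K (w ^+ 2) -> adjoin K w = quad K w.
Proof.
move=> Kf Kw2; apply: quad_eq_field => //.
- by move=> x Kx; apply: field_gen_sub; right.
- by apply: field_gen_sub; left.
- by move=> z [->|Kz]; [exact: quad_gen|exact: quad_base].
Qed.

Lemma gauss_conj (u v : nat) : (u%:R + 2 * 'i * v%:R : algC)^* = u%:R - 2 * 'i * v%:R.
Proof. by rewrite rmorphD !rmorphM !rmorph_nat /= conjCi; ring. Qed.

Lemma gauss_mul (n u v : nat) : n = (u ^ 2 + 4 * v ^ 2)%N ->
  (u%:R + 2 * 'i * v%:R) * (u%:R - 2 * 'i * v%:R) = n%:R :> algC.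
Proof.
move=> ->; rewrite natrD natrM !natrX.
transitivity (u%:R ^+ 2 - 4 * 'i ^+ 2 * v%:R ^+ 2 : algC); first ring.
by rewrite sqrCi; ring.
Qed.

Theorem theorem5p5 (p1 p2 q e f g h : nat) (a b x y : int)
    (H1 H2 H3 H4 : set algC) :
  let k := field_gen [set sqrtC (p1 * p2 * q)%N%:R; 'i] in
  let K2 := adjoin k (sqrtC p2%:R) in
  prime p1 -> prime p2 -> prime q -> uniq [:: p1; p2; q] ->
  (p1 = 1 %[mod 4])%N -> (p2 = 1 %[mod 4])%N -> (q = 3 %[mod 4])%N ->
  p1 = (e ^ 2 + 4 * f ^ 2)%N -> p2 = (g ^ 2 + 4 * h ^ 2)%N ->
  prime_lying_over k (e%:R + 2 * 'i * f%:R) H1 ->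
  prime_lying_over k (e%:R - 2 * 'i * f%:R) H2 ->
  prime_lying_over k (g%:R + 2 * 'i * h%:R) H3 ->
  prime_lying_over k (g%:R - 2 * 'i * h%:R) H4 ->
  fundamental_unit (Qsqrt (p1 * q))
    (a%:~R + b%:~R * sqrtC (p1 * q)%N%:R) ->
  fundamental_unit (Qsqrt (p1 * p2 * q))
    (x%:~R + y%:~R * sqrtC (p1 * p2 * q)%N%:R) ->
  let case1 := square_pm 1 x /\ ~ square_pm 1 a in
  let case2 := square_pm 1 a /\
               (square_pm p2%:Z x \/ square_pm (2 * p2%:Z) x) in
  let case3 := ~ square_pm 1 a /\
               (square_pm p2%:Z x \/ square_pm (2 * p2%:Z) x) in
  [/\ case1 ->
        cap_kernel k K2 =
        Cl_gen k [set ideal_class k H3; ideal_class k H4;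
                      ideal_class k (ideal_mul k H1 H2)],
      case2 ->
        cap_kernel k K2 = Cl_gen k [set ideal_class k H3],
      case3 ->
        cap_kernel k K2 =
        Cl_gen k [set ideal_class k H3; ideal_class k (ideal_mul k H1 H2)] &
      ~ case1 -> ~ case2 -> ~ case3 ->
        cap_kernel k K2 =
        Cl_gen k [set ideal_class k H3; ideal_class k H4]].
Proof.
move=> k K2 pp1 pp pq uq m1 mp mq Ep1 Ep2 P1 P2 P3 P4 fum fud.
move: uq; rewrite /= !inE negb_or andbT => /andP[/andP[ne1 ne2] ne3].
rewrite /= in m1 mp mq.
rewrite /K2 /k field_k adjoin_quad; [|exact: E_subfield|by rewrite sqrtCK; have Ef := E_subfield; sf].
rewrite /k field_k in P1 P2 P3 P4.
have E12 := gauss_mul Ep1; have E34 := gauss_mul Ep2.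
have p10 : p1%:R != 0 :> algC by rewrite pnatr_eq0 -lt0n prime_gt0.
have p20 : p2%:R != 0 :> algC by rewrite pnatr_eq0 -lt0n prime_gt0.
have [e0 e0'] : e%:R + 2 * 'i * f%:R != 0 :> algC /\ e%:R - 2 * 'i * f%:R != 0 :> algC.
  by apply/andP; rewrite -negb_or -mulf_eq0 E12.
have [g0 g0'] : g%:R + 2 * 'i * h%:R != 0 :> algC /\ g%:R - 2 * 'i * h%:R != 0 :> algC.
  by apply/andP; rewrite -negb_or -mulf_eq0 E34.
have F2f := E_subfield (p1 * q); have F1f := E_subfield p2.
(* [sp] exists because [p2] is not a square in [Q(i, sqrt (p1 q))], and [sm] because [p1 q] is not a
   square in [Q(i, sqrt p2)]. *)
have [sp [spF spP]] : exists nu : {rmorphism algC -> algC},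
    (forall z, z \in [:: 'i; sqrtC (p1 * q)%N%:R] -> nu z = z) /\
    nu (sqrtC p2%:R) = - sqrtC p2%:R.
  apply: (quadratic_automorphism F2f) => [z||]; last by rewrite sqrtCK rpred_nat.
    by rewrite !inE => /orP[]/eqP ->; [exact: E_i|exact: E_w].
  move/E_sqr_nat => /(_ p2 (sqrtCK _)) [].
    by apply: (@nsq_primes p2 [::]) => //=; ring.
  by apply: (@nsq_primes p2 [:: p1; q]) => //=; [rewrite pp1 pq|rewrite !inE negb_or eq_sym ne1|ring].
have [sm [smF smM]] : exists nu : {rmorphism algC -> algC},
    (forall z, z \in [:: 'i; sqrtC p2%:R] -> nu z = z) /\
    nu (sqrtC (p1 * q)%N%:R) = - sqrtC (p1 * q)%N%:R.
  apply: (quadratic_automorphism F1f) => [z||]; last by rewrite sqrtCK rpred_nat.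
    by rewrite !inE => /orP[]/eqP ->; [exact: E_i|exact: E_w].
  move/E_sqr_nat => /(_ (p1 * q)%N (sqrtCK _)) [].
    by apply: (@nsq_primes p1 [:: q]) => //=; [rewrite pq|rewrite inE|ring].
  by apply: (@nsq_primes p1 [:: q; p2]) => //=; [rewrite pq pp|rewrite !inE negb_or ne2|ring].
have spi := spF 'i (mem_head _ _); have smi := smF 'i (mem_head _ _).
have spM : sp (sqrtC (p1 * q)%N%:R) = sqrtC (p1 * q)%N%:R by apply: spF; rewrite !inE eqxx orbT.
have smP : sm (sqrtC p2%:R) = sqrtC p2%:R by apply: smF; rewrite !inE eqxx orbT.
have ZG (u v : nat) : int_ring Qi (u%:R + 2 * 'i * v%:R) by oi.
have ZG' (u v : nat) : int_ring Qi (u%:R - 2 * 'i * v%:R) by oi.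
apply: (kappa_cases pp1 pp pq ne1 ne2 ne3 m1 mp mq spi spP spM smi smP smM
  _ _ _ _ (esym (gauss_conj e f)) (esym (gauss_conj g h)) E12 E34 P1 P2 P3 P4 fum fud).
- exact: prime_over_gprime (ZG e f) e0 P1.
- exact: prime_over_gprime (ZG' e f) e0' P2.
- exact: prime_over_gprime (ZG g h) g0 P3.
- exact: prime_over_gprime (ZG' g h) g0' P4.
Qed.
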